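(* Let $d\ge1$, let $\varphi\in L^2(\mathbb{R}^{2d})$, let $J\subseteq\mathbb{N}$, and let $\{g_n\}_{n\in J}$ be an orthonormal sequence of functions in $L^2(\mathbb{R}^d)$ such that, for all $n\in J$ and for almost every $x,\omega\in\mathbb{R}^d$, $$|Rg_n(x,\omega)|\le|\varphi(x,\omega)|.$$ Then the sequence $\{g_n\}_{n\in J}$ must be finite (that is, $J$ is finite).
   Context: Functions are complex-valued. The Fourier transform on $\mathbb{R}^d$ is $\hat f(\omega)=\int_{\mathbb{R}^d}f(x)e^{-2\pi i x\cdot\omega}\,dx$, extended to $L^2(\mathbb{R}^d)$ as a unitary operator. The Rihaczek distribution of $f\in L^2(\mathbb{R}^d)$ is $$Rf(x,\omega)=e^{-2\pi i x\cdot\omega}f(x)\overline{\hat f(\omega)},\qquad x,\omega\in\mathbb{R}^d.$$ *)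

(* Defs.v *)
From HB Require Import structures.
From mathcomp Require Import all_boot all_order all_algebra.
From mathcomp Require Import all_classical all_reals all_analysis.
From mathcomp Require Import complex.

Set Implicit Arguments.
Unset Strict Implicit.
Unset Printing Implicit Defensive.

Import Order.TTheory GRing.Theory Num.Theory.
Import numFieldNormedType.Exports.

Local Open Scope classical_set_scope.
Local Open Scope ring_scope.

(* [measurableTypeR R] is R with its Borel sigma-algebra and a tuple type
   carries the product sigma-algebra: this is R^d with its Borel sets. *)
Notation euclid R d := (d.-tuple (measurableTypeR R)) (only parsing).

Section LebesgueTuple.
Variable R : realType.

Definition cons_pair n (z : measurableTypeR R * euclid R n) : euclid R n.+1 :=
  [tuple of z.1 :: z.2].

Lemma measurable_cons_pair n : measurable_fun [set: _] (@cons_pair n).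
Proof. exact: measurable_cons. Qed.

Section Step.
Variables (n : nat) (m : {sigma_finite_measure set (euclid R n) -> \bar R}).

Definition lebesgue_step : set (euclid R n.+1) -> \bar R :=
  pushforward (lebesgue_measure \x m)%E (@cons_pair n).

Let measurable_preimage_cons (A : set (euclid R n.+1)) :
  measurable A -> measurable (@cons_pair n @^-1` A).
Proof.
by move=> mA; rewrite -[X in measurable X]setTI; exact: measurable_cons_pair.
Qed.

Let lebesgue_step0 : lebesgue_step set0 = 0%E.
Proof. by rewrite /lebesgue_step /pushforward preimage_set0 measure0. Qed.

Let lebesgue_step_ge0 A : (0 <= lebesgue_step A)%E.
Proof. exact: (measure_ge0 (lebesgue_measure \x m)%E). Qed.

Let lebesgue_step_sigma_additive : semi_sigma_additive lebesgue_step.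
Proof.
move=> F mF tF mUF; rewrite /lebesgue_step /pushforward preimage_bigcup.
apply: measure_semi_sigma_additive.
- by move=> k; exact: measurable_preimage_cons.
- apply/trivIsetP => /= i j _ _ ij; rewrite -preimage_setI.
  by move/trivIsetP : tF => /(_ _ _ _ _ ij) ->//; rewrite preimage_set0.
- by rewrite -preimage_bigcup; exact: measurable_preimage_cons.
Qed.

HB.instance Definition _ := isMeasure.Build _ _ _ lebesgue_step
  lebesgue_step0 lebesgue_step_ge0 lebesgue_step_sigma_additive.

Let lebesgue_step_sigma_finite : sigma_finite setT lebesgue_step.
Proof.
have /sigma_finiteP[F [TF ndF Foo]] :=
  sigma_finiteT (@lebesgue_measure R : {sigma_finite_measure set _ -> \bar R}).
have /sigma_finiteP[G [TG ndG Goo]] := sigma_finiteT m.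
pose E k := [set t : euclid R n.+1 |
  F k (tnth t ord0) /\ G k [tuple of behead t]].
exists E.
  apply/esym/seteqP; split=> // t _.
  have [i _ Fi] : (\bigcup_k F k) (tnth t ord0) by rewrite -TF.
  have [j _ Gj] : (\bigcup_k G k) [tuple of behead t] by rewrite -TG.
  exists (maxn i j) => //; split.
    by move: Fi; exact/subsetPset/ndF/leq_maxl.
  by move: Gj; exact/subsetPset/ndG/leq_maxr.
move=> k; have [mF Fk] := Foo k; have [mG Gk] := Goo k; split.
  rewrite (_ : E k = ((@tnth n.+1 _)^~ ord0 @^-1` F k) `&`
      ((fun t : euclid R n.+1 => [tuple of behead t]) @^-1` G k))//.
  apply: measurableI; rewrite -[X in measurable X]setTI.
    exact: measurable_tnth.
  exact: measurable_behead.
rewrite /lebesgue_step /pushforward (_ : _ @^-1` _ = F k `*` G k); last first.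
  apply/seteqP; split=> -[x t]/= [Fx Gt]; split=> //=.
    by move: Gt; congr (G k _); exact: val_inj.
  by move: Gt; congr (G k _); exact: val_inj.
by rewrite product_measure1E// lte_mul_pinfty// ge0_fin_numE.
Qed.

HB.instance Definition _ := Measure_isSigmaFinite.Build _ _ _ lebesgue_step
  lebesgue_step_sigma_finite.

End Step.

Fixpoint lebesgue_tuple (n : nat) :
    {sigma_finite_measure set (euclid R n) -> \bar R} :=
  match n with
  | 0 => dirac ([tuple] : euclid R 0)
  | n'.+1 => lebesgue_step (lebesgue_tuple n')
  end.

Lemma lebesgue_tuple_box n (A : 'I_n -> set (measurableTypeR R)) :
  (forall i, measurable (A i)) ->
  lebesgue_tuple n [set t | forall i, A i (tnth t i)] =
  (\prod_(i < n) lebesgue_measure (A i))%E.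
Proof.
elim: n => [|n IHn] in A * => mA.
  rewrite big_ord0 /= diracE mem_set//; last by case.
rewrite big_ord_recl -IHn//= /lebesgue_step /pushforward.
have mB : measurable [set t : euclid R n | forall i, A (lift ord0 i) (tnth t i)].
  rewrite (_ : [set t | _] =
      \bigcap_(i in [set: 'I_n]) ((@tnth n _)^~ i @^-1` A (lift ord0 i))).
    apply: fin_bigcap_measurable => // i _.
    by rewrite -[X in measurable X]setTI; exact: measurable_tnth.
  by apply/seteqP; split=> t /= At i => [_|]; exact: At.
rewrite -product_measure1E//; congr (_ _).
apply/seteqP; split=> [[x t]/= At|[x t]/= [Ax At] i].
  split; first exact: At ord0.
  by move=> i; have := At (lift ord0 i); rewrite tnthS.
by have [j ->|->//] := unliftP ord0 i; rewrite tnthS.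
Qed.

End LebesgueTuple.

Section ComplexFunctions.
Local Open Scope complex_scope.
Context d (T : measurableType d) (R : realType).
Variable mu : {measure set T -> \bar R}.
Implicit Types f g : T -> R[i].

Definition cmodulus (z : R[i]) : R := ComplexField.Normc.normc z.

Definition cmeasurable f :=
  measurable_fun [set: T] (fun x => complex.Re (f x)) /\
  measurable_fun [set: T] (fun x => complex.Im (f x)).

Definition cLnorm (p : \bar R) f : \bar R :=
  Lnorm mu p (fun x => (cmodulus (f x))%:E).

Definition cLp (p : \bar R) : set (T -> R[i]) :=
  [set f | cmeasurable f /\ (cLnorm p f < +oo)%E].

Definition cintegral f : R[i] :=
  (\int[mu]_x complex.Re (f x)) +i* (\int[mu]_x complex.Im (f x)).

Definition cinner f g : R[i] := cintegral (fun x => f x * (g x)^*).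

Definition orthonormal_on (J : set nat) (g : nat -> T -> R[i]) :=
  forall n m, J n -> J m -> cinner (g n) (g m) = (n == m)%:R.

End ComplexFunctions.

Section Fourier.
Local Open Scope complex_scope.
Context {R : realType} {d : nat}.
Implicit Types (x w : euclid R d) (f h : euclid R d -> R[i]).

Definition dot x w : R := \sum_(i < d) tnth x i * tnth w i.

Definition cexpi (t : R) : R[i] := cos t +i* sin t.

Definition fourier1 f : euclid R d -> R[i] := fun w =>
  cintegral (lebesgue_tuple R d) (fun x => f x * cexpi (- (2 * pi * dot x w))).

(* The graph of the L^2 Fourier transform: the closure in L^2 x L^2 of the graph
   of [fourier1] restricted to L^1 /\ L^2. *)
Definition is_fourier2 f h :=
  [/\ cLp (lebesgue_tuple R d) 2%:E f, cLp (lebesgue_tuple R d) 2%:E h &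
   exists u : nat -> euclid R d -> R[i],
    [/\ forall k, cLp (lebesgue_tuple R d) 1 (u k) /\
                  cLp (lebesgue_tuple R d) 2%:E (u k),
     (fun k => cLnorm (lebesgue_tuple R d) 2%:E (u k \- f)) @ \oo --> 0%E &
     (fun k => cLnorm (lebesgue_tuple R d) 2%:E (fourier1 (u k) \- h)) @ \oo
       --> 0%E]].

(* By Plancherel's theorem every f in L^2 has such a transform, unique almost
   everywhere; one representative is chosen. *)
Definition fourier2 f : euclid R d -> R[i] :=
  xget (fun=> 0) [set h | is_fourier2 f h].

Definition rihaczek f (z : euclid R d * euclid R d) : R[i] :=
  cexpi (- (2 * pi * dot z.1 z.2)) * f z.1 * (fourier2 f z.2)^*.

End Fourier.

(* Main.v *)
Require Import Defs.
From HB Require Import structures.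
From mathcomp Require Import all_boot all_order all_algebra.
From mathcomp Require Import all_classical all_reals all_analysis.
From mathcomp Require Import measurable_realfun complex.
From mathcomp Require Import ring lra.

Set Implicit Arguments.
Unset Strict Implicit.
Unset Printing Implicit Defensive.

Import Order.TTheory GRing.Theory Num.Theory.
Import numFieldNormedType.Exports.

Local Open Scope classical_set_scope.
Local Open Scope ring_scope.

(** The functions [g n] and their transforms [h n] are dominated in L2 uniformly
    in [n], so they cannot escape to infinity in time or in frequency, whereas
    an orthonormal family has to escape somewhere.

    The modulus of the Rihaczek distribution is [|g(x)| |h(w)|].  Squaring the
    domination and integrating over the points whose first coordinate leaves a
    cube [C] bounds [|h|^2] times the energy of [g] outside [C] by the integral
    of [|phi|^2] outside [C x C], and symmetrically for [h] ([tail_energy_le],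
    [energy_tail_le]).  Both [g n] and [h n] have energy bounded below, so a
    single cube leaves out only a small fixed share of the energy of every [g n]
    and every [h n].  Let [p n] be [g n] cut to [C].  Its transform is close to
    [h n] in L2, hence has energy at least 1/20 inside [C].  At each frequency
    [w], however, this transform is the coefficient of [g n] on the exponential
    of frequency [w] cut to [C], so that Bessel's inequality bounds the sum over
    [n] of its squared modulus by [2 |C|] ([sum_fourier1_cut_le]).  Integrating
    over [w] in [C], at most [40 |C|^2] indices can occur.

    Two facts about the L2 Fourier transform are used: it exists
    ([fourier2_exists]), and it changes energies by bounded factors only
    ([fourier2_energy_ge], [fourier2_energyB_le]).  Both come from Plancherel's
    identity on the intersection of L1 and L2 ([plancherel]), and existence
    also from completeness of L2 ([riesz_fischer]).

    For Plancherel, the squared modulus of the Fourier integral of [f] is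
    integrated against the weight [exp (- e (|w_1| + ... + |w_d|))].  By Fubini
    this equals the integral of [f(x) conj(f(y))] against a product of Poisson
    kernels, that is [|f|^2] minus half the mean square oscillation of [f] for
    this kernel ([weighted_ft_osc]).  As [e] tends to 0 the weight increases to
    1, and it remains to see that the oscillation vanishes ([tame_tuple]).  On
    the line this holds for indicators by outer regularity of Lebesgue measure
    ([tame_line_indic]), then for all L2 functions by approximation; in higher
    dimension coordinates are changed one block at a time ([tame_step]).

    Norms enter only through their squares, compared by the inequality
    [|a + b|^2 <= 2 |a|^2 + 2 |b|^2]. *)

(** * Exponential weights on the line *)

Section line_integrals.
Context {R : realType}.
Notation lb := (@lebesgue_measure R).

Lemma ge0_integral_line_split (f : R -> R) : continuous f ->
    (forall x, 0 <= f x) ->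
  (\int[lb]_x (f x)%:E = \int[lb]_(x in `[0%R, +oo[) (f x)%:E +
    \int[lb]_(x in `[0%R, +oo[) (f (- x)%R)%:E)%E.
Proof.
move=> cf f0.
have mf : measurable_fun [set: R] f by exact: continuous_measurable_fun.
have mp : measurable [set x : R | 0 <= x] by rewrite -set_itvcy.
rewrite -(setUv [set x : R | 0 <= x]%R) ge0_integral_setU//= ; last 4 first.
  exact: measurableC.
  by apply/measurable_EFinP; rewrite setUv.
  by move=> x _; rewrite lee_fin.
  exact/disj_setPCl.
rewrite -set_itvcy// setCitvr.
rewrite integral_itv_bndo_bndc; last exact/measurable_EFinP/measurable_funTS.
rewrite -{2}oppr0 ge0_integration_by_substitutionNy//.
exact: continuous_subspaceT.
Qed.

Lemma ge0_half_line_FTC (f F : R -> R) (l : R) : continuous f ->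
    (forall x, 0 <= x -> 0 <= f x) ->
    (forall x, is_derive x (1 : R) F (f x)) -> F x @[x --> +oo] --> l ->
  (\int[lb]_(x in `[0%R, +oo[) (f x)%:E = (l - F 0)%:E)%E.
Proof.
move=> cf f0 dF Fl; have cF : continuous F.
  move=> x; apply/differentiable_continuous/derivable1_diffP.
  by have := dF x => -[].
rewrite (@ge0_continuous_FTC2y R f F 0 l)// ?EFinB//.
- exact: continuous_subspaceT.
- by apply: cvg_at_right_filter; exact: cF.
- by move=> x _; rewrite derive1E; have := dF x => -[].
Qed.

Lemma ge0_line_FTC (f F : R -> R) (l l' : R) : continuous f ->
    (forall x, 0 <= f x) -> (forall x, is_derive x (1 : R) F (f x)) ->
    F x @[x --> +oo] --> l -> F x @[x --> -oo] --> l' ->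
  (\int[lb]_x (f x)%:E = (l - l')%:E)%E.
Proof.
move=> cf f0 dF Fl Fl'; rewrite ge0_integral_line_split//.
rewrite (ge0_half_line_FTC _ _ _ Fl)//.
have dF' (x : R) : is_derive x (1 : R) (fun x => - F (- x)) (f (- x)).
  have H : is_derive x (1 : R) (- (F \o -%R)) (- (f (- x) * - 1)).
    exact: is_deriveN.
  by rewrite mulrN1 opprK in H; exact: H.
rewrite (@ge0_half_line_FTC (f \o -%R) (fun x => - F (- x)) (- l'))//.
- by rewrite oppr0 -EFinD; congr (_%:E); lra.
- by move=> x; apply: continuous_comp; [exact: opp_continuous|exact: cf].
- by move=> x _; exact: f0.
- by apply: cvgN; exact/cvgNy_compNP.
Qed.

End line_integrals.

Section abel_weight.
Context {R : realType}.
Notation lb := (@lebesgue_measure R).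
Variables (e c : R).
Hypothesis e0 : 0 < e.

Let D : R := e ^+ 2 + c ^+ 2.
Let D0 : D != 0.
Proof. by rewrite gt_eqF// ltr_pwDl ?sqr_ge0// exprn_gt0. Qed.

(** Read off from the real and imaginary parts of the primitive of
    [exp ((- e + i c) w)]. *)
Let prim (a b : R) (w : R) : R := expR (- e * w) *
  (- e^-1 + (a * (c * sin (c * w) - e * cos (c * w)) -
             b * (c * cos (c * w) + e * sin (c * w))) / D).

Let dprim a b (w : R) : is_derive w (1 : R) (prim a b)
  (expR (- e * w) * (1 + a * cos (c * w) + b * sin (c * w))).
Proof.
apply: is_derive_eq; rewrite /GRing.scale/= /D.
by field; apply/andP; split; [exact: D0|rewrite gt_eqF].
Qed.

Let cvg_prim a b : prim a b w @[w --> +oo] --> 0.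
Proof.
pose K : R := e^-1 + (`|a| * (`|c| + e) + `|b| * (`|c| + e)) / D.
have cvgE : expR (- e * w) @[w --> +oo] --> (0 : R).
  have h : e * w @[w --> +oo] --> +oo by exact: (gt0_cvgMry e0).
  under eq_fun do rewrite mulNr.
  exact: (cvg_comp _ _ h (@cvgr_expR R)).
apply/norm_cvg0P.
have cvgK : K * expR (- e * w) @[w --> +oo] --> (0 : R).
  by rewrite -(mulr0 K); apply: cvgMr.
apply: (@squeeze_cvgr _ _ _ _ (cst 0) (fun w => K * expR (- e * w))) => //; last first.
  exact: cvg_cst.
apply: nearW => w; rewrite normr_ge0/= /prim normrM mulrC (ger0_norm (expR_ge0 (- e * w)))//.
rewrite ler_wpM2r ?expR_ge0// (le_trans (ler_normD _ _))// normrN.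
have D1 : 0 <= D^-1 by rewrite invr_ge0 addr_ge0// sqr_ge0.
have e'0 : 0 <= e^-1 by rewrite invr_ge0 ltW.
rewrite (ger0_norm e'0) lerD2l normrM (ger0_norm D1).
rewrite ler_wpM2r//.
have hs t : `|sin t| <= 1 :> R by rewrite ler_norml sin_geN1 sin_le1.
have hc t : `|cos t| <= 1 :> R by rewrite ler_norml cos_geN1 cos_le1.
have e1 := ger0_norm (ltW e0).
rewrite (le_trans (ler_normB _ _))// !normrM lerD// ler_wpM2l//.
  rewrite (le_trans (ler_normB _ _))// !normrM e1 lerD//.
    by rewrite ler_piMr.
  by rewrite ler_piMr// ltW.
rewrite (le_trans (ler_normD _ _))// !normrM e1 lerD//.
  by rewrite ler_piMr.
by rewrite ler_piMr// ltW.
Qed.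

(** The weight of Abel summation. *)
Definition abel (w : R) : R := expR (- e * `|w|).

Lemma abel_gt0 w : 0 < abel w. Proof. exact: expR_gt0. Qed.

Lemma continuous_abel : continuous abel.
Proof.
move=> w; apply: continuous_comp; last exact: continuous_expR.
apply: cvgMr; exact: norm_continuous.
Qed.

Lemma measurable_abel : measurable_fun [set: R] abel.
Proof. exact: continuous_measurable_fun continuous_abel. Qed.

Let phase a b (w : R) : R := 1 + a * cos (c * w) + b * sin (c * w).

Let continuous_phase a b : continuous (phase a b).
Proof.
move=> w; apply: cvgD; first apply: cvgD; first exact: cvg_cst.
- apply: cvgMr; apply: continuous_comp; last exact: continuous_cos.
  by apply: cvgMr; exact: cvg_id.
- apply: cvgMr; apply: continuous_comp; last exact: continuous_sin.
  by apply: cvgMr; exact: cvg_id.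
Qed.

Let half_line a b : (forall t : R, 0 <= 1 + a * cos t + b * sin t) ->
  (\int[lb]_(x in `[0%R, +oo[) (abel x * phase a b x)%:E =
   (e^-1 + (a * e + b * c) / D)%:E)%E.
Proof.
move=> hab.
transitivity (\int[lb]_(x in `[0%R, +oo[) (expR (- e * x) * phase a b x)%:E)%E.
  apply: eq_integral => x; rewrite inE/= in_itv/= andbT => x0.
  by rewrite /abel ger0_norm.
rewrite (@ge0_half_line_FTC R (fun x => expR (- e * x) * phase a b x) (prim a b) 0
  _ _ (dprim a b) (cvg_prim a b))//.
- rewrite /prim !mulr0 sin0 cos0 expR0; congr (_%:E); rewrite /D.
  by field; apply/andP; split; [exact: D0|rewrite gt_eqF].
- move=> w; apply: cvgM; last exact: continuous_phase.
  apply: continuous_comp; last exact: continuous_expR.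
  by apply: cvgMr; exact: cvg_id.
- by move=> x _; rewrite mulr_ge0 ?expR_ge0//; exact: hab.
Qed.

(** The half-line primitive is elementary; adding the reflected half-line
    cancels the sine part. Keeping the constant term [1] makes the integrand
    nonnegative, so that the improper fundamental theorem of calculus for
    nonnegative functions applies. *)
Lemma integral_abel_phase a b : (forall t : R, 0 <= 1 + a * cos t + b * sin t) ->
  (\int[lb]_x (abel x * (1 + a * cos (c * x) + b * sin (c * x)))%:E =
   (2 / e + (2 * a * e) / (e ^+ 2 + c ^+ 2))%:E)%E.
Proof.
move=> hab; rewrite -/D.
have hab' (t : R) : 0 <= 1 + a * cos t + (- b) * sin t.
  by have := hab (- t); rewrite cosN sinN mulrN mulNr.
rewrite (@ge0_integral_line_split R (fun x => abel x * phase a b x)).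
- rewrite half_line//.
  transitivity ((e^-1 + (a * e + b * c) / D)%:E +
      \int[lb]_(x in `[0%R, +oo[) (abel x * phase a (- b) x)%:E)%E.
    congr (_ + _)%E; apply: eq_integral => x _.
    by rewrite /abel /phase normrN mulrN cosN sinN !(mulrN, mulNr).
  rewrite half_line// -EFinD; congr (_%:E).
  field.
  by rewrite D0 gt_eqF.
- by move=> w; apply: cvgM; [exact: continuous_abel|exact: continuous_phase].
- by move=> w; rewrite mulr_ge0 ?expR_ge0//; exact: hab.
Qed.

End abel_weight.

Section abel_integrals.
Context {R : realType}.
Notation lb := (@lebesgue_measure R).
Variable e : R.
Hypothesis e0 : 0 < e.

Lemma integral_abel : (\int[lb]_x (abel e x)%:E = (2 / e)%:E)%E.
Proof.
have := @integral_abel_phase R e 0 e0 0 0; rewrite mulr0 !mul0r addr0 => <-.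
  by apply: eq_integral => x _; rewrite !mul0r !addr0 mulr1.
by move=> t; rewrite !mul0r !addr0.
Qed.

Lemma integrable_abelM (h : R -> R) : measurable_fun setT h ->
  (forall w, `|h w| <= 1) -> lb.-integrable setT (fun w => (abel e w * h w)%:E).
Proof.
move=> mh h1; have ma : measurable_fun setT (abel e) by exact: measurable_abel.
apply/integrableP; split; first exact/measurable_EFinP/measurable_funM.
apply: (@le_lt_trans _ _ (2 / e)%:E); last exact: ltry.
rewrite -integral_abel; apply: ge0_le_integral => //.
- by apply: measurableT_comp => //; exact/measurable_EFinP/measurable_funM.
- exact/measurable_EFinP.
- move=> w _; rewrite /= lee_fin normrM ger0_norm; last exact/ltW/abel_gt0.
  by rewrite ler_piMr// ltW// abel_gt0.
Qed.

Lemma integrable_abel : lb.-integrable setT (EFin \o abel e).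
Proof.
have := @integrable_abelM (cst 1) (measurable_cst _).
rewrite (_ : (fun w => _) = EFin \o abel e); last by apply/funext => w /=; rewrite mulr1.
by apply => w /=; rewrite normr1.
Qed.

Variable c : R.

Let mcos : measurable_fun setT (fun w : R => cos (c * w)).
Proof.
apply: continuous_measurable_fun => w; apply: continuous_comp.
  by apply: cvgMr; exact: cvg_id.
exact: continuous_cos.
Qed.

Let msin : measurable_fun setT (fun w : R => sin (c * w)).
Proof.
apply: continuous_measurable_fun => w; apply: continuous_comp.
  by apply: cvgMr; exact: cvg_id.
exact: continuous_sin.
Qed.

Lemma integral_abel_cos :
  (\int[lb]_x (abel e x * cos (c * x))%:E = (2 * e / (e ^+ 2 + c ^+ 2))%:E)%E.
Proof.
have h : (\int[lb]_x (abel e x)%:E + \int[lb]_x (abel e x * cos (c * x))%:E =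
          (2 / e + (2 * 1 * e) / (e ^+ 2 + c ^+ 2))%:E)%E.
  rewrite -(@integral_abel_phase _ _ c e0 1 0); last first.
    by move=> t; rewrite mul0r addr0 mul1r -lerBlDl sub0r cos_geN1.
  rewrite -integralD//; last 2 first.
  - exact: integrable_abel.
  - by apply: integrable_abelM => // w; rewrite ler_norml cos_geN1 cos_le1.
  by apply: eq_integral => w _; rewrite -EFinD mul0r addr0 mul1r mulrDr mulr1.
move: h; rewrite integral_abel => /(congr1 (fun z => z - (2 / e)%:E))%E.
rewrite addeAC subee// add0e => ->; rewrite -EFinB mulr1.
by congr (_%:E); rewrite addrAC subrr add0r.
Qed.

Lemma integral_abel_sin : (\int[lb]_x (abel e x * sin (c * x))%:E = 0)%E.
Proof.
have h : (\int[lb]_x (abel e x)%:E + \int[lb]_x (abel e x * sin (c * x))%:E =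
          (2 / e + (2 * 0 * e) / (e ^+ 2 + c ^+ 2))%:E)%E.
  rewrite -(@integral_abel_phase _ _ c e0 0 1); last first.
    by move=> t; rewrite mul0r addr0 mul1r -lerBlDl sub0r sin_geN1.
  rewrite -integralD//; last 2 first.
  - exact: integrable_abel.
  - by apply: integrable_abelM => // w; rewrite ler_norml sin_geN1 sin_le1.
  by apply: eq_integral => w _; rewrite -EFinD mul0r addr0 mul1r mulrDr mulr1.
move: h; rewrite integral_abel mulr0 !mul0r addr0 => /(congr1 (fun z => z - (2 / e)%:E))%E.
by rewrite addeAC subee// add0e => ->.
Qed.

End abel_integrals.

(** * Square integrals and sequences tending to zero *)

Section square_integrals.
Context d (T : measurableType d) (R : realType) (mu : {measure set T -> \bar R}).
Implicit Types f g h : T -> R.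

Lemma ge0_le_integral_EFin f g : measurable_fun setT f -> measurable_fun setT g ->
    (forall x, 0 <= f x <= g x) ->
  (\int[mu]_x (f x)%:E <= \int[mu]_x (g x)%:E)%E.
Proof.
move=> mf mg fg; apply: ge0_le_integral => //.
- by move=> x _; rewrite lee_fin; have /andP[] := fg x.
- exact/measurable_EFinP.
- exact/measurable_EFinP.
- by move=> x _; rewrite lee_fin; have /andP[] := fg x.
Qed.

Lemma ge0_integral_le_comb f g h (a b : R) : 0 <= a -> 0 <= b ->
    measurable_fun setT f -> measurable_fun setT g -> measurable_fun setT h ->
    (forall x, 0 <= f x) -> (forall x, 0 <= g x) -> (forall x, 0 <= h x) ->
    (forall x, f x <= a * g x + b * h x) ->
  (\int[mu]_x (f x)%:E <=
   a%:E * \int[mu]_x (g x)%:E + b%:E * \int[mu]_x (h x)%:E)%E.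
Proof.
move=> a0 b0 mf mg mh f0 g0 h0 fgh.
have ma : measurable_fun setT (fun x => a * g x) by exact: measurable_funM.
have mb : measurable_fun setT (fun x => b * h x) by exact: measurable_funM.
apply: (@le_trans _ _ (\int[mu]_x (a * g x + b * h x)%:E)%E).
  apply: ge0_le_integral_EFin => //; first exact: measurable_funD.
  by move=> x; rewrite f0 fgh.
under eq_integral do rewrite EFinD.
rewrite ge0_integralD//; last 4 first.
- by move=> x _; rewrite lee_fin mulr_ge0.
- exact/measurable_EFinP.
- by move=> x _; rewrite lee_fin mulr_ge0.
- exact/measurable_EFinP.
under eq_integral do rewrite EFinM.
under [X in (_ + X <= _)%E]eq_integral do rewrite EFinM.
rewrite !ge0_integralZl//.
- exact/measurable_EFinP.
- by move=> x _; rewrite lee_fin.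
- exact/measurable_EFinP.
- by move=> x _; rewrite lee_fin.
Qed.

Definition sqint f : \bar R := (\int[mu]_x ((f x) ^+ 2)%:E)%E.

Lemma sqint_ge0 f : (0 <= sqint f)%E.
Proof. by apply: integral_ge0 => x _; rewrite lee_fin sqr_ge0. Qed.

Lemma sqrD_le2 (x y : R) : (x + y) ^+ 2 <= 2 * x ^+ 2 + 2 * y ^+ 2.
Proof. by have := sqr_ge0 (x - y); lra. Qed.

Lemma sqrB_le2 (x y : R) : (x - y) ^+ 2 <= 2 * x ^+ 2 + 2 * y ^+ 2.
Proof. by have := sqrD_le2 x (- y); rewrite sqrrN. Qed.

Lemma le_sqint f g : measurable_fun setT f -> measurable_fun setT g ->
  (forall x, `|f x| <= `|g x|) -> (sqint f <= sqint g)%E.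
Proof.
move=> mf mg fg; apply: ge0_le_integral_EFin; [exact/measurable_funX..|].
move=> x; rewrite sqr_ge0/= -(real_normK (num_real (f x))).
by rewrite -(real_normK (num_real (g x))) ler_sqr// nnegrE.
Qed.

End square_integrals.

Section ereal_limits.
Context {R : realType}.
Local Open Scope ereal_scope.
Implicit Types u v : nat -> \bar R.

Lemma cvge0P u : (forall n, 0 <= u n) ->
  (u @ \oo --> 0) <->
  (forall e : R, (0 < e)%R -> \forall n \near \oo, u n <= e%:E).
Proof.
move=> u0; split=> [uc e e0|ue A [e/= e0 eA]].
  have h : ereal_nbhs 0 (fun z : \bar R => z < e%:E) by apply: open_ereal_lt'; rewrite lte_fin.
  have h2 := uc _ h.
  by near=> n; apply/ltW; near: n; exact: h2.
have h2 : \forall n \near \oo, u n <= (e / 2)%:E by apply: ue; rewrite divr_gt0.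
suff : \forall n \near \oo, A (u n) by [].
near=> n; have une : u n <= (e / 2)%:E by near: n.
have := u0 n; case: (u n) une => [r| |]//; rewrite !lee_fin => re r0.
apply: eA => /=; rewrite sub0r normrN ger0_norm// (le_lt_trans re)//.
by rewrite ltr_pdivrMr// ltr_pMr// ltr1n.
Unshelve. all: by end_near. Qed.

Lemma squeeze_cvge0 u v : (forall n, 0 <= u n <= v n) -> v @ \oo --> 0 ->
  u @ \oo --> 0.
Proof.
move=> uv v0; apply: (@squeeze_cvge _ _ _ _ (cst 0) _ v) => //.
- exact: nearW.
- exact: cvg_cst.
Qed.

Lemma cvge0_comb u v (a b : R) : (0 <= a)%R -> (0 <= b)%R ->
  (forall n, 0 <= u n) -> (forall n, 0 <= v n) ->
  u @ \oo --> 0 -> v @ \oo --> 0 -> (fun n => a%:E * u n + b%:E * v n) @ \oo --> 0.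
Proof.
move=> a0 b0 u0 v0 cu cv; 
rewrite (_ : 0 = a%:E * 0 + b%:E * 0); last by rewrite !mule0 adde0.
apply: cvgeD; first by rewrite !mule0.
- exact: cvgeZl.
- exact: cvgeZl.
Qed.

Lemma cvge0_approx u : (forall n, 0 <= u n) ->
  (forall e : R, (0 < e)%R ->
    exists v, [/\ forall n, 0 <= v n, v @ \oo --> 0 & forall n, u n <= v n + e%:E]) ->
  u @ \oo --> 0.
Proof.
move=> u0 uv; apply/cvge0P => // e e0.
have e20 : (0 < e / 2)%R by rewrite divr_gt0.
have [v [v0 cv uve]] := uv _ e20.
move/cvge0P : cv => /(_ v0 _ e20) cv; near=> n.
have vn : v n <= (e / 2)%:E by near: n.
by rewrite (le_trans (uve n))// [leRHS](_ : _ = (e / 2)%:E + (e / 2)%:E)%E ?leeD2r//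
  -EFinD -splitr.
Unshelve. all: by end_near. Qed.

End ereal_limits.

(** * Mean square oscillation for a Markov kernel *)

Section oscillation.
Context d (T : measurableType d) (R : realType).
Variable mu : {sigma_finite_measure set T -> \bar R}.
Implicit Types (f g : T -> R) (k : T * T -> R).

(** Symmetry and unit mass make both marginals of the measure with density [k]
    on the product equal to [mu]. *)
Record markov_kernel k : Prop := MarkovKernel {
  markov_measurable : measurable_fun setT k ;
  markov_ge0 : forall z, 0 <= k z ;
  markov_sym : forall x y, k (x, y) = k (y, x) ;
  markov_mass : forall x, (\int[mu]_y (k (x, y))%:E = 1)%E }.

(** Twice the defect [|f|^2 - <K f, f>] of the averaging operator [K] with
    kernel [k]. *)
Definition osc k f : \bar R :=
  (\int[(mu \x mu)%E]_z ((f z.1 - f z.2) ^+ 2 * k z)%:E)%E.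

Lemma measurable_comp_fst f : measurable_fun setT f ->
  measurable_fun setT (fun z : T * T => f z.1).
Proof. by move=> mf; apply: measurableT_comp => //; exact: measurable_fst. Qed.

Lemma measurable_comp_snd f : measurable_fun setT f ->
  measurable_fun setT (fun z : T * T => f z.2).
Proof. by move=> mf; apply: measurableT_comp => //; exact: measurable_snd. Qed.

Section one_kernel.
Variable k : T * T -> R.
Hypothesis kP : markov_kernel k.
Let mk := markov_measurable kP.
Let k0 := markov_ge0 kP.

Lemma markov_integral_fst f : measurable_fun setT f -> (forall x, 0 <= f x) ->
  (\int[(mu \x mu)%E]_z (f z.1 * k z)%:E = \int[mu]_x (f x)%:E)%E.
Proof.
move=> mf f0; rewrite fubini_tonelli1/=; last 2 first.
- apply/measurable_EFinP/measurable_funM => //; exact: measurable_comp_fst.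
- by move=> z; rewrite lee_fin mulr_ge0.
apply: eq_integral => x _; rewrite /fubini_F/=.
under eq_integral do rewrite EFinM.
rewrite ge0_integralZl//; last 3 first.
- exact/measurable_EFinP/measurableT_comp.
- by move=> y _; rewrite lee_fin.
- by rewrite lee_fin.
by rewrite (markov_mass kP) mule1.
Qed.

Lemma markov_integral_snd f : measurable_fun setT f -> (forall x, 0 <= f x) ->
  (\int[(mu \x mu)%E]_z (f z.2 * k z)%:E = \int[mu]_x (f x)%:E)%E.
Proof.
move=> mf f0; rewrite fubini_tonelli2/=; last 2 first.
- apply/measurable_EFinP/measurable_funM => //; exact: measurable_comp_snd.
- by move=> z; rewrite lee_fin mulr_ge0.
apply: eq_integral => x _; rewrite /fubini_G/=.
under eq_integral do rewrite EFinM.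
rewrite ge0_integralZl//; last 3 first.
- exact/measurable_EFinP/measurableT_comp.
- by move=> y _; rewrite lee_fin.
- by rewrite lee_fin.
by under eq_integral do rewrite (markov_sym kP); rewrite (markov_mass kP) mule1.
Qed.

Lemma measurable_osc f : measurable_fun setT f ->
  measurable_fun setT (fun z : T * T => (f z.1 - f z.2) ^+ 2 * k z).
Proof.
move=> mf; apply: measurable_funM => //; apply/measurable_funX/measurable_funB.
- exact: measurable_comp_fst.
- exact: measurable_comp_snd.
Qed.

Lemma osc_ge0 f : (0 <= osc k f)%E.
Proof. by apply: integral_ge0 => z _; rewrite lee_fin mulr_ge0// sqr_ge0. Qed.

Lemma osc_le_sqint f : measurable_fun setT f ->
  (osc k f <= 4%:E * sqint mu f)%E.
Proof.
move=> mf; have mf2 : measurable_fun setT (fun x => f x ^+ 2) by exact: measurable_funX.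
have f20 x : 0 <= f x ^+ 2 by exact: sqr_ge0.
apply: (@le_trans _ _ (2%:E * \int[(mu \x mu)%E]_z (f z.1 ^+ 2 * k z)%:E +
                      2%:E * \int[(mu \x mu)%E]_z (f z.2 ^+ 2 * k z)%:E)%E).
  apply: ge0_integral_le_comb => //.
  - exact: measurable_osc.
  - by apply: measurable_funM => //; exact: (@measurable_comp_fst (fun x => f x ^+ 2)).
  - by apply: measurable_funM => //; exact: (@measurable_comp_snd (fun x => f x ^+ 2)).
  - by move=> z; rewrite mulr_ge0// sqr_ge0.
  - by move=> z; rewrite mulr_ge0// sqr_ge0.
  - by move=> z; rewrite mulr_ge0// sqr_ge0.
  - move=> z; rewrite [leRHS](_ : _ = (2 * f z.1 ^+ 2 + 2 * f z.2 ^+ 2) * k z).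
      by rewrite ler_wpM2r//; exact: sqrB_le2.
    by ring.
rewrite (markov_integral_fst mf2 f20) (markov_integral_snd mf2 f20).
by rewrite -ge0_muleDl ?lee_fin// -EFinD (_ : 2 + 2 = 4 :> R)//; lra.
Qed.

Lemma oscD_le f g : measurable_fun setT f -> measurable_fun setT g ->
  (osc k (fun x => (f x + g x)%R) <= 2%:E * osc k f + 2%:E * osc k g)%E.
Proof.
move=> mf mg; apply: ge0_integral_le_comb => //.
- exact: (measurable_osc (measurable_funD mf mg)).
- exact: measurable_osc.
- exact: measurable_osc.
- by move=> z; rewrite mulr_ge0// sqr_ge0.
- by move=> z; rewrite mulr_ge0// sqr_ge0.
- by move=> z; rewrite mulr_ge0// sqr_ge0.
- move=> z; rewrite [leRHS](_ : _ =
    (2 * (f z.1 - f z.2) ^+ 2 + 2 * (g z.1 - g z.2) ^+ 2) * k z); last by ring.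
  by rewrite ler_wpM2r// opprD addrACA; exact: sqrD_le2.
Qed.

Lemma oscZ a f : measurable_fun setT f ->
  osc k (fun x => a * f x) = ((a ^+ 2)%:E * osc k f)%E.
Proof.
move=> mf; rewrite /osc -ge0_integralZl//.
- by apply: eq_integral => z _; rewrite -EFinM; congr (_%:E); ring.
- by apply/measurable_EFinP; exact: (measurable_osc mf).
- by move=> z _; rewrite lee_fin mulr_ge0// sqr_ge0.
- by rewrite lee_fin sqr_ge0.
Qed.

Lemma osc_le_approx f g : measurable_fun setT f -> measurable_fun setT g ->
  (osc k f <= 2%:E * osc k g + 8%:E * sqint mu (fun x => (f x - g x)%R))%E.
Proof.
move=> mf mg; rewrite [X in osc k X](_ : f = fun x => g x + (f x - g x)); last first.
  by apply/funext => x; rewrite addrC subrK.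
rewrite (le_trans (oscD_le mg (measurable_funB mf mg)))// leeD2l//.
rewrite (_ : 8 = 2 * 4 :> R); last by lra.
by rewrite EFinM -muleA lee_wpmul2l//; apply: osc_le_sqint; exact: measurable_funB.
Qed.

End one_kernel.

Variable ks : nat -> T * T -> R.
Hypothesis ksP : forall n, markov_kernel (ks n).

(** An averaged form of the L2 continuity of translations. *)
Definition tame f := (fun n => osc (ks n) f) @ \oo --> 0%E.

Lemma tameD f g : measurable_fun setT f -> measurable_fun setT g ->
  tame f -> tame g -> tame (fun x => f x + g x).
Proof.
move=> mf mg tf tg.
apply: (@squeeze_cvge0 _ _ (fun n => 2%:E * osc (ks n) f + 2%:E * osc (ks n) g)%E).
  by move=> n; rewrite osc_ge0//= oscD_le.
by apply: cvge0_comb => // n; exact: osc_ge0.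
Qed.

Lemma tameZ a f : measurable_fun setT f -> tame f -> tame (fun x => a * f x).
Proof.
move=> mf tf; rewrite /tame; under eq_fun do rewrite oscZ//.
by rewrite -(mule0 (a ^+ 2)%:E); apply: cvgeZl.
Qed.

(** The bound [osc k f <= 4 |f|^2] is uniform in the kernel, so tameness passes
    to L2 limits. *)
Lemma tame_approx f : measurable_fun setT f ->
  (forall e, 0 < e -> exists g, [/\ measurable_fun setT g, tame g &
     (sqint mu (fun x => (f x - g x)%R) <= e%:E)%E]) -> tame f.
Proof.
move=> mf fg; apply: cvge0_approx => [n|e e0]; first exact: osc_ge0.
have [g [mg tg fge]] := fg _ (divr_gt0 e0 (ltr0Sn R 7)).
exists (fun n => 2%:E * osc (ks n) g + 0%:E * osc (ks n) g)%E; split.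
- by move=> n; rewrite mul0e adde0 mule_ge0// osc_ge0.
- by apply: cvge0_comb => // n; exact: osc_ge0.
- move=> n; rewrite mul0e adde0 (le_trans (osc_le_approx (ksP n) mf mg))// leeD2l//.
  rewrite (_ : e = 8 * (e / 8)); last by rewrite mulrC divfK.
  by rewrite EFinM lee_wpmul2l.
Qed.

End oscillation.

(** * From indicators to square integrable functions *)

Lemma ge0_dominated_cvg0_ereal d (T : measurableType d) (R : realType)
    (mu : {measure set T -> \bar R}) (F : nat -> T -> \bar R) (G : T -> \bar R) :
    (forall n, measurable_fun setT (F n)) -> mu.-integrable setT G ->
    (forall n x, (0 <= F n x <= G x)%E) ->
    (forall x, (G x < +oo)%E -> F ^~ x @ \oo --> 0%E) ->
  (fun n => \int[mu]_x F n x)%E @ \oo --> 0%E.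
Proof.
move=> mF iG FG F0.
have FG' : {ae mu, forall x n, [set: T] x -> (`|F n x| <= G x)%E}.
  by apply: aeW => x n _; have /andP[F0x FGx] := FG n x; rewrite gee0_abs.
have F0' : {ae mu, forall x, [set: T] x -> F ^~ x @ \oo --> (cst 0%E : T -> \bar R) x}.
  apply: filterS (integrable_ae measurableT iG) => x Gx xT; apply: F0.
  by have := Gx xT; case: (G x) => // r _; exact: ltry.
have [_ _] := dominated_convergence measurableT mF (measurable_cst _) F0' iG FG'.
by rewrite integral0.
Qed.

Lemma ge0_dominated_cvg0 d (T : measurableType d) (R : realType)
    (mu : {measure set T -> \bar R}) (F : nat -> T -> \bar R) (G : T -> R) :
    (forall n, measurable_fun setT (F n)) -> mu.-integrable setT (EFin \o G) ->
    (forall n x, (0 <= F n x <= (G x)%:E)%E) ->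
    (forall x, F ^~ x @ \oo --> 0%E) ->
  (fun n => \int[mu]_x F n x)%E @ \oo --> 0%E.
Proof. by move=> mF iG FG F0; exact: (ge0_dominated_cvg0_ereal mF iG FG). Qed.

Section tame_from_indicators.
Context d (T : measurableType d) (R : realType).
Variable mu : {sigma_finite_measure set T -> \bar R}.
Variable ks : nat -> T * T -> R.
Hypothesis ksP : forall n, markov_kernel mu (ks n).
Hypothesis tame_indic : forall A, measurable A -> (mu A < +oo)%E ->
  tame mu ks (\1_A : T -> R).
Import HBNNSimple.

Let tame0 : tame mu ks (fun=> 0).
Proof.
rewrite /tame (_ : (fun n => _) = cst 0%E); first exact: cvg_cst.
apply/funext => n; rewrite /osc integral0_eq// => z _.
by rewrite subrr expr0n/= mul0r.
Qed.

Let tame_nnsfun (g : {nnsfun T >-> R}) : (sqint mu g < +oo)%E ->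
  tame mu ks g.
Proof.
move=> gfin.
have mA y : measurable (g @^-1` [set y]) by exact: measurable_sfunP.
have mI y : measurable_fun setT (\1_(g @^-1` [set y]) : T -> R).
  exact: measurable_indic.
have mu_fin y : y != 0 -> (mu (g @^-1` [set y]) < +oo)%E.
  move=> y0; have y20 : 0 < y ^+ 2 by rewrite exprn_even_gt0.
  have : ((y ^+ 2)%:E * mu (g @^-1` [set y]) <= sqint mu g)%E.
    rewrite -(setIT (g @^-1` _)) -integral_indic// -ge0_integralZl//; last 2 first.
    - exact/measurable_EFinP.
    - by rewrite lee_fin ltW.
    apply: ge0_le_integral_EFin.
    - exact: measurable_funM.
    - exact: measurable_funX.
    - move=> x; rewrite mulr_ge0 ?sqr_ge0//= indicE.
      case: (boolP (x \in _)) => [|_]; last by rewrite mulr0 sqr_ge0.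
      by rewrite inE /= => ->; rewrite mulr1.
  move=> /le_lt_trans/(_ gfin); case: (mu (g @^-1` [set y])) => [r _| |_].
  - exact: ltry.
  - by rewrite mulry gtr0_sg// mul1e ltxx.
  - by [].
suff H (s : seq R) : measurable_fun setT
      (fun x => \sum_(y <- s) (y * \1_(g @^-1` [set y]) x)) /\
    tame mu ks (fun x => \sum_(y <- s) (y * \1_(g @^-1` [set y]) x)).
  rewrite (_ : (g : T -> R) = (fun x => \sum_(y <- finmap.enum_fset (fset_set (range g)))
    (y * \1_(g @^-1` [set y]) x))); first by have [] := H (finmap.enum_fset (fset_set (range g))).
  by apply/funext => x; rewrite [LHS]fimfunE fsbig_finite.
elim: s => [|y s [ms ts]].
  by under eq_fun do rewrite big_nil; split; [exact: measurable_cst|exact: tame0].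
under eq_fun do rewrite big_cons.
have my : measurable_fun setT (fun x => y * \1_(g @^-1` [set y]) x).
  exact: measurable_funM.
split; first exact: measurable_funD.
apply: (tameD ksP) => //; have [->|y0] := eqVneq y 0.
  by under eq_fun do rewrite mul0r; exact: tame0.
apply: (tameZ ksP) => //; apply: tame_indic => //; exact: mu_fin.
Qed.

Let tame_ge0 (f : T -> R) : measurable_fun setT f -> (forall x, 0 <= f x) ->
  (sqint mu f < +oo)%E -> tame mu ks f.
Proof.
move=> mf f0 ffin; apply: (tame_approx ksP mf) => e e0.
have mEf : measurable_fun setT (EFin \o f) by exact/measurable_EFinP.
pose g := nnsfun_approx measurableT mEf.
have g_le n x : g n x <= f x.
  rewrite -lee_fin /g nnsfun_approxE; apply: le_approx => //.
  by move=> y _ /=; rewrite lee_fin.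
have mg n : measurable_fun setT (g n) by exact: measurable_funP.
have g0 n x : 0 <= g n x by exact: fun_ge0.
have gf x : (fun n => (f x - g n x) ^+ 2) @ \oo --> (0 : R).
  have h : EFin \o g ^~ x @ \oo --> (f x)%:E.
    apply: (cvg_nnsfun_approx measurableT mEf) => // y _ /=; by rewrite lee_fin.
  have h2 : g ^~ x @ \oo --> f x by exact: (fine_cvg h).
  have h3 : (fun n => f x - g n x) @ \oo --> (0 : R).
    by rewrite -(subrr (f x)); apply: cvgB => //; exact: cvg_cst.
  by under eq_fun do rewrite expr2; rewrite -(mulr0 (0 : R)); exact: cvgM.
have : (fun n => sqint mu (fun x => f x - g n x)) @ \oo --> 0%E.
  apply: (@ge0_dominated_cvg0 _ _ _ _ _ (fun x => f x ^+ 2)).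
  - by move=> n; apply/measurable_EFinP/measurable_funX/measurable_funB.
  - apply/integrableP; split; first exact/measurable_EFinP/measurable_funX.
    by under eq_integral do rewrite /= ger0_norm ?sqr_ge0//.
  - move=> n x; rewrite !lee_fin sqr_ge0/= ler_sqr ?nnegrE ?subr_ge0//.
    by rewrite lerBlDr lerDl.
  - by move=> x; apply: cvg_EFin; [exact: nearW|exact: gf].
move/cvge0P => /(_ (fun n => sqint_ge0 _ _) _ e0)[n _ /(_ n (leqnn n))/= gn].
exists (g n); split => //; apply: tame_nnsfun.
apply: le_lt_trans ffin; apply: le_sqint => // x.
by rewrite !ger0_norm.
Qed.

(** Splitting into positive and negative part and approximating from below by
    simple functions leaves only indicators to be treated. *)
Lemma tame_of_indic (f : T -> R) : measurable_fun setT f ->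
  (sqint mu f < +oo)%E -> tame mu ks f.
Proof.
move=> mf ffin.
have mp : measurable_fun setT (f^\+)%R by exact: measurable_funrpos.
have mn : measurable_fun setT (f^\-)%R by exact: measurable_funrneg.
rewrite (_ : f = fun x => (f^\+)%R x + (-1) * (f^\-)%R x); last first.
  apply/funext => x; rewrite mulN1r /funrpos /funrneg.
  case: (leP (f x) 0) => h; case: (leP (- f x) 0) => h'; lra.
have le_p x : `|(f^\+)%R x| <= `|f x|.
  rewrite ger0_norm ?funrpos_ge0// /funrpos; case: (leP 0 (f x)) => h.
    by rewrite ger0_norm.
  by rewrite normr_ge0.
have le_n x : `|(f^\-)%R x| <= `|f x|.
  rewrite ger0_norm ?funrneg_ge0// /funrneg -normrN; case: (leP 0 (- f x)) => h.
    by rewrite ger0_norm.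
  by rewrite normr_ge0.
apply: (tameD ksP) => //; first exact: measurable_funM.
- apply: tame_ge0 => //; apply: le_lt_trans ffin; exact: le_sqint.
- apply: (tameZ ksP) => //; apply: tame_ge0 => //; apply: le_lt_trans ffin; exact: le_sqint.
Qed.

End tame_from_indicators.

(** * The Poisson kernel *)

Section poisson_kernel.
Context {R : realType}.
Notation lb := (@lebesgue_measure R).
Notation RR := (measurableTypeR R).

(** The Fourier integral of [abel e], by [integral_abel_cos]. *)
Definition poisson (e t : R) : R := 2 * e / (e ^+ 2 + (2 * pi * t) ^+ 2).

Section one_width.
Variable e : R.
Hypothesis e0 : 0 < e.

Lemma poisson_den_gt0 t : 0 < e ^+ 2 + (2 * pi * t) ^+ 2.
Proof. by rewrite ltr_pwDl ?sqr_ge0// exprn_gt0. Qed.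

Lemma poisson_ge0 t : 0 <= poisson e t.
Proof. by rewrite divr_ge0 ?mulr_ge0 ?(ltW (poisson_den_gt0 t)) ?ltW. Qed.

Lemma poissonN t : poisson e (- t) = poisson e t.
Proof. by rewrite /poisson mulrN sqrrN. Qed.

Lemma continuous_poisson : continuous (poisson e).
Proof.
move=> t; apply: cvgM; first exact: cvg_cst.
apply: cvgV; first by rewrite gt_eqF// poisson_den_gt0.
apply: cvgD; first exact: cvg_cst.
rewrite (_ : (fun x => _) = (fun x => (2 * pi * x) * (2 * pi * x))); last first.
  by apply/funext => x; rewrite expr2.
by apply: cvgM; apply: cvgMr; exact: cvg_id.
Qed.

Lemma integral_poisson (x : R) : (\int[lb]_y (poisson e (x - y))%:E = 1)%E.
Proof.
pose b : R := 2 * pi / e.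
have b0 : 0 < b by rewrite divr_gt0 ?mulr_gt0 ?pi_gt0.
pose F y : R := pi^-1 * atan (b * (y - x)).
have cx : (fun y : R => y - x) y @[y --> +oo] --> +oo.
  apply/cvgryPge => A; near=> y; rewrite lerBrDr; near: y; apply: nbhs_pinfty_ge; exact: num_real.
have dF (y : R) : is_derive y (1 : R) F (poisson e (x - y)).
  rewrite /F; apply: is_derive_eq.
  rewrite /GRing.scale/= /poisson /b.
  move: (@pi R) (pi_gt0 R) => p p0; field.
  by rewrite !gt_eqF//= ltr_pwDl ?sqr_ge0// exprn_gt0.
rewrite (@ge0_line_FTC _ _ F (pi^-1 * (pi / 2)) (pi^-1 * (- (pi / 2)))).
- congr (_%:E); move: (@pi R) (pi_gt0 R) => p p0; field.
  by rewrite gt_eqF.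
- move=> y; apply: (@continuous_comp _ _ _ (fun y : R => x - y) (poisson e)); last exact: continuous_poisson.
  by apply: cvgB; [exact: cvg_cst|exact: cvg_id].
- by move=> y; exact: poisson_ge0.
- apply: cvgMr.
  have h : b * (y - x) @[y --> +oo] --> +oo by exact: (gt0_cvgMry b0 cx).
  exact: (cvg_comp _ _ h (@cvgy_atan R)).
- apply: cvgMr; apply/cvgNy_compNP; rewrite /=.
  have h : b * (y + x) @[y --> +oo] --> +oo.
    apply: (gt0_cvgMry b0); apply/cvgryPge => A; near=> y.
    by rewrite -lerBlDr; near: y; apply: nbhs_pinfty_ge; exact: num_real.
  rewrite (_ : (fun y => _) = (fun y => - atan (b * (y + x)))); last first.
    by apply/funext => y /=; rewrite -opprD mulrN atanN.
  by apply: cvgN; exact: (cvg_comp _ _ h (@cvgy_atan R)).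
Unshelve. all: by end_near. Qed.

Lemma measurable_poisson_diff :
  measurable_fun setT (fun z : RR * RR => poisson e (z.1 - z.2)).
Proof.
apply: (@measurableT_comp _ _ _ _ _ _ (poisson e)).
  exact: continuous_measurable_fun continuous_poisson.
by apply: measurable_funB; [exact: measurable_fst|exact: measurable_snd].
Qed.

Lemma markov_poisson : markov_kernel (lb : {sigma_finite_measure set RR -> \bar R})
  (fun z : RR * RR => poisson e (z.1 - z.2)).
Proof.
split.
- exact: measurable_poisson_diff.
- by move=> z; exact: poisson_ge0.
- by move=> x y /=; rewrite -poissonN opprB.
- exact: integral_poisson.
Qed.

End one_width.

Definition line_kernel (n : nat) (z : RR * RR) : R :=
  poisson (harmonic n) (z.1 - z.2).

Lemma line_kernelP n :
  markov_kernel (lb : {sigma_finite_measure set RR -> \bar R}) (line_kernel n).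
Proof. by apply: markov_poisson; exact: harmonic_gt0. Qed.

(** Away from 0 the kernel is at most [O(e)] times a fixed integrable one, which
    forces its mass there to vanish with [e]. *)
Lemma poisson_tail (D e t : R) : 0 < D -> D <= `|t| -> 0 < e <= 1 ->
  poisson e t <= e * (1 + ((2 * pi * D) ^+ 2)^-1) * poisson 1 t.
Proof.
move=> D0 Dt /andP[e0 e1].
pose s := (2 * pi * t) ^+ 2; pose u := (2 * pi * D) ^+ 2.
have pi0 : 0 < 2 * pi :> R by rewrite mulr_gt0 ?pi_gt0.
have u0 : 0 < u by rewrite exprn_gt0// mulr_gt0.
have us : u <= s.
  rewrite /u /s -[leRHS]real_normK ?num_real// normrM (gtr0_norm pi0).
  rewrite ler_sqr ?nnegrE; first by rewrite ler_pM2l.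
    by rewrite ltW// mulr_gt0.
  by rewrite mulr_ge0// ltW.
have s0 : 0 < s by exact: lt_le_trans us.
rewrite /poisson -/s -/u expr1n mulr1.
have e20 : 0 < e ^+ 2 by rewrite exprn_gt0.
rewrite mulrA ler_pdivrMr ?addr_gt0// mulrAC ler_pdivlMr ?addr_gt0//.
have -> : e * (1 + u^-1) * 2 = (2 * e) * (1 + u^-1) by ring.
rewrite -(mulrA (2 * e)) ler_wpM2l//; first by rewrite mulr_ge0 ?ltW.
have us1 : 1 <= s / u by rewrite ler_pdivlMr ?mul1r.
rewrite mulrDl mul1r (mulrC u^-1) mulrDl.
have : 0 <= e ^+ 2 / u by rewrite divr_ge0 ?ltW.
lra.
Qed.

Lemma line_kernel_leaves (U : set R) (x : R) : open U -> U x ->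
  (fun n => \int[lb]_y (\1_(~` U) y * line_kernel n (x, y))%:E)%E @ \oo --> 0%E.
Proof.
move=> oU Ux.
have [D /= D0 DU] : exists2 D : R, 0 < D & forall y, `|x - y| < D -> U y.
  by have [D /= D0 DU] := oU _ Ux; exists D => // y; exact: DU.
pose K : R := 1 + ((2 * pi * D) ^+ 2)^-1.
have K0 : 0 <= K by rewrite addr_ge0// invr_ge0 sqr_ge0.
have mU : measurable (~` U : set RR).
  by apply: measurableC; exact: open_measurable.
have mp (e : R) : 0 < e -> measurable_fun setT (fun y : RR => poisson e (x - y)).
  move=> e0; apply: continuous_measurable_fun => y.
  apply: (@continuous_comp _ _ _ (fun y : R => x - y) (poisson e)); last exact: continuous_poisson.
  by apply: cvgB; [exact: cvg_cst|exact: cvg_id].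
apply: (@squeeze_cvge0 _ _ (fun n => (harmonic n)%:E * K%:E)%E).
  move=> n; apply/andP; split.
    apply: integral_ge0 => y _; rewrite lee_fin mulr_ge0//.
    by apply: poisson_ge0; exact: harmonic_gt0.
  apply: (@le_trans _ _ (\int[lb]_y ((harmonic n * K) * poisson 1 (x - y))%:E)%E).
    apply: ge0_le_integral_EFin.
    - apply: measurable_funM; first exact: measurable_indic.
      by apply: mp; exact: harmonic_gt0.
    - by apply: measurable_funM => //; exact: mp.
    - move=> y; rewrite mulr_ge0//=; last by apply: poisson_ge0; exact: harmonic_gt0.
      rewrite indicE; case: (boolP (y \in _)) => [|_]; last first.
        by rewrite mul0r mulr_ge0 ?poisson_ge0// mulr_ge0 ?harmonic_ge0.
      rewrite inE/= mul1r => Uy; apply: poisson_tail => //.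
        by rewrite leNgt; apply/negP => /DU.
      by rewrite harmonic_gt0/= invf_le1// ler1n.
  under eq_integral do rewrite EFinM.
  rewrite ge0_integralZl//.
  - by rewrite integral_poisson// mule1 EFinM.
  - by apply/measurable_EFinP; exact: mp.
  - by move=> y _; rewrite lee_fin poisson_ge0.
  - by rewrite lee_fin mulr_ge0// harmonic_ge0.
rewrite -[X in _ --> X](mul0e K%:E); apply: cvgeZr => //; exact: cvge_harmonic.
Qed.
End poisson_kernel.

(** * Vanishing oscillation on the line *)

Section tame_line.
Context {R : realType}.
Notation RR := (measurableTypeR R).
Notation lb := (@lebesgue_measure R : {sigma_finite_measure set RR -> \bar R}).

Let indic2 (A B : set RR) (z : RR * RR) : R := \1_A z.1 * \1_B z.2.

Let measurable_indic2 A B : measurable A -> measurable B ->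
  measurable_fun setT (indic2 A B).
Proof.
move=> mA mB; apply: measurable_funM.
- exact: (measurable_comp_fst (measurable_indic mA)).
- exact: (measurable_comp_snd (measurable_indic mB)).
Qed.

(** The mass of the pairs that jump from [A] to [B]. *)
Let cross (A B : set RR) n : \bar R :=
  (\int[(lb \x lb)%E]_z (indic2 A B z * line_kernel n z)%:E)%E.

Let mK n : measurable_fun setT (@line_kernel R n).
Proof. exact: markov_measurable (line_kernelP n). Qed.

Let K0 n z : 0 <= @line_kernel R n z.
Proof. exact: markov_ge0 (line_kernelP n) z. Qed.

Let cross_cvg0 (A U : set RR) : measurable A -> (lb A < +oo)%E -> open U ->
  A `<=` U -> cross A (~` U) @ \oo --> 0%E.
Proof.
move=> mA Afin oU AU.
have mU : measurable (~` U : set RR) by apply: measurableC; exact: open_measurable.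
have mF n : measurable_fun setT (fun z : RR * RR => (indic2 A (~` U) z * line_kernel n z)%:E).
  by apply/measurable_EFinP/measurable_funM => //; exact: measurable_indic2.
have F0 n z : (0 <= (indic2 A (~` U) z * line_kernel n z)%:E)%E.
  by rewrite lee_fin mulr_ge0// mulr_ge0.
rewrite (_ : cross A (~` U) = fun n =>
    (\int[lb]_x \int[lb]_y (indic2 A (~` U) (x, y) * line_kernel n (x, y))%:E)%E); last first.
  by apply/funext => n; rewrite /cross fubini_tonelli1.
apply: (@ge0_dominated_cvg0 _ _ _ _ _ (\1_A : RR -> R)).
- by move=> n; exact: (measurable_fun_fubini_tonelli_F _ (mF n) (F0 n)).
- apply/integrableP; split; first exact/measurable_EFinP/measurable_indic.
  under eq_integral do rewrite /= ger0_norm//.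
  by rewrite integral_indic// setIT.
- move=> n x; rewrite integral_ge0//=.
  apply: (@le_trans _ _ (\int[lb]_y (\1_A x * line_kernel n (x, y))%:E)%E).
    apply: ge0_le_integral_EFin.
    - exact: (measurableT_comp (measurable_funM (measurable_indic2 mA mU) (mK n))).
    - by apply: measurable_funM => //; exact: measurableT_comp.
    - move=> y; apply/andP; split; first by rewrite mulr_ge0// mulr_ge0.
      rewrite ler_wpM2r// /indic2/= ler_piMr//.
  under eq_integral do rewrite EFinM.
  rewrite ge0_integralZl//.
  - by rewrite (markov_mass (line_kernelP n)) mule1.
  - by apply/measurable_EFinP; exact: measurableT_comp.
  - by move=> y _; rewrite lee_fin.
- move=> x; have [xA|xA] := boolP (x \in A); last first.
    rewrite (_ : (fun n => _) = cst 0%E); first exact: cvg_cst.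
    apply/funext => n; apply: integral0_eq => y _.
    by rewrite /indic2/= indicE (negbTE xA) !mul0r.
  rewrite (_ : (fun n => _) = (fun n =>
      \int[lb]_y (\1_(~` U) y * line_kernel n (x, y))%:E)%E).
    by apply: line_kernel_leaves => //; apply: AU; rewrite inE in xA.
  apply/funext => n; apply: eq_integral => y _.
  by rewrite /indic2/= [in X in X * _]indicE xA mul1r.
Qed.

Let cross_sym A B n : measurable A -> measurable B -> cross A B n = cross B A n.
Proof.
move=> mA mB.
have mF C D : measurable C -> measurable D ->
    measurable_fun setT (fun z : RR * RR => (indic2 C D z * line_kernel n z)%:E).
  by move=> mC mD; apply/measurable_EFinP/measurable_funM => //; exact: measurable_indic2.
have F0 C D z : (0 <= (indic2 C D z * line_kernel n z)%:E)%E.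
  by rewrite lee_fin mulr_ge0// mulr_ge0.
rewrite /cross fubini_tonelli1; [|exact: mF|by []].
rewrite fubini_tonelli2; [|exact: mF|by []].
apply: eq_integral => x _; apply: eq_integral => y _.
by rewrite /indic2/= mulrC (markov_sym (line_kernelP n)) (mulrC (\1_A x)) mulrC.
Qed.

(** For open [U] containing [A], a pair straddling the boundary of [A] either
    leaves [U], which is unlikely for a narrow kernel, or has a point in the
    small set [U `\` A]. *)
Lemma tame_line_indic (A : set RR) : measurable A -> (lb A < +oo)%E ->
  tame lb (@line_kernel R) (\1_A : RR -> R).
Proof.
move=> mA Afin.
apply: (cvge0_approx (fun n => osc_ge0 (line_kernelP n) _)) => e e0.
have [U [oU AU Ue]] := lebesgue_regularity_outer mA Afin (divr_gt0 e0 (ltr0Sn R 1)).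
have mU : measurable (U : set RR) by exact: open_measurable.
have mUC : measurable (~` U : set RR) by exact: measurableC.
have mD : measurable (U `\` A : set RR) by exact: measurableD.
have mI2 B C n : measurable B -> measurable C ->
    measurable_fun setT (fun z : RR * RR => indic2 B C z * line_kernel n z).
  by move=> mB mC; apply: measurable_funM => //; exact: measurable_indic2.
exists (fun n => 2%:E * cross A (~` U) n + 0%:E * cross A (~` U) n)%E.
have c0 B C n : (0 <= cross B C n)%E.
  by apply: integral_ge0 => z _; rewrite lee_fin mulr_ge0// mulr_ge0.
split.
- by move=> n; rewrite mul0e adde0 mule_ge0.
- by apply: cvge0_comb => //; exact: cross_cvg0.
- move=> n; rewrite mul0e adde0.
  pose a z : R := indic2 A (~` U) z * line_kernel n z + indic2 (~` U) A z * line_kernel n z.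
  pose b z : R := \1_(U `\` A) z.1 * line_kernel n z + \1_(U `\` A) z.2 * line_kernel n z.
  have mb1 : measurable_fun setT (fun z : RR * RR => (\1_(U `\` A) z.1 : R) * line_kernel n z).
    apply: measurable_funM => //; exact: (measurable_comp_fst (measurable_indic mD)).
  have mb2 : measurable_fun setT (fun z : RR * RR => (\1_(U `\` A) z.2 : R) * line_kernel n z).
    apply: measurable_funM => //; exact: (measurable_comp_snd (measurable_indic mD)).
  have a0 z : 0 <= a z.
    by apply: addr_ge0; apply: mulr_ge0 => //; exact: mulr_ge0.
  have b0 z : 0 <= b z by apply: addr_ge0; exact: mulr_ge0.
  have ia : (\int[(lb \x lb)%E]_z (a z)%:E = 2%:E * cross A (~` U) n)%E.
    under eq_integral do rewrite EFinD.
    rewrite ge0_integralD//.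
    - by rewrite -/(cross _ _ _) -/(cross _ _ _) (cross_sym n mUC mA) mule_natl mule2n.
    - by move=> z _; rewrite lee_fin mulr_ge0// mulr_ge0.
    - by apply/measurable_EFinP; exact: mI2.
    - by move=> z _; rewrite lee_fin mulr_ge0// mulr_ge0.
    - by apply/measurable_EFinP; exact: mI2.
  have ib : (\int[(lb \x lb)%E]_z (b z)%:E = 2%:E * lb (U `\` A))%E.
    under eq_integral do rewrite EFinD.
    have mI : measurable_fun setT (\1_(U `\` A) : RR -> R) by exact: measurable_indic.
    rewrite ge0_integralD//.
    - rewrite (markov_integral_fst (line_kernelP n) mI)//.
      rewrite (markov_integral_snd (line_kernelP n) mI)//.
      by rewrite integral_indic// setIT mule_natl mule2n.
    - by move=> z _; rewrite lee_fin mulr_ge0.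
    - exact/measurable_EFinP.
    - by move=> z _; rewrite lee_fin mulr_ge0.
    - exact/measurable_EFinP.
  apply: (@le_trans _ _ (1%:E * \int[(lb \x lb)%E]_z (a z)%:E +
                         1%:E * \int[(lb \x lb)%E]_z (b z)%:E)%E).
    apply: ge0_integral_le_comb => //.
    - exact: (measurable_osc (line_kernelP n) (measurable_indic mA)).
    - by apply: measurable_funD; exact: mI2.
    - exact: measurable_funD.
    - by move=> z; rewrite mulr_ge0 ?sqr_ge0.
    - move=> z; rewrite !mul1r /a /b -!mulrDl ler_wpM2r// /indic2 !indicE.
      rewrite !(in_setC, in_setD).
      have AU' (x : RR) : x \in A -> x \in U by rewrite !inE; exact: AU.
      have := AU' z.1; have := AU' z.2.
      case: (z.1 \in A); case: (z.2 \in A); case: (z.1 \in U); case: (z.2 \in U) => //=;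
        move=> h1 h2; rewrite ?(mulr0,mul0r,mul1r,mulr1,subr0,sub0r,subrr,expr0n,expr1n,sqrrN,add0r,addr0)//=;
        by [have := h1 isT|have := h2 isT|lra].
  rewrite ia ib !mul1e leeD2l//.
  rewrite (_ : e = 2 * (e / 2)); last by rewrite mulrC divfK.
  by rewrite EFinM lee_wpmul2l// ltW.
Qed.

Lemma tame_line (f : RR -> R) : measurable_fun setT f ->
  (sqint lb f < +oo)%E -> tame lb (@line_kernel R) f.
Proof.
apply: tame_of_indic; first exact: line_kernelP.
exact: tame_line_indic.
Qed.

End tame_line.

(** * Product kernels in higher dimension *)

Section cons_integral.
Context {R : realType}.
Notation RR := (measurableTypeR R).
Notation lb := (@lebesgue_measure R : {sigma_finite_measure set RR -> \bar R}).
Variable d : nat.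

Definition euclid_tail (t : euclid R d.+1) : euclid R d := [tuple of behead t].

Lemma cons_pairK (t : euclid R d.+1) : cons_pair (tnth t ord0, euclid_tail t) = t.
Proof. by case/tupleP: t => x t; apply: val_inj. Qed.

Lemma tnth_cons_pair0 x (t : euclid R d) : tnth (cons_pair (x, t)) ord0 = x.
Proof. by []. Qed.

Lemma tnth_cons_pairS x (t : euclid R d) i :
  tnth (cons_pair (x, t)) (lift ord0 i) = tnth t i.
Proof. by rewrite tnthS. Qed.

Lemma euclid_tail_cons x (t : euclid R d) : euclid_tail (cons_pair (x, t)) = t.
Proof. exact: val_inj. Qed.

Lemma measurable_euclid_tail : measurable_fun setT euclid_tail.
Proof. exact: measurable_behead. Qed.

Lemma measurable_cons_fun dT (S : measurableType dT) (F : euclid R d.+1 -> S) :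
  measurable_fun setT F -> measurable_fun setT (fun z : RR * euclid R d => F (cons_pair z)).
Proof. by move=> mF; apply: measurableT_comp => //; exact: measurable_cons_pair. Qed.

Lemma ge0_integral_cons_prod (F : euclid R d.+1 -> \bar R) :
  measurable_fun setT F -> (forall t, (0 <= F t)%E) ->
  (\int[lebesgue_tuple R d.+1]_t F t =
   \int[(lb \x lebesgue_tuple R d)%E]_z F (cons_pair z))%E.
Proof.
move=> mF F0.
have h := @ge0_integral_pushforward _ _ _ _ R (@cons_pair R d) (@measurable_cons_pair R d)
  (lb \x lebesgue_tuple R d)%E setT F measurableT mF (fun t _ => F0 t).
by rewrite preimage_setT in h.
Qed.

Lemma ge0_integral_cons (F : euclid R d.+1 -> \bar R) :
  measurable_fun setT F -> (forall t, (0 <= F t)%E) ->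
  (\int[lebesgue_tuple R d.+1]_t F t =
   \int[lb]_x \int[lebesgue_tuple R d]_t F (cons_pair (x, t)))%E.
Proof.
move=> mF F0; rewrite ge0_integral_cons_prod// fubini_tonelli1//.
exact: measurable_cons_fun.
Qed.

Lemma ge0_integral_cons2 (F : euclid R d.+1 -> \bar R) :
  measurable_fun setT F -> (forall t, (0 <= F t)%E) ->
  (\int[lebesgue_tuple R d.+1]_t F t =
   \int[lebesgue_tuple R d]_t \int[lb]_x F (cons_pair (x, t)))%E.
Proof.
move=> mF F0; rewrite ge0_integral_cons_prod// fubini_tonelli2//.
exact: measurable_cons_fun.
Qed.

End cons_integral.

Section tuple_kernel.
Context {R : realType}.
Notation RR := (measurableTypeR R).
Notation lb := (@lebesgue_measure R : {sigma_finite_measure set RR -> \bar R}).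

Definition tuple_kernel (n d : nat) (z : euclid R d * euclid R d) : R :=
  \prod_(i < d) line_kernel n (tnth z.1 i, tnth z.2 i).

Lemma tuple_kernel_cons n d x (s : euclid R d) y t :
  tuple_kernel n (cons_pair (x, s), cons_pair (y, t)) =
  line_kernel n (x, y) * tuple_kernel n (s, t).
Proof.
rewrite /tuple_kernel big_ord_recl/=; congr (_ * _).
by apply: eq_bigr => i _; rewrite !tnth_cons_pairS.
Qed.

Lemma measurable_tuple_kernel n d : measurable_fun setT (@tuple_kernel n d).
Proof.
apply: measurable_prod => i _.
have mi : measurable_fun setT ((@tnth d RR)^~ i) by exact: measurable_tnth.
apply: (measurableT_comp (markov_measurable (@line_kernelP R n))).
apply/measurable_fun_pairP; split => /=.
- exact: (measurableT_comp mi measurable_fst).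
- exact: (measurableT_comp mi measurable_snd).
Qed.

Lemma tuple_kernel_ge0 n d z : 0 <= @tuple_kernel n d z.
Proof. by apply: prodr_ge0 => i _; exact: markov_ge0 (line_kernelP n) _. Qed.

Lemma tuple_kernel_sym n d (x y : euclid R d) :
  tuple_kernel n (x, y) = tuple_kernel n (y, x).
Proof. by apply: eq_bigr => i _; exact: markov_sym (line_kernelP n) _ _. Qed.

Let measurable_tuple_kernel_row n d (x : euclid R d) :
  measurable_fun setT (fun y => tuple_kernel n (x, y)).
Proof. exact: (measurableT_comp (@measurable_tuple_kernel n d) (pair1_measurable x)). Qed.

Lemma tuple_kernel_mass n d (x : euclid R d) :
  (\int[lebesgue_tuple R d]_y (tuple_kernel n (x, y))%:E = 1)%E.
Proof.
elim: d x => [|d IHd] x.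
  rewrite integral_dirac//; last first.
    by apply/measurable_EFinP; exact: measurable_tuple_kernel_row.
  by rewrite diracT mul1e /tuple_kernel big_ord0.
rewrite -(cons_pairK x) ge0_integral_cons//; last 2 first.
- by apply/measurable_EFinP; exact: measurable_tuple_kernel_row.
- by move=> t; rewrite lee_fin tuple_kernel_ge0.
under eq_integral.
  move=> y _.
  under eq_integral do rewrite tuple_kernel_cons EFinM.
  rewrite ge0_integralZl//; last 3 first.
  - by apply/measurable_EFinP; exact: measurable_tuple_kernel_row.
  - by move=> t _; rewrite lee_fin tuple_kernel_ge0.
  - by rewrite lee_fin; exact: markov_ge0 (line_kernelP n) _.
  rewrite IHd mule1.
  over.
exact: markov_mass (line_kernelP n) _.
Qed.

Lemma tuple_kernelP n d : markov_kernel (lebesgue_tuple R d) (@tuple_kernel n d).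
Proof.
split.
- exact: measurable_tuple_kernel.
- exact: tuple_kernel_ge0.
- exact: tuple_kernel_sym.
- exact: tuple_kernel_mass.
Qed.

End tuple_kernel.

(** * Vanishing oscillation in higher dimension *)

Section tame_tuple.
Context {R : realType}.
Notation RR := (measurableTypeR R).
Notation lb := (@lebesgue_measure R : {sigma_finite_measure set RR -> \bar R}).

Section step.
Variables (d : nat) (f : euclid R d.+1 -> R).
Hypothesis mf : measurable_fun setT f.
Notation E := (euclid R d).
Notation mud := (lebesgue_tuple R d).
Notation muS := (lebesgue_tuple R d.+1).

Let fx (x : RR) (s : E) := f (cons_pair (x, s)).

Let mfx x : measurable_fun setT (fx x).
Proof.
exact: (measurableT_comp mf (measurableT_comp (@measurable_cons_pair R d) (pair1_measurable x))).
Qed.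

Let mfs s : measurable_fun setT (fx ^~ s).
Proof.
exact: (measurableT_comp mf (measurableT_comp (@measurable_cons_pair R d) (pair2_measurable s))).
Qed.

(** The midpoint of a two-step move from [z.1] to [z.2]: first the head
    coordinate changes, then all the others. *)
Let mix (z : euclid R d.+1 * euclid R d.+1) : euclid R d.+1 :=
  cons_pair (tnth z.2 ord0, euclid_tail z.1).

Let measurable_mix : measurable_fun setT mix.
Proof.
apply: (measurableT_comp (@measurable_cons_pair R d)).
apply/measurable_fun_pairP; split => /=.
- exact: (measurableT_comp (measurable_tnth ord0) measurable_snd).
- exact: (measurableT_comp (@measurable_euclid_tail R d) measurable_fst).
Qed.

Section fixed_n.
Variable n : nat.
Notation k1 := (@line_kernel R n).
Notation kd := (@tuple_kernel R n d).
Notation kS := (@tuple_kernel R n d.+1).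

Let k1P := @line_kernelP R n.
Let kdP := @tuple_kernelP R n d.
Let kSP := @tuple_kernelP R n d.+1.

Let F1 z := (f z.1 - f (mix z)) ^+ 2 * kS z.
Let F2 z := (f (mix z) - f z.2) ^+ 2 * kS z.

Let mF1 : measurable_fun setT F1.
Proof.
apply: measurable_funM; last exact: markov_measurable kSP.
apply/measurable_funX/measurable_funB; first exact: (measurableT_comp mf).
exact: (measurableT_comp mf).
Qed.

Let mF2 : measurable_fun setT F2.
Proof.
apply: measurable_funM; last exact: markov_measurable kSP.
apply/measurable_funX/measurable_funB; first exact: (measurableT_comp mf).
exact: (measurableT_comp mf).
Qed.

Let F1_ge0 z : 0 <= F1 z.
Proof. by rewrite mulr_ge0 ?sqr_ge0// tuple_kernel_ge0. Qed.

Let F2_ge0 z : 0 <= F2 z.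
Proof. by rewrite mulr_ge0 ?sqr_ge0// tuple_kernel_ge0. Qed.

Let osc_head_tail :
  (osc muS kS f <= 2%:E * \int[(muS \x muS)%E]_z (F1 z)%:E +
                   2%:E * \int[(muS \x muS)%E]_z (F2 z)%:E)%E.
Proof.
apply: ge0_integral_le_comb => //; first exact: (measurable_osc kSP).
- by move=> z; rewrite mulr_ge0 ?sqr_ge0// tuple_kernel_ge0.
- move=> z; rewrite /F1 /F2 [leRHS](_ : _ =
    (2 * (f z.1 - f (mix z)) ^+ 2 + 2 * (f (mix z) - f z.2) ^+ 2) * kS z); last by ring.
  rewrite ler_wpM2r ?tuple_kernel_ge0//.
  rewrite (_ : f z.1 - f z.2 = (f z.1 - f (mix z)) + (f (mix z) - f z.2)); last by ring.
  exact: sqrD_le2.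
Qed.

Let mk1 (x : RR) : measurable_fun setT (fun y : RR => k1 (x, y)).
Proof. exact: (measurableT_comp (markov_measurable k1P) (pair1_measurable x)). Qed.

Let mkd (s : E) : measurable_fun setT (fun t : E => kd (s, t)).
Proof. exact: (measurableT_comp (markov_measurable kdP) (pair1_measurable s)). Qed.

Let int_F1_inner (x : RR) (s : E) :
  (\int[muS]_q (F1 (cons_pair (x, s), q))%:E =
   \int[lb]_y ((fx x s - fx y s) ^+ 2 * k1 (x, y))%:E)%E.
Proof.
rewrite ge0_integral_cons//; last 2 first.
- apply/measurable_EFinP.
  exact: (measurableT_comp mF1 (pair1_measurable (cons_pair (x, s)))).
- by move=> q; rewrite lee_fin.
apply: eq_integral => y _.
transitivity (\int[mud]_t (((fx x s - fx y s) ^+ 2 * k1 (x, y))%:E * (kd (s, t))%:E))%E.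
  apply: eq_integral => t _; rewrite -EFinM /F1/= tuple_kernel_cons /mix/= euclid_tail_cons.
  by rewrite tnth_cons_pair0 mulrA.
rewrite ge0_integralZl//.
- by rewrite (markov_mass kdP) mule1.
- exact/measurable_EFinP.
- by move=> t _; rewrite lee_fin tuple_kernel_ge0.
- by rewrite lee_fin mulr_ge0 ?sqr_ge0// (markov_ge0 k1P).
Qed.

Let int_F2_inner (y : RR) (t : E) :
  (\int[muS]_p (F2 (p, cons_pair (y, t)))%:E =
   \int[mud]_s ((fx y t - fx y s) ^+ 2 * kd (t, s))%:E)%E.
Proof.
rewrite ge0_integral_cons2//; last 2 first.
- apply/measurable_EFinP.
  exact: (measurableT_comp mF2 (pair2_measurable (cons_pair (y, t)))).
- by move=> q; rewrite lee_fin.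
apply: eq_integral => s _.
transitivity (\int[lb]_x (((fx y t - fx y s) ^+ 2 * kd (t, s))%:E * (k1 (y, x))%:E))%E.
  apply: eq_integral => x _; rewrite -EFinM /F2/= tuple_kernel_cons /mix/= euclid_tail_cons.
  rewrite tnth_cons_pair0 (markov_sym k1P) (markov_sym kdP) -/(fx y s) -/(fx y t).
  by congr (_%:E); ring.
rewrite ge0_integralZl//.
- by rewrite (markov_mass k1P) mule1.
- exact/measurable_EFinP.
- by move=> x _; rewrite lee_fin (markov_ge0 k1P).
- by rewrite lee_fin mulr_ge0 ?sqr_ge0// (markov_ge0 kdP).
Qed.

Let int_F1 : (\int[(muS \x muS)%E]_z (F1 z)%:E =
  \int[mud]_s osc lb k1 (fx ^~ s))%E.
Proof.
have mE : measurable_fun setT (EFin \o F1) by exact/measurable_EFinP.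
have F10 z : (0 <= (EFin \o F1) z)%E by rewrite lee_fin.
rewrite (fubini_tonelli1 (EFin \o F1))// ge0_integral_cons2//; last 2 first.
- exact: (measurable_fun_fubini_tonelli_F _ mE F10).
- by move=> x; apply: integral_ge0.
apply: eq_integral => s _; rewrite /osc fubini_tonelli1/=; last 2 first.
- by apply/measurable_EFinP; exact: (measurable_osc k1P (mfs s)).
- by move=> z; rewrite lee_fin mulr_ge0 ?sqr_ge0// (markov_ge0 k1P).
by apply: eq_integral => x _; exact: int_F1_inner.
Qed.

Let int_F2 : (\int[(muS \x muS)%E]_z (F2 z)%:E =
  \int[lb]_y osc mud kd (fx y))%E.
Proof.
have mE : measurable_fun setT (EFin \o F2) by exact/measurable_EFinP.
have F20 z : (0 <= (EFin \o F2) z)%E by rewrite lee_fin.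
rewrite (fubini_tonelli2 (EFin \o F2))// ge0_integral_cons//; last 2 first.
- exact: (measurable_fun_fubini_tonelli_G _ mE F20).
- by move=> x; apply: integral_ge0.
apply: eq_integral => y _; rewrite /osc fubini_tonelli1/=; last 2 first.
- by apply/measurable_EFinP; exact: (measurable_osc kdP (mfx y)).
- by move=> z; rewrite lee_fin mulr_ge0 ?sqr_ge0// (markov_ge0 kdP).
by apply: eq_integral => t _; exact: int_F2_inner.
Qed.

(** In each of the two steps one factor of the kernel is idle and integrates to
    1, which leaves the oscillation of the sections of [f]. *)
Lemma osc_step_le : (osc muS kS f <= 2%:E * \int[mud]_s osc lb k1 (fx ^~ s) +
                                   2%:E * \int[lb]_y osc mud kd (fx y))%E.
Proof. by rewrite -int_F1 -int_F2; exact: osc_head_tail. Qed.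

Lemma measurable_osc_head : measurable_fun setT (fun s => osc lb k1 (fx ^~ s)).
Proof.
have mE : measurable_fun setT (EFin \o F1) by exact/measurable_EFinP.
have F10 z : (0 <= (EFin \o F1) z)%E by rewrite lee_fin.
have mG := measurable_fun_fubini_tonelli_F (EFin \o F1) mE F10 : measurable_fun setT
  (fun p => \int[muS]_q (F1 (p, q))%:E)%E.
have mG' : measurable_fun setT (fun z : RR * E =>
    \int[muS]_q (F1 (cons_pair z, q))%:E)%E.
  exact: (measurableT_comp mG (@measurable_cons_pair R d)).
have G'0 (z : RR * E) : (0 <= \int[muS]_q (F1 (cons_pair z, q))%:E)%E.
  by apply: integral_ge0 => q _; rewrite lee_fin.
have := measurable_fun_fubini_tonelli_G (m1 := lb) _ mG' G'0.
congr (measurable_fun _ _); apply/funext => s; rewrite /osc fubini_tonelli1/=; last 2 first.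
- by apply/measurable_EFinP; exact: (measurable_osc k1P (mfs s)).
- by move=> z; rewrite lee_fin mulr_ge0 ?sqr_ge0// (markov_ge0 k1P).
by apply: eq_integral => x _; exact: int_F1_inner.
Qed.

Lemma measurable_osc_tail : measurable_fun setT (fun y => osc mud kd (fx y)).
Proof.
have mE : measurable_fun setT (EFin \o F2) by exact/measurable_EFinP.
have F20 z : (0 <= (EFin \o F2) z)%E by rewrite lee_fin.
have mG := measurable_fun_fubini_tonelli_G (EFin \o F2) mE F20 : measurable_fun setT
  (fun q => \int[muS]_p (F2 (p, q))%:E)%E.
have mG' : measurable_fun setT (fun z : RR * E =>
    \int[muS]_p (F2 (p, cons_pair z))%:E)%E.
  exact: (measurableT_comp mG (@measurable_cons_pair R d)).
have G'0 (z : RR * E) : (0 <= \int[muS]_p (F2 (p, cons_pair z))%:E)%E.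
  by apply: integral_ge0 => q _; rewrite lee_fin.
have := measurable_fun_fubini_tonelli_F (m2 := mud) _ mG' G'0.
congr (measurable_fun _ _); apply/funext => y; rewrite /osc fubini_tonelli1/=; last 2 first.
- by apply/measurable_EFinP; exact: (measurable_osc kdP (mfx y)).
- by move=> z; rewrite lee_fin mulr_ge0 ?sqr_ge0// (markov_ge0 kdP).
by apply: eq_integral => t _; exact: int_F2_inner.
Qed.

End fixed_n.

Let mf2 : measurable_fun setT (fun t => (f t ^+ 2)%:E).
Proof. exact/measurable_EFinP/measurable_funX. Qed.

Let mf2c : measurable_fun setT (fun z : RR * E => (f (cons_pair z) ^+ 2)%:E).
Proof. exact: (measurableT_comp mf2 (@measurable_cons_pair R d)). Qed.

Let f20 z : (0 <= (f (cons_pair z : euclid R d.+1) ^+ 2)%:E)%E.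
Proof. by rewrite lee_fin sqr_ge0. Qed.

Lemma sqint_head : (sqint muS f = \int[mud]_s sqint lb (fx ^~ s))%E.
Proof. by rewrite /sqint ge0_integral_cons2// => t; rewrite lee_fin sqr_ge0. Qed.

Lemma sqint_tail : (sqint muS f = \int[lb]_x sqint mud (fx x))%E.
Proof. by rewrite /sqint ge0_integral_cons// => t; rewrite lee_fin sqr_ge0. Qed.

(** Almost all sections of [f] are square integrable, hence tame; their
    oscillations are dominated by four times their energies, and the latter are
    integrable. *)
Lemma tame_step :
  (forall g : E -> R, measurable_fun setT g -> (sqint mud g < +oo)%E ->
     tame mud (fun n => @tuple_kernel R n d) g) ->
  (sqint muS f < +oo)%E -> tame muS (fun n => @tuple_kernel R n d.+1) f.
Proof.
move=> tame_d ffin.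
have mhead : measurable_fun setT (fun s => sqint lb (fx ^~ s)).
  exact: (measurable_fun_fubini_tonelli_G _ mf2c f20).
have mtail : measurable_fun setT (fun x => sqint mud (fx x)).
  exact: (measurable_fun_fubini_tonelli_F _ mf2c f20).
apply: (@squeeze_cvge0 _ _ (fun n =>
   2%:E * \int[mud]_s osc lb (line_kernel n) (fx ^~ s) +
   2%:E * \int[lb]_y osc mud (@tuple_kernel R n d) (fx y))%E).
  by move=> n; rewrite osc_step_le andbT osc_ge0//; exact: tuple_kernelP.
have h1 n s := osc_ge0 (@line_kernelP R n) (fx ^~ s).
have h2 n x := osc_ge0 (@tuple_kernelP R n d) (fx x).
have fin4' u : (0 <= u -> 4%:E * u < +oo -> u < +oo :> \bar R)%E.
  by case: u => [r _| |_] //; rewrite ?ltry// mulry gtr0_sg// mul1e.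
apply: cvge0_comb => //.
- by move=> n; exact: integral_ge0.
- by move=> n; exact: integral_ge0.
- apply: (@ge0_dominated_cvg0_ereal _ _ _ _ _ (fun s => 4%:E * sqint lb (fx ^~ s))%E).
  + exact: measurable_osc_head.
  + apply/integrableP; split; first exact: measurable_funeM.
    under eq_integral do rewrite gee0_abs ?mule_ge0 ?sqint_ge0//.
    rewrite ge0_integralZl//; last by move=> s _; exact: sqint_ge0.
    by rewrite -sqint_head lte_mul_pinfty.
  + by move=> n s; rewrite h1 (osc_le_sqint (line_kernelP n)).
  + by move=> s /fin4' sfin; apply: tame_line => //; apply: sfin; exact: sqint_ge0.
- apply: (@ge0_dominated_cvg0_ereal _ _ _ _ _ (fun x => 4%:E * sqint mud (fx x))%E).
  + exact: measurable_osc_tail.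
  + apply/integrableP; split; first exact: measurable_funeM.
    under eq_integral do rewrite gee0_abs ?mule_ge0 ?sqint_ge0//.
    rewrite ge0_integralZl//; last by move=> s _; exact: sqint_ge0.
    by rewrite -sqint_tail lte_mul_pinfty.
  + by move=> n x; rewrite h2 (osc_le_sqint (tuple_kernelP n d)).
  + by move=> s /fin4' sfin; apply: tame_d => //; apply: sfin; exact: sqint_ge0.
Qed.

End step.

Lemma tame_tuple d (f : euclid R d -> R) : measurable_fun setT f ->
  (sqint (lebesgue_tuple R d) f < +oo)%E ->
  tame (lebesgue_tuple R d) (fun n => @tuple_kernel R n d) f.
Proof.
elim: d f => [|d IHd] f mf ffin; last exact: tame_step.
rewrite /tame (_ : (fun n => _) = cst 0%E); first exact: cvg_cst.
apply/funext => n; rewrite /osc integral0_eq// => z _.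
by rewrite (tuple0 z.1) (tuple0 z.2) subrr expr0n/= mul0r.
Qed.

End tame_tuple.

(** * Product weights and their Fourier integrals *)

Section tuple_abel.
Context {R : realType}.
Notation RR := (measurableTypeR R).
Notation lb := (@lebesgue_measure R : {sigma_finite_measure set RR -> \bar R}).

Lemma integral_cons d (F : euclid R d.+1 -> R) :
    (lebesgue_tuple R d.+1).-integrable setT (EFin \o F) ->
  (\int[lebesgue_tuple R d.+1]_t (F t)%:E =
   \int[lb]_x \int[lebesgue_tuple R d]_t (F (cons_pair (x, t)))%:E)%E.
Proof.
move=> iF; have mF : measurable_fun setT (EFin \o F) by case/integrableP: iF.
have mFc := measurableT_comp mF (@measurable_cons_pair R d).
have iFc : (lb \x lebesgue_tuple R d)%E.-integrable setT (EFin \o F \o @cons_pair R d).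
  apply/integrableP; split => //.
  rewrite -(ge0_integral_cons_prod (F := fun t => `|(F t)%:E|%E)).
  - by case/integrableP: iF.
  - exact: measurableT_comp.
  - by move=> t; exact: abse_ge0.
have h := @integral_pushforward _ _ _ _ R (@cons_pair R d) (@measurable_cons_pair R d)
  (lb \x lebesgue_tuple R d)%E setT (EFin \o F) mF.
rewrite preimage_setT in h; rewrite (h iFc measurableT).
by rewrite -(integral12_prod_meas1 iFc).
Qed.

Definition tuple_abel (n d : nat) (w : euclid R d) : R :=
  \prod_(i < d) abel (harmonic n) (tnth w i).

Lemma tuple_abel_cons n d x (w : euclid R d) :
  tuple_abel n (cons_pair (x, w)) = abel (harmonic n) x * tuple_abel n w.
Proof.
rewrite /tuple_abel big_ord_recl/=; congr (_ * _).
by apply: eq_bigr => i _; rewrite tnth_cons_pairS.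
Qed.

Lemma tuple_abel_gt0 n d (w : euclid R d) : 0 < tuple_abel n w.
Proof. by apply: prodr_gt0 => i _; exact: abel_gt0. Qed.

Lemma measurable_tuple_abel n d : measurable_fun setT (@tuple_abel n d).
Proof.
apply: measurable_prod => i _.
apply: (measurableT_comp (measurable_abel (harmonic n))).
exact: measurable_tnth.
Qed.

Let h0 n : 0 < harmonic n :> R. Proof. exact: harmonic_gt0. Qed.

Lemma integral_tuple_abel_lty n d :
  (\int[lebesgue_tuple R d]_w (tuple_abel n w)%:E < +oo)%E.
Proof.
elim: d => [|d IHd].
  rewrite integral_dirac//; last by apply/measurable_EFinP; exact: measurable_tuple_abel.
  by rewrite diracT mul1e ltry.
have mE : measurable_fun setT (fun w : euclid R d => (tuple_abel n w)%:E).
  by apply/measurable_EFinP; exact: measurable_tuple_abel.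
have W0 (w : euclid R d) : [set: _] w -> (0 <= (tuple_abel n w)%:E)%E.
  by move=> _; rewrite lee_fin ltW// tuple_abel_gt0.
rewrite ge0_integral_cons; last 2 first.
- by apply/measurable_EFinP; exact: measurable_tuple_abel.
- by move=> w; rewrite lee_fin ltW// tuple_abel_gt0.
have fW : (\int[lebesgue_tuple R d]_w (tuple_abel n w)%:E)%E \is a fin_num.
  by rewrite ge0_fin_numE//; exact: integral_ge0.
under eq_integral => x _.
  under eq_integral do rewrite tuple_abel_cons EFinM.
  rewrite ge0_integralZl//; last by rewrite lee_fin ltW// abel_gt0.
  rewrite -(fineK fW) muleC.
  over.
rewrite ge0_integralZl//; last 3 first.
- by apply/measurable_EFinP; exact: measurable_abel.
- by move=> x _; rewrite lee_fin ltW// abel_gt0.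
- by rewrite lee_fin fine_ge0//; exact: integral_ge0.
by rewrite integral_abel// -EFinM ltry.
Qed.

Lemma integrable_tuple_abel n d (h : euclid R d -> R) (M : R) : measurable_fun setT h ->
    (forall w, `|h w| <= M) ->
  (lebesgue_tuple R d).-integrable setT (fun w => (tuple_abel n w * h w)%:E).
Proof.
move=> mh h1; have M0 : 0 <= M by exact: le_trans (normr_ge0 _) (h1 [tuple 0 | i < d]).
have mW := @measurable_tuple_abel n d.
apply/integrableP; split; first exact/measurable_EFinP/measurable_funM.
apply: (@le_lt_trans _ _ (\int[lebesgue_tuple R d]_w (M * tuple_abel n w)%:E)%E).
  apply: (@ge0_le_integral_EFin _ _ _ (lebesgue_tuple R d) (fun w => `|tuple_abel n w * h w|)).
  - by apply: measurableT_comp => //; exact: measurable_funM.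
  - exact: measurable_funM.
  - move=> w; rewrite normr_ge0/= normrM mulrC (ger0_norm (ltW (tuple_abel_gt0 n w))).
    by rewrite ler_wpM2r// ltW// tuple_abel_gt0.
under eq_integral do rewrite EFinM.
have fin := integral_tuple_abel_lty n d.
rewrite ge0_integralZl//.
- by rewrite lte_mul_pinfty.
- exact/measurable_EFinP.
- by move=> w _; rewrite lee_fin ltW// tuple_abel_gt0.
Qed.

Definition angle d (x w : euclid R d) : R := 2 * pi * dot x w.

Lemma angle_cons d x (s : euclid R d) y t :
  angle (cons_pair (x, s)) (cons_pair (y, t)) = 2 * pi * (x * y) + angle s t.
Proof.
rewrite /angle /dot big_ord_recl/= mulrDr; congr (_ * _ + _ * _).
by apply: eq_bigr => i _; rewrite !tnth_cons_pairS.
Qed.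

Lemma measurable_angle d :
  measurable_fun setT (fun z : euclid R d * euclid R d => angle z.1 z.2).
Proof.
apply: measurable_funM => //; apply: measurable_sum => i.
have mi : measurable_fun setT ((@tnth d RR)^~ i) by exact: measurable_tnth.
apply: measurable_funM.
- exact: (measurableT_comp mi measurable_fst).
- exact: (measurableT_comp mi measurable_snd).
Qed.

Lemma measurable_angle_r d (x : euclid R d) : measurable_fun setT (angle x).
Proof. exact: (measurableT_comp (@measurable_angle d) (pair1_measurable x)). Qed.

Lemma measurable_angle_l d (w : euclid R d) : measurable_fun setT (fun x => angle x w).
Proof. exact: (measurableT_comp (@measurable_angle d) (pair2_measurable w)). Qed.

Lemma measurable_cosR : measurable_fun setT (@cos R).
Proof. by apply: continuous_measurable_fun => t; exact: continuous_cos. Qed.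

Lemma measurable_sinR : measurable_fun setT (@sin R).
Proof. by apply: continuous_measurable_fun => t; exact: continuous_sin. Qed.

Lemma normr_cos_le1 (t : R) : `|cos t| <= 1.
Proof. by rewrite ler_norml cos_geN1 cos_le1. Qed.

Lemma normr_sin_le1 (t : R) : `|sin t| <= 1.
Proof. by rewrite ler_norml sin_geN1 sin_le1. Qed.

(** The addition formulas mix cosine and sine, so the induction on the dimension
    has to carry both integrals. *)
Lemma integral_tuple_abel_cos_sin n d (x y : euclid R d) :
  ((\int[lebesgue_tuple R d]_w (tuple_abel n w * cos (angle x w - angle y w))%:E =
   (tuple_kernel n (x, y))%:E) /\
  (\int[lebesgue_tuple R d]_w (tuple_abel n w * sin (angle x w - angle y w))%:E = 0))%E.
Proof.
have md k (u v : euclid R k) : measurable_fun setT (fun w => angle u w - angle v w).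
  by apply: measurable_funB; exact: measurable_angle_r.
have ic k (u v : euclid R k) : (lebesgue_tuple R k).-integrable setT
    (EFin \o (fun w => tuple_abel n w * cos (angle u w - angle v w))).
  apply: (@integrable_tuple_abel n k _ 1); last by move=> w; exact: normr_cos_le1.
  exact: (measurableT_comp measurable_cosR (md k u v)).
have is_ k (u v : euclid R k) : (lebesgue_tuple R k).-integrable setT
    (EFin \o (fun w => tuple_abel n w * sin (angle u w - angle v w))).
  apply: (@integrable_tuple_abel n k _ 1); last by move=> w; exact: normr_sin_le1.
  exact: (measurableT_comp measurable_sinR (md k u v)).
elim: d => [|d IHd] in x y *.
  rewrite !integral_dirac//; [|by case/integrableP: (is_ 0%N x y)|by case/integrableP: (ic 0%N x y)].
  by rewrite diracT !mul1e /tuple_abel /tuple_kernel !big_ord0 /angle /dot !big_ord0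
    mulr0 subr0 cos0 sin0 !mul1r.
rewrite -(cons_pairK x) -(cons_pairK y).
move: (tnth x ord0) (tnth y ord0) (euclid_tail x) (euclid_tail y) => {}x {}y s t.
have [IHc IHs] := IHd s t.
pose c : R := 2 * pi * (x - y).
have dE w (r : euclid R d) : angle (cons_pair (x, s)) (cons_pair (w, r)) -
    angle (cons_pair (y, t)) (cons_pair (w, r)) = c * w + (angle s r - angle t r).
  by rewrite !angle_cons /c; ring.
split.
- rewrite integral_cons; last exact: ic.
  transitivity (\int[lb]_w ((tuple_kernel n (s, t))%:E *
      (abel (harmonic n) w * cos (c * w))%:E))%E.
    apply: eq_integral => w _.
    transitivity (\int[lebesgue_tuple R d]_r
      ((abel (harmonic n) w * cos (c * w))%:E * (tuple_abel n r * cos (angle s r - angle t r))%:E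
       - (abel (harmonic n) w * sin (c * w))%:E * (tuple_abel n r * sin (angle s r - angle t r))%:E))%E.
      apply: eq_integral => r _; rewrite dE tuple_abel_cons (cosD (c * w)) -!EFinM -EFinB.
      by congr (_%:E); ring.
    rewrite integralB//; [|exact/integrableZl/ic|exact/integrableZl/is_].
    rewrite !integralZl//; [|exact: is_|exact: ic].
    by rewrite IHc IHs mule0 sube0 muleC.
  rewrite integralZl//; last first.
    apply: integrable_abelM => //; last by move=> w; exact: normr_cos_le1.
    by apply: (measurableT_comp measurable_cosR); exact: measurable_funM.
  rewrite integral_abel_cos// -EFinM tuple_kernel_cons mulrC.
  by [].
- rewrite integral_cons; last exact: is_.
  transitivity (\int[lb]_w ((tuple_kernel n (s, t))%:E *
      (abel (harmonic n) w * sin (c * w))%:E))%E.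
    apply: eq_integral => w _.
    transitivity (\int[lebesgue_tuple R d]_r
      ((abel (harmonic n) w * sin (c * w))%:E * (tuple_abel n r * cos (angle s r - angle t r))%:E
       + (abel (harmonic n) w * cos (c * w))%:E * (tuple_abel n r * sin (angle s r - angle t r))%:E))%E.
      apply: eq_integral => r _; rewrite dE tuple_abel_cons (sinD (c * w)) -!EFinM -EFinD.
      by congr (_%:E); ring.
    rewrite integralD//; [|exact/integrableZl/ic|exact/integrableZl/is_].
    rewrite !integralZl//; [|exact: is_|exact: ic].
    by rewrite IHc IHs mule0 adde0 muleC.
  rewrite integralZl//; last first.
    apply: integrable_abelM => //; last by move=> w; exact: normr_sin_le1.
    by apply: (measurableT_comp measurable_sinR); exact: measurable_funM.
  by rewrite integral_abel_sin// mule0.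
Qed.

End tuple_abel.

(** * The Fourier integral in real form *)

Section plancherel.
Context {R : realType}.
Variable d : nat.
Notation E := (euclid R d).
Notation mu := (lebesgue_tuple R d).
Implicit Types a b : E -> R.

Definition oscillatory a b (x w : E) : R := a x * cos (angle x w) + b x * sin (angle x w).

(** [ft a b] and [ft b (- a)] are the real and imaginary parts of the Fourier
    integral of [a + i b]; see [fourier1E]. *)
Definition ft a b (w : E) : R := \int[mu]_x oscillatory a b x w.

Lemma measurable_oscillatory a b : measurable_fun setT a -> measurable_fun setT b ->
  measurable_fun setT (fun z : E * E => oscillatory a b z.1 z.2).
Proof.
move=> ma mb; apply: measurable_funD; apply: measurable_funM.
- exact: measurable_comp_fst.
- exact: (measurableT_comp measurable_cosR (@measurable_angle R d)).
- exact: measurable_comp_fst.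
- exact: (measurableT_comp measurable_sinR (@measurable_angle R d)).
Qed.

Lemma oscillatory_le a b x w : `|oscillatory a b x w| <= `|a x| + `|b x|.
Proof.
rewrite (le_trans (ler_normD _ _))// !normrM lerD// ler_piMr//.
- exact: normr_cos_le1.
- exact: normr_sin_le1.
Qed.

Lemma integrable_prod_dominated (g : E -> R) (h : E -> R) (F : E * E -> R) :
    measurable_fun setT F -> mu.-integrable setT (EFin \o g) ->
    mu.-integrable setT (EFin \o h) ->
    (forall x w, `|F (x, w)| <= g x * h w) ->
  (mu \x mu)%E.-integrable setT (EFin \o F).
Proof.
move=> mF /integrableP[mg ig] /integrableP[mh ih] Fgh.
have {}mg : measurable_fun setT g by exact/measurable_EFinP.
have {}mh : measurable_fun setT h by exact/measurable_EFinP.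
apply/integrable12ltyP; first exact/measurable_EFinP.
have mF1 x : measurable_fun setT (fun w => F (x, w)).
  exact: (measurableT_comp mF (pair1_measurable x)).
have mnF : measurable_fun setT (fun z : E * E => (`|F z|)%:E).
  exact/measurable_EFinP/measurableT_comp.
have nF0 (z : E * E) : (0 <= (`|F z|)%:E)%E by rewrite lee_fin.
have mng : measurable_fun setT (fun x => (`|g x|)%:E) by exact/measurable_EFinP/measurableT_comp.
have mnh : measurable_fun setT (fun x => (`|h x|)%:E) by exact/measurable_EFinP/measurableT_comp.
have fh : (\int[mu]_w `|(h w)%:E|)%E \is a fin_num.
  by rewrite ge0_fin_numE//; exact: integral_ge0.
apply: (@le_lt_trans _ _ (\int[mu]_x ((`|g x|)%:E * \int[mu]_w `|(h w)%:E|))%E).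
  apply: ge0_le_integral => //.
  - by move=> x _; exact: integral_ge0.
  - exact: (measurable_fun_fubini_tonelli_F _ mnF nF0).
  - by rewrite -(fineK fh); apply: emeasurable_funM => //; exact: measurable_cst.
  - move=> x _; rewrite -ge0_integralZl//.
    apply: ge0_le_integral => //.
    + by apply/measurable_EFinP; apply: measurableT_comp.
    + exact: measurable_funeM.
    + by move=> w ?; rewrite /= -EFinM lee_fin (le_trans (Fgh x w))// -normrM ler_norm.
rewrite -(fineK fh); under eq_integral do rewrite muleC.
rewrite ge0_integralZl//; last by rewrite lee_fin fine_ge0//; exact: integral_ge0.
by rewrite lte_mul_pinfty// lee_fin fine_ge0//; exact: integral_ge0.
Qed.

Section integrable_pair.
Variables a b : E -> R.
Hypotheses (ia : mu.-integrable setT (EFin \o a)) (ib : mu.-integrable setT (EFin \o b)).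

Let ma : measurable_fun setT a.
Proof. by have /integrableP[/measurable_EFinP] := ia. Qed.

Let mb : measurable_fun setT b.
Proof. by have /integrableP[/measurable_EFinP] := ib. Qed.

Let m (x : E) : R := `|a x| + `|b x|.

Let m0 x : 0 <= m x. Proof. exact: addr_ge0. Qed.

Let im : mu.-integrable setT (EFin \o m).
Proof.
have -> : EFin \o m = (abse \o (EFin \o a)) \+ (abse \o (EFin \o b)) by [].
by apply: integrableD => //; exact: integrable_abse.
Qed.

Lemma integrable_oscillatory w : mu.-integrable setT (fun x => (oscillatory a b x w)%:E).
Proof.
apply: le_integrable im => //.
- apply/measurable_EFinP.
  exact: (measurableT_comp (measurable_oscillatory ma mb) (pair2_measurable w)).
- move=> x _ /=; rewrite lee_fin (le_trans (oscillatory_le _ _ _ _))//.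
  by rewrite -/(m x) ler_norm.
Qed.

Lemma ftE w : (ft a b w)%:E = (\int[mu]_x (oscillatory a b x w)%:E)%E.
Proof. by rewrite fineK//; apply: integrable_fin_num => //; exact: integrable_oscillatory. Qed.

Lemma ft_bounded w : `|ft a b w| <= \int[mu]_x (`|a x| + `|b x|).
Proof.
have iu := integrable_oscillatory w.
rewrite (le_trans (le_normr_Rintegral _ iu))//.
apply: le_Rintegral => //; first exact: integrable_norm.
by move=> x _; exact: oscillatory_le.
Qed.

(** Measurability of a parametric integral comes with Fubini's theorem, but
    [oscillatory a b x w] is not integrable in [(x, w)]; it becomes so after
    multiplication by a positive weight in [w], which is divided out at the end. *)
Lemma measurable_ft : measurable_fun setT (ft a b).
Proof.
pose F (z : E * E) := tuple_abel 0 z.2 * oscillatory a b z.1 z.2.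
have mF : measurable_fun setT F.
  apply: measurable_funM; last exact: measurable_oscillatory.
  exact: (measurable_comp_snd (@measurable_tuple_abel R 0 d)).
have iW : mu.-integrable setT (EFin \o @tuple_abel R 0 d).
  have := @integrable_tuple_abel R 0 d (cst 1) 1 (measurable_cst _).
  rewrite (_ : (fun w => _) = (EFin \o @tuple_abel R 0 d)); last first.
    by apply/funext => w /=; rewrite mulr1.
  by apply => w /=; rewrite normr1.
have iF : (mu \x mu)%E.-integrable setT (EFin \o F).
  apply: (integrable_prod_dominated mF im iW) => x w.
  rewrite /F/= normrM (ger0_norm (ltW (tuple_abel_gt0 0 w))) mulrC.
  by rewrite ler_wpM2r ?oscillatory_le// ltW// tuple_abel_gt0.
have mG := measurable_fubini_G iF.
rewrite (_ : ft a b = fun w => (tuple_abel 0 w)^-1 * fine (fubini_G mu (EFin \o F) w)).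
  apply: measurable_funM.
  - rewrite (_ : (fun w => _) = fun w : E => tuple_abel 0 w `^ (-1)); last first.
      by apply/funext => w; rewrite powR_inv1// ltW// tuple_abel_gt0.
    by apply: (measurableT_comp (measurable_powR (-1))); exact: measurable_tuple_abel.
  - exact: measurableT_comp.
apply/funext => w; rewrite /fubini_G/= /F/=.
under eq_integral do rewrite EFinM.
rewrite integralZl//; last exact: integrable_oscillatory.
by rewrite -ftE -EFinM/= mulKf// gt_eqF// tuple_abel_gt0.
Qed.

End integrable_pair.
End plancherel.

(** * The weighted Plancherel identity *)

Section plancherel_identity.
Context {R : realType}.
Variable d : nat.
Notation E := (euclid R d).
Notation mu := (lebesgue_tuple R d).
Variables a b : E -> R.
Hypotheses (ia : mu.-integrable setT (EFin \o a)) (ib : mu.-integrable setT (EFin \o b)).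
Hypotheses (fa : (sqint mu a < +oo)%E) (fb : (sqint mu b < +oo)%E).

Let a' (x : E) : R := - a x.

Let ia' : mu.-integrable setT (EFin \o a').
Proof. by exact: (integrableN ia). Qed.

Let ma : measurable_fun setT a.
Proof. by have /integrableP[/measurable_EFinP] := ia. Qed.

Let mb : measurable_fun setT b.
Proof. by have /integrableP[/measurable_EFinP] := ib. Qed.

Let ma' : measurable_fun setT a'.
Proof. by have /integrableP[/measurable_EFinP] := ia'. Qed.

Let u1 := oscillatory a b.
Let u2 := oscillatory b a'.
Let f1 := ft a b.
Let f2 := ft b a'.

Let m (x : E) : R := `|a x| + `|b x|.

Let im : mu.-integrable setT (EFin \o m).
Proof.
have -> : EFin \o m = (abse \o (EFin \o a)) \+ (abse \o (EFin \o b)) by [].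
by apply: integrableD => //; exact: integrable_abse.
Qed.

Let u1_le x w : `|u1 x w| <= m x. Proof. exact: oscillatory_le. Qed.

Let u2_le x w : `|u2 x w| <= m x.
Proof. by rewrite (le_trans (oscillatory_le _ _ _ _))// /m addrC normrN. Qed.

Let M : R := \int[mu]_x m x.

Let M0 : 0 <= M.
Proof. by apply: Rintegral_ge0 => x _; exact: addr_ge0. Qed.

Let f1_le w : `|f1 w| <= M. Proof. exact: ft_bounded. Qed.

Let f2_le w : `|f2 w| <= M.
Proof.
rewrite (le_trans (ft_bounded ib ia' w))// /M le_eqVlt; apply/orP; left.
by apply/eqP; apply: eq_Rintegral => x _; rewrite /m addrC normrN.
Qed.

Let mf1 : measurable_fun setT f1. Proof. exact: measurable_ft. Qed.
Let mf2 : measurable_fun setT f2. Proof. exact: measurable_ft. Qed.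

Section fixed_n.
Variable n : nat.
Let W := @tuple_abel R n d.
Let mW : measurable_fun setT W. Proof. exact: measurable_tuple_abel. Qed.
Let W0 w : 0 <= W w. Proof. exact/ltW/tuple_abel_gt0. Qed.

Let iWh (h : E -> R) : measurable_fun setT h -> (forall w, `|h w| <= 1) ->
  mu.-integrable setT (fun w => (W w * h w)%:E).
Proof. by move=> mh h1; apply: integrable_tuple_abel h1. Qed.

Let iW : mu.-integrable setT (EFin \o W).
Proof.
have := @iWh (cst 1) (measurable_cst _).
rewrite (_ : (fun w => _) = (EFin \o W)); last by apply/funext => w /=; rewrite mulr1.
by apply => w /=; rewrite normr1.
Qed.

Let iu1 w : mu.-integrable setT (fun x => (u1 x w)%:E).
Proof. exact: integrable_oscillatory. Qed.

Let iu2 w : mu.-integrable setT (fun x => (u2 x w)%:E).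
Proof. exact: integrable_oscillatory. Qed.

Let comb (r1 r2 : R) w :
  (\int[mu]_x (r1 * u1 x w + r2 * u2 x w)%:E = (r1 * f1 w + r2 * f2 w)%:E)%E.
Proof.
under eq_integral do rewrite EFinD !EFinM.
rewrite integralD//; [|exact: (integrableZl measurableT r1 (iu1 w))
                      |exact: (integrableZl measurableT r2 (iu2 w))].
by rewrite !integralZl// EFinD !EFinM !ftE.
Qed.

Let H (z : E * E) : R := W z.2 * f1 z.2 * u1 z.1 z.2 + W z.2 * f2 z.2 * u2 z.1 z.2.

Let mu1 : measurable_fun setT (fun z : E * E => u1 z.1 z.2).
Proof. exact: measurable_oscillatory. Qed.

Let mu2 : measurable_fun setT (fun z : E * E => u2 z.1 z.2).
Proof. exact: measurable_oscillatory. Qed.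

Let mH : measurable_fun setT H.
Proof.
apply: measurable_funD; apply: measurable_funM => //.
- exact: (measurable_comp_snd (measurable_funM mW mf1)).
- exact: (measurable_comp_snd (measurable_funM mW mf2)).
Qed.

Let iH : (mu \x mu)%E.-integrable setT (EFin \o H).
Proof.
have i2 : mu.-integrable setT (EFin \o (fun w => (2 * M) * W w)).
  exact: (integrableZl measurableT (2 * M) iW).
apply: (integrable_prod_dominated mH im i2) => x w; rewrite /H/=.
rewrite (le_trans (ler_normD _ _))// !normrM (ger0_norm (W0 w)).
rewrite (_ : m x * _ = W w * M * m x + W w * M * m x); last by ring.
by rewrite lerD// ler_pM ?mulr_ge0// ler_wpM2l.
Qed.

Let G x (z : E * E) : R := W z.2 * u1 x z.2 * u1 z.1 z.2 + W z.2 * u2 x z.2 * u2 z.1 z.2.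

Let mG x : measurable_fun setT (G x).
Proof.
apply: measurable_funD; apply: measurable_funM => //.
- apply: (measurable_comp_snd (f := fun w => W w * u1 x w)).
  by apply: measurable_funM => //; exact: (measurableT_comp mu1 (pair1_measurable x)).
- apply: (measurable_comp_snd (f := fun w => W w * u2 x w)).
  by apply: measurable_funM => //; exact: (measurableT_comp mu2 (pair1_measurable x)).
Qed.

Let iG x : (mu \x mu)%E.-integrable setT (EFin \o G x).
Proof.
have i2 : mu.-integrable setT (EFin \o (fun w => (2 * m x) * W w)).
  exact: (integrableZl measurableT (2 * m x) iW).
apply: (integrable_prod_dominated (mG x) im i2) => y w; rewrite /G/=.
rewrite (le_trans (ler_normD _ _))// !normrM (ger0_norm (W0 w)).
rewrite (_ : m y * _ = W w * m x * m y + W w * m x * m y); last by ring.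
by rewrite lerD// ler_pM ?mulr_ge0// ler_wpM2l.
Qed.

Let kn := @tuple_kernel R n d.

(** The two factors of each square are expanded into integrals one after the
    other, so that only functions of two variables are ever exchanged.  The
    sine terms disappear because the weight is even. *)
Lemma weighted_ft_eq :
  (\int[mu]_w (W w * (f1 w ^+ 2 + f2 w ^+ 2))%:E =
   \int[mu]_x \int[mu]_y ((a x * a y + b x * b y) * kn (x, y))%:E)%E.
Proof.
transitivity (\int[mu]_w \int[mu]_x (EFin \o H) (x, w))%E.
  by apply: eq_integral => w _; rewrite /H/= comb; congr (_%:E); ring.
rewrite -(Fubini iH); apply: eq_integral => x _.
transitivity (\int[mu]_w \int[mu]_y (EFin \o G x) (y, w))%E.
  by apply: eq_integral => w _; rewrite /H /G/= comb; congr (_%:E); ring.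
rewrite -(Fubini (iG x)); apply: eq_integral => y _.
have md : measurable_fun setT (fun w : E => angle x w - angle y w).
  by apply: measurable_funB; exact: measurable_angle_r.
have ic := iWh (measurableT_comp measurable_cosR md) (fun w => normr_cos_le1 _).
have is_ := iWh (measurableT_comp measurable_sinR md) (fun w => normr_sin_le1 _).
have [Ic Is] := integral_tuple_abel_cos_sin n x y.
transitivity (\int[mu]_w ((a x * a y + b x * b y)%:E * (W w * cos (angle x w - angle y w))%:E
  + (b x * a y - a x * b y)%:E * (W w * sin (angle x w - angle y w))%:E))%E.
  apply: eq_integral => w _; rewrite -!EFinM -EFinD /G/= /u1 /u2 /oscillatory /a'.
  by rewrite cosB sinB; congr (_%:E); ring.
rewrite integralD//; [|exact: (integrableZl measurableT _ ic)|exact: (integrableZl measurableT _ is_)].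
by rewrite !integralZl// Ic Is mule0 adde0.
Qed.

Let knP := @tuple_kernelP R n d.
Let mk : measurable_fun setT kn := markov_measurable knP.
Let k0 := markov_ge0 knP.

(** The cross term is half of what remains of the squares after the
    oscillation is taken out: [2 a(x) a(y) = a(x)^2 + a(y)^2 - (a(x) - a(y))^2]. *)
Lemma weighted_ft_osc :
  (\int[mu]_w (W w * (f1 w ^+ 2 + f2 w ^+ 2))%:E +
    (2^-1)%:E * (osc mu kn a + osc mu kn b) = sqint mu a + sqint mu b)%E.
Proof.
pose s x := a x ^+ 2 + b x ^+ 2.
have s0 x : 0 <= s x by rewrite addr_ge0 ?sqr_ge0.
have ms : measurable_fun setT s by apply: measurable_funD; exact: measurable_funX.
pose S (z : E * E) := s z.1 * kn z + s z.2 * kn z.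
have mS1 : measurable_fun setT (fun z : E * E => s z.1 * kn z).
  by apply: measurable_funM => //; exact: measurable_comp_fst.
have mS2 : measurable_fun setT (fun z : E * E => s z.2 * kn z).
  by apply: measurable_funM => //; exact: measurable_comp_snd.
have S10 z : 0 <= s z.1 * kn z by rewrite mulr_ge0.
have S20 z : 0 <= s z.2 * kn z by rewrite mulr_ge0.
have Es : (\int[mu]_x (s x)%:E = sqint mu a + sqint mu b)%E.
  under eq_integral do rewrite EFinD.
  rewrite ge0_integralD//.
  - by move=> x _; rewrite lee_fin sqr_ge0.
  - exact/measurable_EFinP/measurable_funX.
  - by move=> x _; rewrite lee_fin sqr_ge0.
  - exact/measurable_EFinP/measurable_funX.
have fin2 : (sqint mu a + sqint mu b < +oo)%E by rewrite lte_add_pinfty.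
have ES : (\int[(mu \x mu)%E]_z (S z)%:E = 2%:E * (sqint mu a + sqint mu b))%E.
  under eq_integral do rewrite EFinD.
  rewrite ge0_integralD//; last 4 first.
  - by move=> z _; rewrite lee_fin.
  - exact/measurable_EFinP.
  - by move=> z _; rewrite lee_fin.
  - exact/measurable_EFinP.
  by rewrite (markov_integral_fst knP ms s0) (markov_integral_snd knP ms s0) Es mule_natl mule2n.
pose D (z : E * E) := (a z.1 - a z.2) ^+ 2 * kn z + (b z.1 - b z.2) ^+ 2 * kn z.
have D0 z : 0 <= D z by rewrite addr_ge0// mulr_ge0// sqr_ge0.
have mD : measurable_fun setT D.
  by apply: measurable_funD; exact: (measurable_osc knP).
have ED : (\int[(mu \x mu)%E]_z (D z)%:E = osc mu kn a + osc mu kn b)%E.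
  under eq_integral do rewrite EFinD.
  rewrite ge0_integralD//.
  - by move=> z _; rewrite lee_fin mulr_ge0// sqr_ge0.
  - by apply/measurable_EFinP; exact: (measurable_osc knP ma).
  - by move=> z _; rewrite lee_fin mulr_ge0// sqr_ge0.
  - by apply/measurable_EFinP; exact: (measurable_osc knP mb).
have iS : (mu \x mu)%E.-integrable setT (EFin \o S).
  apply/integrableP; split; first exact/measurable_EFinP/measurable_funD.
  under eq_integral => z _ do rewrite /= ger0_norm ?addr_ge0//.
  by rewrite ES lte_mul_pinfty.
have iD : (mu \x mu)%E.-integrable setT (EFin \o D).
  apply/integrableP; split; first exact/measurable_EFinP.
  under eq_integral => z _ do rewrite /= ger0_norm//.
  rewrite ED lte_add_pinfty//.
    by apply: le_lt_trans (osc_le_sqint knP ma) _; rewrite lte_mul_pinfty.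
  by apply: le_lt_trans (osc_le_sqint knP mb) _; rewrite lte_mul_pinfty.
pose C (z : E * E) := (a z.1 * a z.2 + b z.1 * b z.2) * kn z.
have CE z : C z = 2^-1 * S z - 2^-1 * D z by rewrite /C /S /D /s; field.
have iC : (mu \x mu)%E.-integrable setT (EFin \o C).
  rewrite (_ : EFin \o C = (fun z => (2^-1)%:E * (EFin \o S) z - (2^-1)%:E * (EFin \o D) z)%E).
    by apply: integrableB => //; apply: integrableZl.
  by apply/funext => z /=; rewrite CE EFinB !EFinM.
rewrite weighted_ft_eq.
have -> : (\int[mu]_x \int[mu]_y (C (x, y))%:E = \int[(mu \x mu)%E]_z (C z)%:E)%E.
  exact: (integral12_prod_meas1 iC).
have -> : (\int[(mu \x mu)%E]_z (C z)%:E =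
    (2^-1)%:E * \int[(mu \x mu)%E]_z (S z)%:E - (2^-1)%:E * \int[(mu \x mu)%E]_z (D z)%:E)%E.
  rewrite -!integralZl// -integralB//; [|exact: integrableZl|exact: integrableZl].
  by apply: eq_integral => z _; rewrite /= -!EFinM -EFinB CE.
have fD := integrable_fin_num measurableT iD.
rewrite -ED subeK; last by rewrite fin_numM.
by rewrite ES muleA -EFinM mulVf// mul1e.
Qed.

End fixed_n.
End plancherel_identity.

(** * Plancherel's identity *)

Section plancherel_theorem.
Context {R : realType}.
Variable d : nat.
Notation E := (euclid R d).
Notation mu := (lebesgue_tuple R d).

Let l1 (w : E) : R := \sum_(i < d) `|tnth w i|.

Let tuple_abelE n (w : E) : tuple_abel n w = expR (- (harmonic n * l1 w)).
Proof.
rewrite /l1 mulr_sumr -sumrN expR_sum; apply: eq_bigr => i _.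
by rewrite /abel mulNr.
Qed.

Let l1_ge0 w : 0 <= l1 w. Proof. exact: sumr_ge0. Qed.

Let tuple_abel_nd (w : E) m n : (m <= n)%N -> tuple_abel m w <= tuple_abel n w.
Proof.
move=> mn; rewrite !tuple_abelE ler_expR lerN2 ler_wpM2r//.
by rewrite /harmonic lef_pV2 ?posrE// ler_nat ltnS.
Qed.

Let tuple_abel_cvg1 (w : E) : (fun n => tuple_abel n w) @ \oo --> (1 : R).
Proof.
under eq_fun do rewrite tuple_abelE; rewrite -(@expR0 R).
have h : (fun n => - (harmonic n * l1 w)) @ \oo --> (0 : R).
  rewrite -[X in _ --> X]oppr0; apply: cvgN; rewrite -(mul0r (l1 w)).
  by apply: cvgMl; exact: cvg_harmonic.
exact: (continuous_cvg _ (@continuous_expR R 0) h).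
Qed.

(** The limit of [weighted_ft_osc]: the weights increase to 1 while the
    oscillations tend to 0. *)
Theorem plancherel (a b : E -> R) :
    mu.-integrable setT (EFin \o a) -> mu.-integrable setT (EFin \o b) ->
    (sqint mu a < +oo)%E -> (sqint mu b < +oo)%E ->
  (sqint mu (ft a b) + sqint mu (ft b (fun x => (- a x)%R)) = sqint mu a + sqint mu b)%E.
Proof.
move=> ia ib fa fb.
have ma : measurable_fun setT a by have /integrableP[/measurable_EFinP] := ia.
have mb : measurable_fun setT b by have /integrableP[/measurable_EFinP] := ib.
have ia' : mu.-integrable setT (EFin \o (fun x => - a x)) by exact: (integrableN ia).
pose f1 := ft a b; pose f2 := ft b (fun x => - a x).
have mf1 : measurable_fun setT (fun w => f1 w ^+ 2) by apply: measurable_funX; exact: measurable_ft.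
have mf2 : measurable_fun setT (fun w => f2 w ^+ 2) by apply: measurable_funX; exact: measurable_ft.
pose P w := f1 w ^+ 2 + f2 w ^+ 2.
have P0 w : 0 <= P w by rewrite addr_ge0 ?sqr_ge0.
have mP : measurable_fun setT P by exact: measurable_funD.
have -> : (sqint mu (ft a b) + sqint mu (ft b (fun x => (- a x)%R)) = \int[mu]_w (P w)%:E)%E.
  rewrite /P; under [RHS]eq_integral do rewrite EFinD.
  rewrite ge0_integralD//.
  - by move=> w _; rewrite lee_fin sqr_ge0.
  - exact/measurable_EFinP.
  - by move=> w _; rewrite lee_fin sqr_ge0.
  - exact/measurable_EFinP.
pose u n := (\int[mu]_w (tuple_abel n w * P w)%:E)%E.
pose v n := ((2^-1)%:E * osc mu (@tuple_kernel R n d) a +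
             (2^-1)%:E * osc mu (@tuple_kernel R n d) b)%E.
have cu : u @ \oo --> (\int[mu]_w (P w)%:E)%E.
  have -> : (\int[mu]_w (P w)%:E = \int[mu]_w limn (fun n => (tuple_abel n w * P w)%:E))%E.
    apply: eq_integral => w _; apply/esym/cvg_lim => //.
    apply: cvg_EFin; first exact: nearW.
    by rewrite -[X in _ --> X]mul1r; apply: cvgMl; exact: tuple_abel_cvg1.
  apply: cvg_monotone_convergence => //.
  - move=> n; apply/measurable_EFinP/measurable_funM => //.
    exact: measurable_tuple_abel.
  - by move=> n w _; rewrite lee_fin mulr_ge0// ltW// tuple_abel_gt0.
  - by move=> w _ m n mn; rewrite lee_fin ler_wpM2r// tuple_abel_nd.
have cv : v @ \oo --> 0%E.
  apply: cvge0_comb => //.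
  - by move=> n; apply: osc_ge0; exact: tuple_kernelP.
  - by move=> n; apply: osc_ge0; exact: tuple_kernelP.
  - exact: tame_tuple.
  - exact: tame_tuple.
have uv n : (u n + v n = sqint mu a + sqint mu b)%E.
  have oa := osc_ge0 (@tuple_kernelP R n d) a; have ob := osc_ge0 (@tuple_kernelP R n d) b.
  by rewrite -(weighted_ft_osc ia ib fa fb n) /v (ge0_muleDr _ oa ob).
have cuv : (fun n => u n + v n)%E @ \oo --> (\int[mu]_w (P w)%:E)%E.
  rewrite -[X in _ --> X]adde0; apply: cvgeD => //.
  by rewrite ?fin_num_adde_defl// fin_num_adde_defr.
apply: (@cvg_unique _ (@ereal_hausdorff R) _ _ _ _ cuv).
by rewrite (_ : (fun n => _) = cst (sqint mu a + sqint mu b)%E); [exact: cvg_cst|apply/funext].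
Qed.

End plancherel_theorem.

(** * Energy of a complex function *)

Section complex_energy.
Context d (T : measurableType d) (R : realType).
Variable mu : {measure set T -> \bar R}.
Implicit Types f g : T -> R[i].
Local Notation Re := complex.Re.
Local Notation Im := complex.Im.

Lemma cmodulus_ge0 (z : R[i]) : 0 <= cmodulus z.
Proof. by case: z => x y; rewrite /cmodulus /= sqrtr_ge0. Qed.

Lemma sqr_cmodulus (z : R[i]) : cmodulus z ^+ 2 = Re z ^+ 2 + Im z ^+ 2.
Proof. by case: z => x y; rewrite /cmodulus /= sqr_sqrtr// addr_ge0 ?sqr_ge0. Qed.

(** The square of the L2 norm. *)
Definition energy f : \bar R := (\int[mu]_x (cmodulus (f x) ^+ 2)%:E)%E.

Lemma energy_ge0 f : (0 <= energy f)%E.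
Proof. by apply: integral_ge0 => x _; rewrite lee_fin sqr_ge0. Qed.

Lemma cLnorm2E f : cLnorm mu 2%:E f = (energy f `^ 2^-1)%E.
Proof.
rewrite /cLnorm unlock /energy; congr (_ `^ _)%E.
apply: eq_integral => x _; rewrite abse_EFin poweR_EFin; congr (_%:E).
by rewrite powR_mulrn ?normr_ge0// ger0_norm// cmodulus_ge0.
Qed.

Lemma energyE f : energy f = (cLnorm mu 2%:E f `^ 2)%E.
Proof. by rewrite cLnorm2E -poweRrM mulVf// poweRe1// energy_ge0. Qed.

Lemma measurable_cmodulus f : cmeasurable f -> measurable_fun setT (fun x => cmodulus (f x)).
Proof.
move=> [mr mi]; rewrite (_ : (fun x => _) =
  (fun x => (Re (f x) ^+ 2 + Im (f x) ^+ 2) `^ 2^-1)); last first.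
  apply/funext => x; rewrite -sqr_cmodulus powR12_sqrt ?sqr_ge0//.
  by rewrite sqrtr_sqr ger0_norm// cmodulus_ge0.
apply: (measurableT_comp (measurable_powR 2^-1)).
by apply: measurable_funD; exact: measurable_funX.
Qed.

Lemma energy_ReIm f : cmeasurable f ->
  (energy f = sqint mu (fun x => Re (f x)) + sqint mu (fun x => Im (f x)))%E.
Proof.
move=> [mr mi]; rewrite /energy; under eq_integral do rewrite sqr_cmodulus EFinD.
rewrite ge0_integralD//.
- by move=> x _; rewrite lee_fin sqr_ge0.
- exact/measurable_EFinP/measurable_funX.
- by move=> x _; rewrite lee_fin sqr_ge0.
- exact/measurable_EFinP/measurable_funX.
Qed.

Lemma cLp2P f : cLp mu 2%:E f <-> cmeasurable f /\ (energy f < +oo)%E.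
Proof.
split=> -[mf fin]; split => //.
- by rewrite energyE; exact: poweR_lty.
- by rewrite cLnorm2E; exact: poweR_lty.
Qed.

Lemma cLnorm2_cvg0P (F : nat -> T -> R[i]) :
  ((fun k => cLnorm mu 2%:E (F k)) @ \oo --> 0%E) <->
  ((fun k => energy (F k)) @ \oo --> 0%E).
Proof.
have N0 k : (0 <= cLnorm mu 2%:E (F k))%E by exact: Lnorm_ge0.
split=> h; apply/cvge0P.
- by move=> k; exact: energy_ge0.
- move=> e e0; move/cvge0P : h => /(_ N0 (Num.sqrt e)); rewrite sqrtr_gt0 => /(_ e0) h.
  near=> k; have hk : (cLnorm mu 2%:E (F k) <= (Num.sqrt e)%:E)%E by near: k.
  rewrite energyE (le_trans (gt0_ler_poweR _ _ _ hk))//.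
  + by rewrite in_itv/= N0 leey.
  + by rewrite in_itv/= lee_fin sqrtr_ge0 leey.
  + by rewrite poweR_EFin powR_mulrn ?sqrtr_ge0// sqr_sqrtr// ltW.
- exact: N0.
- move=> e e0; move/cvge0P : h => /(_ (fun k => energy_ge0 _) (e ^+ 2)); rewrite exprn_gt0// => /(_ isT) h.
  near=> k; have hk : (energy (F k) <= (e ^+ 2)%:E)%E by near: k.
  rewrite cLnorm2E (le_trans (gt0_ler_poweR _ _ _ hk))//.
  + by rewrite in_itv/= energy_ge0 leey.
  + by rewrite in_itv/= lee_fin sqr_ge0 leey.
  + by rewrite -(powR_mulrn 2 (ltW e0)) poweR_EFin -powRrM mulfV// (powRr1 (ltW e0)).
Unshelve. all: by end_near. Qed.

End complex_energy.

Arguments energy {d T R} mu f%_ring_scope.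

(** * Completeness of L2 *)

Section riesz_fischer.
Context d (T : measurableType d) (R : realType).
Variable mu : {measure set T -> \bar R}.
Variables (a : nat -> T -> R) (C : R).
Hypothesis ma : forall k, measurable_fun setT (a k).
Hypothesis aC : forall k j, (k <= j)%N ->
  (sqint mu (fun x => (a k x - a j x)%R) <= (C * 8^-1 ^+ k)%:E)%E.

Let D k (x : T) : R := a k.+1 x - a k x.

Let mD k : measurable_fun setT (D k). Proof. exact: measurable_funB. Qed.

(** The factor [4 ^ k] still leaves a summable series of integrals, and turns a
    finite value of the sum into a geometric bound on the increments. *)
Let w k (x : T) : \bar R := (4 ^+ k * D k x ^+ 2)%:E.

Let w0 k x : (0 <= w k x)%E.
Proof. by rewrite lee_fin mulr_ge0 ?sqr_ge0// exprn_ge0. Qed.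

Let mw k : measurable_fun setT (w k).
Proof. by apply/measurable_EFinP/measurable_funM => //; exact: measurable_funX. Qed.

Let S (x : T) : \bar R := (\sum_(k <oo) w k x)%E.

Let S_ge x k : (w k x <= S x)%E.
Proof.
apply: le_trans (nneseries_lim_ge k.+1 (fun n _ _ => w0 n x)).
by rewrite big_nat_recr//= leeDr// sume_ge0.
Qed.

Let integral_S : (\int[mu]_x S x < +oo)%E.
Proof.
rewrite integral_nneseries//.
apply: (@le_lt_trans _ _ (\sum_(k <oo) ((2 * C) / (2 ^ (k + 1))%:R)%:E)%E).
  apply: lee_nneseries => [k _ _|k _]; first exact: integral_ge0.
  rewrite /w; under eq_integral do rewrite EFinM.
  rewrite ge0_integralZl//; last 2 first.
  - exact/measurable_EFinP/measurable_funX.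
  - by move=> x _; rewrite lee_fin sqr_ge0.
  have h : (\int[mu]_x (D k x ^+ 2)%:E <= (C * 8^-1 ^+ k)%:E)%E.
    apply: le_trans (aC (leqnSn k)); rewrite le_eqVlt; apply/orP; left; apply/eqP.
    by apply: eq_integral => x _; rewrite -sqrrN opprB.
  apply: (le_trans (lee_wpmul2l _ h)); first by rewrite lee_fin exprn_ge0.
  rewrite -EFinM lee_fin le_eqVlt; apply/orP; left; apply/eqP.
  rewrite mulrCA -exprMn addn1 natrX exprSr invfM mulrA mulrAC -exprVn.
  rewrite (_ : 4 * 8^-1 = 2^-1 :> R); last by field.
  by field.
have := @cvg_geometric_eseries_half R (2 * C) 0.
move=> /cvg_lim h; rewrite h//; exact: ltry.
Qed.

Let mS : measurable_fun setT S.
Proof. by apply: ge0_emeasurable_sum => // k x _ _; exact: w0. Qed.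

Let iS : mu.-integrable setT S.
Proof.
apply/integrableP; split => //; apply: le_lt_trans integral_S.
rewrite le_eqVlt; apply/orP; left; apply/eqP; apply: eq_integral => x _.
by rewrite gee0_abs//; exact: nneseries_ge0.
Qed.

(** Where the weighted series [S] converges, increments are [O(2^-k)]. *)
Let cvg_a x : (S x < +oo)%E -> cvgn (fun k => a k x).
Proof.
move=> Sx; have S0 : (0 <= S x)%E by exact: nneseries_ge0.
have [s Ss] : exists s, S x = s%:E.
  by exists (fine (S x)); rewrite fineK// ge0_fin_numE.
have s0 : 0 <= s by rewrite -lee_fin -Ss.
have Dle k : `|D k x| <= Num.sqrt s * 2^-1 ^+ k.
  have := S_ge x k; rewrite Ss lee_fin => h.
  rewrite -ler_sqr ?nnegrE ?mulr_ge0 ?sqrtr_ge0 ?exprn_ge0//.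
  rewrite exprMn sqr_sqrtr// real_normK ?num_real// -exprM mulnC exprM expr2.
  rewrite -[X in _ <= s * X ^+ k](_ : 4^-1 = _); last by field.
  by rewrite exprVn ler_pdivlMr ?exprn_gt0// mulrC.
have cs : cvgn (series (fun k => D k x)).
  apply: (@normed_cvg R R^o); apply: (@series_le_cvg _ _ (geometric (Num.sqrt s) 2^-1)) => //.
  - by move=> k; exact: normr_ge0.
  - by move=> k; apply: mulr_ge0; rewrite ?sqrtr_ge0// exprn_ge0.
  - by apply: is_cvg_geometric_series; rewrite ger0_norm// invf_lt1// ltr1n.
rewrite (_ : (fun k => _) = (fun k => a 0%N x + series (fun k => D k x) k)); last first.
  by apply/funext => k; rewrite (eq_sum_telescope (fun k => a k x)).
by apply: is_cvgD => //; exact: is_cvg_cst.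
Qed.

(** Setting the sequence to 0 on the null set where [S] is infinite makes it
    converge everywhere, so that its limit is measurable. *)
Let b k (x : T) : R := if (S x < +oo)%E then a k x else 0.

Let mA : measurable [set x | (S x < +oo)%E].
Proof. by rewrite -[X in measurable X]setTI; apply: emeasurable_fun_infty_o. Qed.

Let mb k : measurable_fun setT (b k).
Proof.
rewrite (_ : b k = fun x => \1_[set x | (S x < +oo)%E] x * a k x).
  by apply: measurable_funM => //; exact: measurable_indic.
apply/funext => x; rewrite /b indicE; case: ifPn => h.
  by rewrite mem_set ?mul1r.
by rewrite memNset ?mul0r//; exact/negP.
Qed.

Let cvg_b x : cvgn (fun k => b k x).
Proof.
rewrite /b; case: (boolP (S x < +oo)%E) => h; first exact: cvg_a.
exact: is_cvg_cst.
Qed.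

(** Almost everywhere convergence gives the limit, and Fatou's lemma hands the
    Cauchy rate over to it. *)
Lemma riesz_fischer : exists l : T -> R, measurable_fun setT l /\
  forall k, (sqint mu (fun x => (a k x - l x)%R) <= (C * 8^-1 ^+ k)%:E)%E.
Proof.
pose l x := limn (fun k => b k x).
have bl x : (fun k => b k x) @ \oo --> l x by exact: cvg_b.
have ml : measurable_fun setT l.
  apply/measurable_EFinP; apply: (emeasurable_fun_cvg (fun k => EFin \o b k)).
  - by move=> k; exact/measurable_EFinP.
  - by move=> x _; apply: cvg_EFin; [exact: nearW|exact: bl].
exists l; split => // k.
have fatou_k := @fatou _ _ _ mu setT measurableT
  (fun j x => ((a k x - a (k + j)%N x) ^+ 2)%:E).
apply: (@le_trans _ _ (\int[mu]_x limn_einf (fun j => ((a k x - a (k + j)%N x) ^+ 2)%:E))%E).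
  rewrite le_eqVlt; apply/orP; left; apply/eqP.
  apply: ge0_ae_eq_integral => //.
  - exact/measurable_EFinP/measurable_funX/measurable_funB.
  - have mi n : measurable_fun setT
        (fun x => einfs (fun j => ((a k x - a (k + j)%N x) ^+ 2)%:E) n).
      apply: measurable_fun_einfs => j.
      exact/measurable_EFinP/measurable_funX/measurable_funB.
    have := @emeasurable_fun_cvg _ _ _ setT
      (fun n x => einfs (fun j => ((a k x - a (k + j)%N x) ^+ 2)%:E) n)
      (fun x => limn_einf (fun j => ((a k x - a (k + j)%N x) ^+ 2)%:E)) mi.
    apply => x _.
    by rewrite limn_einf_lim; exact: is_cvg_einfs.
  - by move=> x _; rewrite lee_fin sqr_ge0.
  - move=> x _; rewrite limn_einf_lim; apply: lime_ge; first exact: is_cvg_einfs.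
    apply: nearW => n; apply: le_ereal_inf_tmp => _ [m /= _ <-].
    by rewrite lee_fin sqr_ge0.
  - apply: filterS (integrable_ae measurableT iS) => x Sx _.
    have {}Sx : (S x < +oo)%E by have := Sx Logic.I; rewrite ge0_fin_numE//; exact: nneseries_ge0.
    have al : (fun j => a j x) @ \oo --> l x.
      by have := bl x; rewrite /b Sx.
    have al' : (fun j => ((a k x - a (k + j)%N x) ^+ 2)%:E) @ \oo --> ((a k x - l x) ^+ 2)%:E.
      apply: cvg_EFin; first exact: nearW.
      have h : (fun j => a k x - a (k + j)%N x) @ \oo --> a k x - l x.
        apply: cvgB; first exact: cvg_cst.
        move: al; rewrite -(cvg_shiftn k (fun j => a j x)).
        by rewrite (_ : [sequence _]_n = (fun j => a (k + j)%N x))//;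
          apply/funext => j /=; rewrite addnC.
      by under eq_fun do rewrite expr2; rewrite expr2; exact: cvgM.
    by have [-> _] := cvg_limn_einf_sup al'.
apply: (le_trans (fatou_k _ _)).
- move=> j; exact/measurable_EFinP/measurable_funX/measurable_funB.
- by move=> j x _; rewrite lee_fin sqr_ge0.
- rewrite limn_einf_lim; apply: lime_le; first exact: is_cvg_einfs.
  apply: nearW => n; apply: le_trans (aC (leq_addr n k)).
  by apply: ereal_inf_lbound; exists n => /=.
Qed.

End riesz_fischer.

(** * Truncation of complex functions *)

Section complex_functions.
Context d (T : measurableType d) (R : realType).
Variable mu : {measure set T -> \bar R}.
Implicit Types f g : T -> R[i].
Local Notation Re := complex.Re.
Local Notation Im := complex.Im.

Lemma cmeasurableB f g : cmeasurable f -> cmeasurable g -> cmeasurable (f \- g).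
Proof.
move=> [fr fi] [gr gi]; split.
- rewrite (_ : (fun x => _) = (fun x => Re (f x) - Re (g x))); first exact: measurable_funB.
  by apply/funext => x /=; case: (f x) => a b; case: (g x).
- rewrite (_ : (fun x => _) = (fun x => Im (f x) - Im (g x))); first exact: measurable_funB.
  by apply/funext => x /=; case: (f x) => a b; case: (g x).
Qed.

Lemma sqr_cmodulusB_le (z w : R[i]) :
  cmodulus (z - w) ^+ 2 <= 2 * cmodulus z ^+ 2 + 2 * cmodulus w ^+ 2.
Proof.
case: z => a b; case: w => p q; rewrite !sqr_cmodulus/=.
by have := sqrB_le2 a p; have := sqrB_le2 b q; lra.
Qed.

Lemma energyB_le f g : cmeasurable f -> cmeasurable g ->
  (energy mu (f \- g) <= 2%:E * energy mu f + 2%:E * energy mu g)%E.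
Proof.
move=> mf mg; apply: ge0_integral_le_comb => //.
- by apply: measurable_funX; apply: measurable_cmodulus; exact: cmeasurableB.
- by apply: measurable_funX; exact: measurable_cmodulus.
- by apply: measurable_funX; exact: measurable_cmodulus.
- by move=> x; exact: sqr_ge0.
- by move=> x; exact: sqr_ge0.
- by move=> x; exact: sqr_ge0.
- by move=> x; exact: sqr_cmodulusB_le.
Qed.

Lemma energyBC f g : energy mu (f \- g) = energy mu (g \- f).
Proof.
apply: eq_integral => x _; congr (_%:E) => /=.
case: (f x) => a b; case: (g x) => p q; rewrite !sqr_cmodulus/=.
by ring.
Qed.

(** The parallelogram bound replaces the triangle inequality throughout; the
    constants it costs are harmless. *)
Lemma energyB_triangle f g h : cmeasurable f -> cmeasurable g -> cmeasurable h ->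
  (energy mu (f \- h) <= 2%:E * energy mu (f \- g) + 2%:E * energy mu (h \- g))%E.
Proof.
move=> mf mg mh; rewrite (_ : f \- h = (f \- g) \- (h \- g)).
  by apply: energyB_le; exact: cmeasurableB.
by apply/funext => x /=; ring.
Qed.

Lemma energy_le_shift f g : cmeasurable f -> cmeasurable g ->
  (energy mu f <= 2%:E * energy mu g + 2%:E * energy mu (g \- f))%E.
Proof.
move=> mf mg; rewrite [X in (energy _ X <= _)%E](_ : f = g \- (g \- f)).
  by apply: energyB_le => //; exact: cmeasurableB.
by apply/funext => x /=; ring.
Qed.

Lemma normr_Re_le (z : R[i]) : `|Re z| <= cmodulus z.
Proof.
rewrite -ler_sqr ?nnegrE ?cmodulus_ge0// sqr_cmodulus real_normK ?num_real//.
by rewrite lerDl sqr_ge0.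
Qed.

Lemma normr_Im_le (z : R[i]) : `|Im z| <= cmodulus z.
Proof.
rewrite -ler_sqr ?nnegrE ?cmodulus_ge0// sqr_cmodulus real_normK ?num_real//.
by rewrite lerDr sqr_ge0.
Qed.

Lemma cLnorm1E f : cLnorm mu 1 f = (\int[mu]_x (cmodulus (f x))%:E)%E.
Proof.
rewrite /cLnorm Lnorm1; apply: eq_integral => x _.
by rewrite abse_EFin ger0_norm// cmodulus_ge0.
Qed.

Lemma cLp1P f : cLp mu 1 f <->
  cmeasurable f /\ (\int[mu]_x (cmodulus (f x))%:E < +oo)%E.
Proof. by rewrite -cLnorm1E. Qed.

Lemma cLp1_integrable f : cLp mu 1 f ->
  mu.-integrable setT (EFin \o (fun x => Re (f x))) /\
  mu.-integrable setT (EFin \o (fun x => Im (f x))).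
Proof.
move=> /cLp1P[mf fin]; have mm := measurable_cmodulus mf.
have im : mu.-integrable setT (EFin \o (fun x => cmodulus (f x))).
  apply/integrableP; split; first exact/measurable_EFinP.
  by under eq_integral do rewrite /= ger0_norm ?cmodulus_ge0//.
have [mr mi] := mf.
split; apply: le_integrable im => //; [exact/measurable_EFinP| |exact/measurable_EFinP|];
  move=> x _; rewrite /= lee_fin [leRHS]ger0_norm ?cmodulus_ge0//.
- exact: normr_Re_le.
- exact: normr_Im_le.
Qed.

Definition cut (B : set T) f (x : T) : R[i] := if x \in B then f x else 0.

Lemma cut_ReIm B f x : Re (cut B f x) = \1_B x * Re (f x) /\
  Im (cut B f x) = \1_B x * Im (f x).
Proof. by rewrite /cut indicE; case: ifPn => _ /=; rewrite ?mul1r ?mul0r. Qed.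

Lemma cmeasurable_cut B f : measurable B -> cmeasurable f -> cmeasurable (cut B f).
Proof.
move=> mB [mr mi]; have mI : measurable_fun setT (\1_B : T -> R) by exact: measurable_indic.
split.
- by under eq_fun do rewrite (cut_ReIm _ _ _).1; exact: measurable_funM.
- by under eq_fun do rewrite (cut_ReIm _ _ _).2; exact: measurable_funM.
Qed.

Lemma cmodulus_cut B f x : cmodulus (cut B f x) = \1_B x * cmodulus (f x).
Proof.
rewrite /cut indicE; case: ifPn => _; first by rewrite mul1r.
by rewrite mul0r /cmodulus /= expr0n/= addr0 sqrtr0.
Qed.

Lemma cut_cLp2 B f : measurable B -> cLp mu 2%:E f -> cLp mu 2%:E (cut B f).
Proof.
move=> mB /cLp2P[mf fin]; apply/cLp2P; split; first exact: cmeasurable_cut.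
apply: le_lt_trans fin; apply: ge0_le_integral_EFin.
- by apply/measurable_funX/measurable_cmodulus; exact: cmeasurable_cut.
- exact/measurable_funX/measurable_cmodulus.
- move=> x; rewrite sqr_ge0/= cmodulus_cut exprMn ler_piMl ?sqr_ge0//.
Qed.

Lemma cut_cLp1 B f : measurable B -> (mu B < +oo)%E -> cLp mu 2%:E f ->
  cLp mu 1 (cut B f).
Proof.
move=> mB Bfin /cLp2P[mf fin]; apply/cLp1P; split; first exact: cmeasurable_cut.
have mI : measurable_fun setT (\1_B : T -> R) by exact: measurable_indic.
apply: (@le_lt_trans _ _ (1%:E * \int[mu]_x (\1_B x)%:E + 1%:E * energy mu f)%E).
  apply: ge0_integral_le_comb => //.
  - by apply/measurable_cmodulus; exact: cmeasurable_cut.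
  - exact/measurable_funX/measurable_cmodulus.
  - by move=> x; exact: cmodulus_ge0.
  - by move=> x; exact: sqr_ge0.
  - move=> x; rewrite cmodulus_cut !mul1r indicE; case: (x \in B).
      rewrite mulr1n mul1r; have := sqr_ge0 (cmodulus (f x) - 2^-1).
      by rewrite sqrrB => h; lra.
    by rewrite mulr0n mul0r add0r sqr_ge0.
by rewrite !mul1e integral_indic// setIT lte_add_pinfty.
Qed.

Lemma energy_cut B f : measurable B -> cmeasurable f ->
  energy mu (cut B f \- f) = (\int[mu]_(x in ~` B) (cmodulus (f x) ^+ 2)%:E)%E.
Proof.
move=> mB mf; rewrite [RHS]integral_mkcond; apply: eq_integral => x _.
rewrite /patch in_setC /=; have [xB|xB] := boolP (x \in B); rewrite /= /cut.
  by rewrite xB subrr /cmodulus /= expr0n/= addr0 sqrtr0 expr0n.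
rewrite (negbTE xB) sub0r; congr (_%:E); case: (f x) => a b.
by rewrite !sqr_cmodulus/= !sqrrN.
Qed.

Lemma tail_cvg0 (B : nat -> set T) (g : T -> \bar R) :
    (forall m, measurable (B m)) -> (forall x, \forall m \near \oo, B m x) ->
    measurable_fun setT g -> (forall x, (0 <= g x)%E) -> (\int[mu]_x g x < +oo)%E ->
  (fun m => \int[mu]_(x in ~` B m) g x)%E @ \oo --> 0%E.
Proof.
move=> mB BT mg g0 gfin.
under eq_fun do rewrite integral_mkcond.
have gp m x : (g \_ (~` B m)) x = if x \in ~` B m then g x else 0%E by [].
apply: (@ge0_dominated_cvg0_ereal _ _ _ _ _ g).
- by move=> m; apply/(measurable_restrictT g (measurableC (mB m))); exact: measurable_funTS.
- apply/integrableP; split => //.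
  by under eq_integral do rewrite gee0_abs//.
- by move=> m x; rewrite gp; case: ifP => _; rewrite ?lexx ?g0.
- move=> x _; apply: cvg_near_cst; near=> m.
  have Bx : B m x by near: m; exact: BT.
  by rewrite gp in_setC mem_set.
Unshelve. all: by end_near.
Qed.

End complex_functions.

(** * The Fourier transform on L2 *)

Section fourier_transform.
Context {R : realType}.
Variable d : nat.
Notation E := (euclid R d).
Notation mu := (lebesgue_tuple R d).
Implicit Types f g h p : E -> R[i].
Local Notation Re := complex.Re.
Local Notation Im := complex.Im.

Definition cube (m : nat) : set E := [set t | forall i, `[- m%:R, m%:R]%classic (tnth t i)].

Lemma measurable_cube m : measurable (cube m).
Proof.
rewrite (_ : cube m =
    \bigcap_(i in [set: 'I_d]) ((@tnth d (measurableTypeR R))^~ i @^-1` `[- m%:R, m%:R]%classic)).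
  apply: fin_bigcap_measurable => // i _.
  by rewrite -[X in measurable X]setTI; exact: measurable_tnth.
by apply/seteqP; split=> t /= At i => [_|]; exact: At.
Qed.

Lemma cube_lty m : (mu (cube m) < +oo)%E.
Proof.
pose I : set (measurableTypeR R) := `[- m%:R, m%:R]%classic.
have mI : measurable I by exact: measurable_itv.
have I_fin : lebesgue_measure I \is a fin_num.
  by rewrite lebesgue_measure_itv; case: ifP.
rewrite /cube (@lebesgue_tuple_box R d (fun=> I))//.
suff h : (\prod_(i < d) lebesgue_measure I)%E \is a fin_num by rewrite ltey_eq h.
by elim/big_ind : _ => // x y; exact: fin_numM.
Qed.

Lemma cube_absorbs (t : E) : \forall m \near \oo, cube m t.
Proof.
near=> m; move=> i /=; rewrite in_itv/= -ler_norml.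
apply: (@le_trans _ _ (\sum_(j < d) `|tnth t j|)).
  by rewrite (bigD1 i)//= lerDl sumr_ge0.
by near: m; exact: nbhs_infty_ger.
Unshelve. all: by end_near. Qed.

Lemma fourier1E f w : fourier1 f w =
  Complex (ft (fun x => Re (f x)) (fun x => Im (f x)) w)
          (ft (fun x => Im (f x)) (fun x => - Re (f x)) w).
Proof.
rewrite /fourier1 /cintegral /ft; congr Complex; apply: eq_Rintegral => x _;
  rewrite /oscillatory /angle /cexpi; case: (f x) => a b /=; rewrite cosN sinN; ring.
Qed.

Lemma fourier1_measurable f : cLp mu 1 f -> cmeasurable (fourier1 f).
Proof.
move=> /cLp1_integrable[ir ii]; split; under eq_fun do rewrite fourier1E/=.
- exact: measurable_ft.
- by apply: measurable_ft => //; exact: (integrableN ir).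
Qed.

Lemma plancherel_complex f : cLp mu 1 f -> cLp mu 2%:E f ->
  energy mu (fourier1 f) = energy mu f.
Proof.
move=> f1 f2; have [ir ii] := cLp1_integrable f1; move/cLp2P : f2 => [mf fin].
rewrite energy_ReIm; last exact: fourier1_measurable.
have fE := energy_ReIm mu mf; rewrite fE in fin *.
have fr : (sqint mu (fun x => Re (f x)) < +oo)%E.
  by apply: le_lt_trans fin; rewrite leeDl ?sqint_ge0.
have fi : (sqint mu (fun x => Im (f x)) < +oo)%E.
  by apply: le_lt_trans fin; rewrite leeDr ?sqint_ge0.
rewrite -(plancherel ir ii fr fi).
have -> : (fun w => Re (fourier1 f w)) = ft (fun x => Re (f x)) (fun x => Im (f x)).
  by apply/funext => w; rewrite fourier1E.
have -> // : (fun w => Im (fourier1 f w)) = ft (fun x => Im (f x)) (fun x => - Re (f x)).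
by apply/funext => w; rewrite fourier1E.
Qed.

Lemma cLp1B f g : cLp mu 1 f -> cLp mu 1 g -> cLp mu 1 (f \- g).
Proof.
move=> /cLp1P[mf ff] /cLp1P[mg fg]; apply/cLp1P; split; first exact: cmeasurableB.
apply: (@le_lt_trans _ _ (1%:E * \int[mu]_x (cmodulus (f x))%:E +
                          1%:E * \int[mu]_x (cmodulus (g x))%:E)%E).
  apply: ge0_integral_le_comb => //.
  - by apply: measurable_cmodulus; exact: cmeasurableB.
  - exact: measurable_cmodulus.
  - exact: measurable_cmodulus.
  - by move=> x; exact: cmodulus_ge0.
  - by move=> x; exact: cmodulus_ge0.
  - by move=> x; exact: cmodulus_ge0.
  - move=> x; rewrite !mul1r /cmodulus (le_trans (le_normcD (f x) (- g x)))//.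
    by rewrite normcN.
by rewrite !mul1e lte_add_pinfty.
Qed.

Lemma cLp2B f g : cLp mu 2%:E f -> cLp mu 2%:E g -> cLp mu 2%:E (f \- g).
Proof.
move=> /cLp2P[mf ff] /cLp2P[mg fg]; apply/cLp2P; split; first exact: cmeasurableB.
apply: le_lt_trans (energyB_le mu mf mg) _.
by rewrite lte_add_pinfty// lte_mul_pinfty.
Qed.

Let ftB a b a' b' w :
  mu.-integrable setT (EFin \o a) -> mu.-integrable setT (EFin \o b) ->
  mu.-integrable setT (EFin \o a') -> mu.-integrable setT (EFin \o b') ->
  ft (fun x => a x - a' x) (fun x => b x - b' x) w = ft a b w - ft a' b' w.
Proof.
move=> ia ib ia' ib'; rewrite /ft -RintegralB//; [|exact: integrable_oscillatory..].
by apply: eq_Rintegral => x _; rewrite /oscillatory; ring.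
Qed.

Lemma fourier1B f g : cLp mu 1 f -> cLp mu 1 g ->
  fourier1 (f \- g) = fourier1 f \- fourier1 g.
Proof.
move=> /cLp1_integrable[fr fi] /cLp1_integrable[gr gi].
have [fr' gr'] := (integrableN fr, integrableN gr).
apply/funext => w /=; rewrite !fourier1E; apply/eqP; rewrite eq_complex/=; apply/andP; split.
- rewrite -ftB//; apply/eqP; congr (ft _ _ w); apply/funext => x;
    by case: (f x) => a b; case: (g x).
- rewrite -ftB//; apply/eqP; congr (ft _ _ w); apply/funext => x;
    by case: (f x) => a b; case: (g x) => p q //=; ring.
Qed.

Lemma energy_fourier1B f g : cLp mu 1 f -> cLp mu 1 g ->
    cLp mu 2%:E f -> cLp mu 2%:E g ->
  energy mu (fourier1 f \- fourier1 g) = energy mu (f \- g).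
Proof.
move=> f1 g1 f2 g2; rewrite -fourier1B// plancherel_complex//.
- exact: cLp1B.
- exact: cLp2B.
Qed.

(** Truncations to cubes, chosen to converge to [f] geometrically fast, have
    Fourier integrals that converge by Plancherel and completeness. *)
Lemma fourier2_exists f : cLp mu 2%:E f -> exists h, is_fourier2 f h.
Proof.
move=> f2; have [mf ff] := (cLp2P mu f).1 f2.
have tails : (fun m => energy mu (cut (cube m) f \- f)) @ \oo --> 0%E.
  under eq_fun do rewrite (energy_cut mu (measurable_cube _) mf).
  apply: (tail_cvg0 measurable_cube cube_absorbs _ _ ff).
  - by apply/measurable_EFinP/measurable_funX; exact: measurable_cmodulus.
  - by move=> x; rewrite lee_fin sqr_ge0.
have /choice[m mP] : forall k, exists m,
    (energy mu (cut (cube m) f \- f) <= (8^-1 ^+ k)%:E)%E.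
  move=> k; move/cvge0P : tails => /(_ (fun=> energy_ge0 _ _) (8^-1 ^+ k)).
  rewrite exprn_gt0// => /(_ isT)[N _ /(_ N (leqnn N))/= h].
  by exists N.
pose u k := cut (cube (m k)) f.
have u1 k : cLp mu 1 (u k) by apply: cut_cLp1 => //; [exact: measurable_cube|exact: cube_lty].
have u2 k : cLp mu 2%:E (u k) by apply: cut_cLp2 => //; exact: measurable_cube.
have mu_ k : cmeasurable (u k) by have /cLp1P[] := u1 k.
have mv k : cmeasurable (fourier1 (u k)) by exact: fourier1_measurable.
have vE k j : (k <= j)%N ->
    (energy mu (fourier1 (u k) \- fourier1 (u j)) <= (4 * 8^-1 ^+ k)%:E)%E.
  move=> kj; rewrite energy_fourier1B//.
  apply: (le_trans (energyB_triangle mu (mu_ k) mf (mu_ j))).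
  apply: (@le_trans _ _ (2%:E * (8^-1 ^+ k)%:E + 2%:E * (8^-1 ^+ j)%:E)%E).
    by apply: leeD; apply: lee_wpmul2l => //; exact: mP.
  rewrite -!EFinM -EFinD lee_fin.
  have : 8^-1 ^+ j <= 8^-1 ^+ k :> R by rewrite ler_wiXn2l// invf_le1// ler1n.
  by lra.
have vRI k j : (energy mu (fourier1 (u k) \- fourier1 (u j)) =
    sqint mu (fun w => (Re (fourier1 (u k) w) - Re (fourier1 (u j) w))%R) +
    sqint mu (fun w => (Im (fourier1 (u k) w) - Im (fourier1 (u j) w))%R))%E.
  rewrite energy_ReIm; last exact: cmeasurableB.
  by congr (sqint _ _ + sqint _ _)%E; apply/funext => w /=;
    case: (fourier1 (u k) w) => a b; case: (fourier1 (u j) w).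
have [l [ml lP]] : exists l : E -> R, measurable_fun setT l /\ forall k,
    (sqint mu (fun w => (Re (fourier1 (u k) w) - l w)%R) <= (4 * 8^-1 ^+ k)%:E)%E.
  apply: (@riesz_fischer _ _ _ mu (fun k w => Re (fourier1 (u k) w))).
    by move=> k; case: (mv k).
  by move=> k j kj; apply: le_trans (vE k j kj); rewrite vRI leeDl ?sqint_ge0.
have [l' [ml' lP']] : exists l : E -> R, measurable_fun setT l /\ forall k,
    (sqint mu (fun w => (Im (fourier1 (u k) w) - l w)%R) <= (4 * 8^-1 ^+ k)%:E)%E.
  apply: (@riesz_fischer _ _ _ mu (fun k w => Im (fourier1 (u k) w))).
    by move=> k; case: (mv k).
  by move=> k j kj; apply: le_trans (vE k j kj); rewrite vRI leeDr ?sqint_ge0.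
pose h w : R[i] := Complex (l w) (l' w).
have mh : cmeasurable h by [].
have vh k : (energy mu (fourier1 (u k) \- h) <= (8 * 8^-1 ^+ k)%:E)%E.
  rewrite energy_ReIm; last exact: cmeasurableB.
  have -> : 8 * 8^-1 ^+ k = 4 * 8^-1 ^+ k + 4 * 8^-1 ^+ k :> R by lra.
  rewrite EFinD leeD//.
  - rewrite (_ : (fun x => _) = (fun w => Re (fourier1 (u k) w) - l w)); first exact: lP.
    by apply/funext => w; rewrite /h /=; case: (fourier1 (u k) w).
  - rewrite (_ : (fun x => _) = (fun w => Im (fourier1 (u k) w) - l' w)); first exact: lP'.
    by apply/funext => w; rewrite /h /=; case: (fourier1 (u k) w).
have c8 : (fun k => (8^-1 ^+ k)%:E) @ \oo --> (0%E : \bar R).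
  apply: cvg_EFin; first exact: nearW.
  have := @cvg_geometric R 1 8^-1; rewrite /geometric/=; under eq_fun do rewrite mul1r.
  by apply; rewrite ger0_norm// invf_lt1// ltr1n.
exists h; split => //.
- apply/cLp2P; split => //; apply: le_lt_trans (energy_le_shift mu mh (mv 0%N)) _.
  rewrite lte_add_pinfty// lte_mul_pinfty//.
    by rewrite plancherel_complex//; have /cLp2P[] := u2 0%N.
  by apply: le_lt_trans (vh 0%N) _; exact: ltry.
- exists u; split => //.
  + apply/cLnorm2_cvg0P; apply: squeeze_cvge0 c8 => k.
    by rewrite energy_ge0 mP.
  + apply/cLnorm2_cvg0P; apply: (@squeeze_cvge0 _ _ (fun k => 8%:E * (8^-1 ^+ k)%:E)%E).
      by move=> k; rewrite energy_ge0 -EFinM vh.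
    by rewrite -(mule0 8%:E); apply: cvgeZl.
Qed.

Section limits.
Variables f h : E -> R[i].
Hypothesis fh : is_fourier2 f h.

Let mf : cmeasurable f. Proof. by case: fh => /cLp2P[]. Qed.
Let mh : cmeasurable h. Proof. by case: fh => _ /cLp2P[]. Qed.

(** The closure in the definition of the transform, at a single precision. *)
Let approx e : 0 < e -> exists u, [/\ cLp mu 1 u, cLp mu 2%:E u,
  (energy mu (u \- f) <= e%:E)%E & (energy mu (fourier1 u \- h) <= e%:E)%E].
Proof.
move=> e0; have [_ _ [u [u12 /cLnorm2_cvg0P uf /cLnorm2_cvg0P uh]]] := fh.
move/cvge0P : uf => /(_ (fun=> energy_ge0 _ _) _ e0) uf.
move/cvge0P : uh => /(_ (fun=> energy_ge0 _ _) _ e0) uh.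
have [N _ /(_ N (leqnn N))/= [a b]] : \forall k \near \oo,
    (energy mu (u k \- f) <= e%:E)%E /\ (energy mu (fourier1 (u k) \- h) <= e%:E)%E.
  by near=> k; split; near: k.
by exists (u N); have [] := u12 N.
Unshelve. all: by end_near. Qed.

Lemma fourier2_energy_ge : (energy mu f <= 4%:E * energy mu h)%E.
Proof.
apply/lee_addgt0Pr => e e0.
have [u [u1 u2 uf uh]] := approx (divr_gt0 e0 (ltr0Sn R 5)).
have mu_ : cmeasurable u by have /cLp1P[] := u1.
have mv := fourier1_measurable u1.
apply: (le_trans (energy_le_shift mu mf mu_)).
have h1 : (energy mu u <= 2%:E * energy mu h + 2%:E * (e / 6)%:E)%E.
  rewrite -(plancherel_complex u1 u2) (le_trans (energy_le_shift mu mv mh))//.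
  by apply: leeD => //; rewrite energyBC; exact: lee_wpmul2l.
apply: (@le_trans _ _ (2%:E * (2%:E * energy mu h + 2%:E * (e / 6)%:E) + 2%:E * (e / 6)%:E)%E).
  by apply: leeD; apply: lee_wpmul2l.
have e60 : (0 <= 2%:E * (e / 6)%:E)%E by rewrite -EFinM lee_fin mulr_ge0// divr_ge0// ltW.
rewrite (ge0_muleDr _ _ e60); last by rewrite mule_ge0 ?energy_ge0.
rewrite -addeA muleA -!EFinM -EFinD (_ : 2 * 2 = 4 :> R); last by ring.
by rewrite (_ : 2 * (2 * (e / 6)) + 2 * (e / 6) = e)//; field.
Qed.

Lemma fourier2_energyB_le p : cLp mu 1 p -> cLp mu 2%:E p ->
  (energy mu (fourier1 p \- h) <= 4%:E * energy mu (p \- f))%E.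
Proof.
move=> p1 p2; apply/lee_addgt0Pr => e e0.
have [u [u1 u2 uf uh]] := approx (divr_gt0 e0 (ltr0Sn R 5)).
have mu_ : cmeasurable u by have /cLp1P[] := u1.
have mp : cmeasurable p by have /cLp1P[] := p1.
have mv := fourier1_measurable u1; have mq := fourier1_measurable p1.
apply: (le_trans (energyB_triangle mu mq mv mh)).
have h1 : (energy mu (fourier1 p \- fourier1 u) <=
    2%:E * energy mu (p \- f) + 2%:E * (e / 6)%:E)%E.
  rewrite energy_fourier1B// (le_trans (energyB_triangle mu mp mf mu_))//.
  by apply: leeD => //; exact: lee_wpmul2l.
have h2 : (energy mu (h \- fourier1 u) <= (e / 6)%:E)%E by rewrite energyBC.
apply: (@le_trans _ _ (2%:E * (2%:E * energy mu (p \- f) + 2%:E * (e / 6)%:E) + 2%:E * (e / 6)%:E)%E).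
  by apply: leeD; apply: lee_wpmul2l.
have e60 : (0 <= 2%:E * (e / 6)%:E)%E by rewrite -EFinM lee_fin mulr_ge0// divr_ge0// ltW.
rewrite (ge0_muleDr _ _ e60); last by rewrite mule_ge0 ?energy_ge0.
rewrite -addeA muleA -!EFinM -EFinD (_ : 2 * 2 = 4 :> R); last by ring.
by rewrite (_ : 2 * (2 * (e / 6)) + 2 * (e / 6) = e)//; field.
Qed.
End limits.
End fourier_transform.

(** * Bessel's inequality *)

Section bessel.
Context d (T : measurableType d) (R : realType).
Variable mu : {measure set T -> \bar R}.
Implicit Types f g h : T -> R[i].
Local Notation Re := complex.Re.
Local Notation Im := complex.Im.

(** The inner product of the underlying real Hilbert space. *)
Definition re_inner f g : R :=
  \int[mu]_x (Re (f x) * Re (g x) + Im (f x) * Im (g x)).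

Lemma integrable_re_inner f g : cLp mu 2%:E f -> cLp mu 2%:E g ->
  mu.-integrable setT (fun x => (Re (f x) * Re (g x) + Im (f x) * Im (g x))%:E).
Proof.
move=> /cLp2P[mf ff] /cLp2P[mg fg].
have [[fr fi] [gr gi]] := (mf, mg).
have msf : measurable_fun setT (fun x => cmodulus (f x) ^+ 2).
  exact/measurable_funX/measurable_cmodulus.
have msg : measurable_fun setT (fun x => cmodulus (g x) ^+ 2).
  exact/measurable_funX/measurable_cmodulus.
apply/integrableP; split.
  by apply/measurable_EFinP; apply: measurable_funD; exact: measurable_funM.
apply: (@le_lt_trans _ _ (1%:E * energy mu f + 1%:E * energy mu g)%E); last first.
  by rewrite !mul1e lte_add_pinfty.
apply: (@ge0_integral_le_comb _ _ _ mu
  (fun x => `|Re (f x) * Re (g x) + Im (f x) * Im (g x)|)) => //.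
- apply: measurableT_comp => //; apply: measurable_funD; exact: measurable_funM.
- by move=> x; exact: sqr_ge0.
- by move=> x; exact: sqr_ge0.
- move=> x; rewrite !mul1r !sqr_cmodulus; case: (f x) => a b; case: (g x) => p q /=.
  have := sqr_ge0 (a - p); have := sqr_ge0 (b - q).
  have := sqr_ge0 (a + p); have := sqr_ge0 (b + q).
  have := sqr_ge0 a; have := sqr_ge0 b; have := sqr_ge0 p; have := sqr_ge0 q.
  rewrite !sqrrB !sqrrD => *; rewrite ler_norml; apply/andP; split; lra.
Qed.

Lemma re_innerC f g : re_inner f g = re_inner g f.
Proof. by apply: eq_Rintegral => x _; ring. Qed.

Definition csub_scale f (c : R) g (x : T) : R[i] :=
  Complex (Re (f x) - c * Re (g x)) (Im (f x) - c * Im (g x)).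

Lemma csub_scale_cLp2 f c g : cLp mu 2%:E f -> cLp mu 2%:E g ->
  cLp mu 2%:E (csub_scale f c g).
Proof.
move=> /cLp2P[mf ff] /cLp2P[mg fg]; have [[fr fi] [gr gi]] := (mf, mg).
have ms : cmeasurable (csub_scale f c g).
  by split; apply: measurable_funB => //; exact: measurable_funM.
apply/cLp2P; split => //.
apply: (@le_lt_trans _ _ (2%:E * energy mu f + (2 * c ^+ 2)%:E * energy mu g)%E); last first.
  by rewrite lte_add_pinfty// lte_mul_pinfty// lee_fin mulr_ge0// sqr_ge0.
apply: ge0_integral_le_comb => //.
- by rewrite mulr_ge0// sqr_ge0.
- exact/measurable_funX/measurable_cmodulus.
- exact/measurable_funX/measurable_cmodulus.
- exact/measurable_funX/measurable_cmodulus.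
- by move=> x; exact: sqr_ge0.
- by move=> x; exact: sqr_ge0.
- by move=> x; exact: sqr_ge0.
- move=> x; rewrite !sqr_cmodulus /csub_scale/=.
  case: (f x) => a b; case: (g x) => p q /=.
  by have := sqrB_le2 a (c * p); have := sqrB_le2 b (c * q); rewrite !exprMn; lra.
Qed.

Lemma re_inner_subl f c g h : cLp mu 2%:E f -> cLp mu 2%:E g -> cLp mu 2%:E h ->
  re_inner (csub_scale f c g) h = re_inner f h - c * re_inner g h.
Proof.
move=> f2 g2 h2; have [ifh igh] := (integrable_re_inner f2 h2, integrable_re_inner g2 h2).
rewrite /re_inner -RintegralZl// -RintegralB//; last exact: (integrableZl measurableT c igh).
by apply: eq_Rintegral => x _; rewrite /csub_scale /=; ring.
Qed.

(** Removing the component along one vector lowers [re_inner f f] by the square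
    of its coefficient and leaves the other coefficients unchanged. *)
Lemma bessel (g : nat -> T -> R[i]) (F : seq nat) f : uniq F ->
    (forall n, n \in F -> cLp mu 2%:E (g n)) ->
    (forall n m, n \in F -> m \in F -> re_inner (g n) (g m) = (n == m)%:R) ->
    cLp mu 2%:E f ->
  \sum_(n <- F) (re_inner f (g n)) ^+ 2 <= re_inner f f.
Proof.
elim: F f => [|n F IH] f uF g2 gF f2.
  rewrite big_nil; apply: Rintegral_ge0 => x _.
  by rewrite -!expr2 addr_ge0// sqr_ge0.
move: uF => /= /andP[nF uF].
have n2 : cLp mu 2%:E (g n) by apply: g2; rewrite inE eqxx.
pose c := re_inner f (g n); pose f' := csub_scale f c (g n).
have f'2 : cLp mu 2%:E f' by exact: csub_scale_cLp2.
have E m : m \in F -> re_inner f' (g m) = re_inner f (g m).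
  move=> mF; have m2 : cLp mu 2%:E (g m) by apply: g2; rewrite inE mF orbT.
  rewrite /f' re_inner_subl// gF ?inE ?eqxx ?mF ?orbT//.
  rewrite (_ : (n == m) = false); first by rewrite mulr0 subr0.
  by apply/negbTE; apply: contra nF => /eqP ->.
have E0 : re_inner f' f' = re_inner f f - c ^+ 2.
  rewrite {1}/f' re_inner_subl// (re_innerC f f') (re_innerC (g n) f').
  rewrite /f' !re_inner_subl// gF ?inE ?eqxx// (re_innerC (g n) f) -/c.
  by rewrite mulr1 subrr mulr0 subr0 expr2.
have := IH f' uF _ _ f'2.
rewrite big_cons E0 -/c lerBrDl => h; apply: le_trans (h _ _).
- by rewrite lerD2l le_eqVlt; apply/orP; left; apply/eqP;
    apply: eq_big_seq => m mF; rewrite E.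
- by move=> m mF; apply: g2; rewrite inE mF orbT.
- by move=> m k mF kF; apply: gF; rewrite inE ?mF ?kF orbT.
Qed.

Lemma orthonormal_re_inner (J : set nat) (g : nat -> T -> R[i]) n m :
  orthonormal_on mu J g -> J n -> J m -> re_inner (g n) (g m) = (n == m)%:R.
Proof.
move=> og Jn Jm; have := congr1 (@complex.Re R) (og n m Jn Jm).
rewrite /cinner /cintegral/= => E; rewrite /re_inner.
transitivity (\int[mu]_x Re (g n x * (g m x)^*%C)).
  apply: eq_Rintegral => x _; case: (g n x) => a b; case: (g m x) => p q /=.
  by ring.
by rewrite E; case: (n == m).
Qed.

Lemma re_inner_energy f : cLp mu 2%:E f -> energy mu f = (re_inner f f)%:E.
Proof.
move=> f2; rewrite /re_inner /Rintegral fineK; last first.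
  by apply: integrable_fin_num => //; exact: integrable_re_inner.
by apply: eq_integral => x _; rewrite sqr_cmodulus !expr2.
Qed.

End bessel.

(** * Energy outside cubes under domination *)

Lemma integral_EFin_indic d (T : measurableType d) (R : realType)
    (mu : {measure set T -> \bar R}) (A : set T) (g : T -> R) :
  (\int[mu]_(x in A) (g x)%:E = \int[mu]_x (\1_A x * g x)%:E)%E.
Proof.
rewrite [LHS]integral_mkcond; apply: eq_integral => x _.
by rewrite /patch indicE; case: (x \in A); rewrite ?mul1r ?mul0r.
Qed.

Section rihaczek_domination.
Context {R : realType}.
Variable d : nat.
Notation E := (euclid R d).
Notation mu := (lebesgue_tuple R d).
Notation mu2 := ((mu \x mu)%E).
Local Notation Re := complex.Re.
Local Notation Im := complex.Im.

Lemma cmodulus_cexpi (t : R) : cmodulus (cexpi t) = 1.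
Proof. by rewrite /cmodulus /cexpi /= cos2Dsin2 sqrtr1. Qed.

Lemma cmodulus_rihaczek (f : E -> R[i]) z :
  cmodulus (rihaczek f z) = cmodulus (f z.1) * cmodulus (fourier2 f z.2).
Proof.
rewrite /rihaczek /cmodulus !ComplexField.Normc.normcM -!/(cmodulus _).
rewrite cmodulus_cexpi mul1r; congr (_ * _).
by case: (fourier2 f z.2) => a b; rewrite /cmodulus /= sqrrN.
Qed.

Section one_function.
Variables (f h : E -> R[i]) (phi : E * E -> R[i]).
Hypotheses (mf : cmeasurable f) (mh : cmeasurable h) (mphi : cmeasurable phi).
Hypothesis fh_le : {ae mu2, forall z, cmodulus (f z.1) * cmodulus (h z.2) <= cmodulus (phi z)}.

(** Product weights turn the almost everywhere domination on the product space
    into a bound on energies. *)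
Lemma weighted_energy_prod_le (al be : E -> R) :
    measurable_fun setT al -> measurable_fun setT be ->
    (forall x, 0 <= al x) -> (forall w, 0 <= be w) ->
  (\int[mu]_x (al x * cmodulus (f x) ^+ 2)%:E * \int[mu]_w (be w * cmodulus (h w) ^+ 2)%:E <=
   \int[mu2]_z (al z.1 * be z.2 * cmodulus (phi z) ^+ 2)%:E)%E.
Proof.
move=> mal mbe al0 be0.
pose u x := al x * cmodulus (f x) ^+ 2; pose v w := be w * cmodulus (h w) ^+ 2.
have mU : measurable_fun setT u by apply: measurable_funM => //; exact/measurable_funX/measurable_cmodulus.
have mV : measurable_fun setT v by apply: measurable_funM => //; exact/measurable_funX/measurable_cmodulus.
have u0 x : 0 <= u x by rewrite mulr_ge0// sqr_ge0.
have v0 w : 0 <= v w by rewrite mulr_ge0// sqr_ge0.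
have mUV : measurable_fun setT (fun z : E * E => u z.1 * v z.2).
  by apply: measurable_funM; [exact: measurable_comp_fst|exact: measurable_comp_snd].
have -> : (\int[mu]_x (al x * cmodulus (f x) ^+ 2)%:E * \int[mu]_w (be w * cmodulus (h w) ^+ 2)%:E =
    \int[mu2]_z (u z.1 * v z.2)%:E)%E.
  rewrite fubini_tonelli1; [|exact/measurable_EFinP|by move=> z; rewrite lee_fin mulr_ge0].
  rewrite -ge0_integralZr//.
  - apply: eq_integral => x _; rewrite /fubini_F/=.
    under [RHS]eq_integral do rewrite EFinM.
    rewrite ge0_integralZl//; first exact/measurable_EFinP.
    + by move=> w _; rewrite lee_fin.
    + by rewrite lee_fin.
  - exact/measurable_EFinP.
  - by move=> x _; rewrite lee_fin; exact: u0.
  - by apply: integral_ge0 => w _; rewrite lee_fin; exact: v0.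
apply: ae_ge0_le_integral => //.
- by move=> z _; rewrite lee_fin mulr_ge0.
- exact/measurable_EFinP.
- by move=> z _; rewrite lee_fin mulr_ge0 ?sqr_ge0// mulr_ge0.
- apply/measurable_EFinP; apply: measurable_funM.
    by apply: measurable_funM; [exact: measurable_comp_fst|exact: measurable_comp_snd].
  exact/measurable_funX/measurable_cmodulus.
- apply: filterS fh_le => z fhz _; rewrite lee_fin /u /v.
  rewrite (_ : _ * _ * _ = al z.1 * be z.2 * (cmodulus (f z.1) * cmodulus (h z.2)) ^+ 2); last by ring.
  by rewrite ler_wpM2l ?mulr_ge0// ler_sqr// nnegrE ?mulr_ge0 ?cmodulus_ge0.
Qed.

Definition square (m : nat) : set (E * E) := cube m `*` cube m.

Let tail m : \bar R := (\int[mu2]_(z in ~` @square m) (cmodulus (phi z) ^+ 2)%:E)%E.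

Let mC m : measurable (~` (cube m : set E)).
Proof. by apply: measurableC; exact: measurable_cube. Qed.

Let tail_bound m (al be : E -> R) :
    measurable_fun setT al -> measurable_fun setT be ->
    (forall x, 0 <= al x) -> (forall w, 0 <= be w) ->
    (forall z, al z.1 * be z.2 <= \1_(~` @square m) z) ->
  (\int[mu2]_z (al z.1 * be z.2 * cmodulus (phi z) ^+ 2)%:E <= tail m)%E.
Proof.
move=> mal mbe al0 be0 ab; rewrite /tail [leRHS]integral_EFin_indic.
have mp : measurable_fun setT (fun z => cmodulus (phi z) ^+ 2).
  exact/measurable_funX/measurable_cmodulus.
have mS : measurable (~` @square m).
  by apply: measurableC; apply: measurableX; exact: measurable_cube.
apply: ge0_le_integral_EFin.
- apply: measurable_funM => //.
  by apply: measurable_funM; [exact: measurable_comp_fst|exact: measurable_comp_snd].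
- by apply: measurable_funM => //; exact: measurable_indic.
- move=> z; rewrite mulr_ge0 ?sqr_ge0 ?mulr_ge0//=.
  by rewrite ler_wpM2r// sqr_ge0.
Qed.

Let mI m : measurable_fun setT (\1_(~` (cube m : set E)) : E -> R).
Proof. exact: measurable_indic. Qed.

Let m1 : measurable_fun setT (cst 1 : E -> R). Proof. exact: measurable_cst. Qed.

Let I0 m (x : E) : 0 <= (\1_(~` cube m) x : R). Proof. by rewrite indicE. Qed.

Let one0 (x : E) : 0 <= (cst 1 x : R). Proof. exact: ler01. Qed.

Lemma tail_energy_le m :
  (\int[mu]_(x in ~` cube m) (cmodulus (f x) ^+ 2)%:E * energy mu h <= tail m)%E.
Proof.
apply: (@le_trans _ _ (\int[mu2]_z (\1_(~` cube m) z.1 * cst 1 z.2 * cmodulus (phi z) ^+ 2)%:E)%E).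
  apply: le_trans (weighted_energy_prod_le (mI m) m1 (I0 m) one0).
  rewrite integral_EFin_indic; apply: lee_wpmul2l; last first.
    by rewrite le_eqVlt; apply/orP; left; apply/eqP; apply: eq_integral => w _; rewrite mul1r.
  by apply: integral_ge0 => x _; rewrite lee_fin mulr_ge0// sqr_ge0.
apply: tail_bound => // z; rewrite /= mulr1 !indicE; case: (boolP (z.1 \in _)) => // zC.
by rewrite mem_set// => -[]; move: zC; rewrite inE.
Qed.

Lemma energy_tail_le m :
  (energy mu f * \int[mu]_(w in ~` cube m) (cmodulus (h w) ^+ 2)%:E <= tail m)%E.
Proof.
apply: (@le_trans _ _ (\int[mu2]_z (cst 1 z.1 * \1_(~` cube m) z.2 * cmodulus (phi z) ^+ 2)%:E)%E).
  apply: le_trans (weighted_energy_prod_le m1 (mI m) one0 (I0 m)).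
  rewrite integral_EFin_indic; apply: lee_wpmul2r.
    by apply: integral_ge0 => x _; rewrite lee_fin mulr_ge0// sqr_ge0.
  by rewrite le_eqVlt; apply/orP; left; apply/eqP; apply: eq_integral => w _; rewrite mul1r.
apply: tail_bound => // z; rewrite /= mul1r !indicE; case: (boolP (z.2 \in _)) => // zC.
by rewrite mem_set// => -[_]; move: zC; rewrite inE.
Qed.

End one_function.
End rihaczek_domination.

(** * Counting the functions *)

Section bessel_on_cubes.
Context {R : realType}.
Variable d : nat.
Notation E := (euclid R d).
Notation mu := (lebesgue_tuple R d).
Local Notation Re := complex.Re.
Local Notation Im := complex.Im.

Lemma energy_cut_unimodular (B : set E) (v : E -> R[i]) : measurable B ->
    cmeasurable v -> (forall x, cmodulus (v x) = 1) ->
  energy mu (cut B v) = mu B.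
Proof.
move=> mB mv v1; rewrite -[X in _ = mu X]setIT -integral_indic//.
apply: eq_integral => x _; rewrite cmodulus_cut v1 mulr1 indicE.
by case: (x \in B); rewrite ?expr1n ?expr0n.
Qed.

(** The real and imaginary parts of the transform at [w] are the real
    coefficients of [g n] on two unimodular functions cut to [B], each of energy
    [mu B]. *)
Lemma sum_fourier1_cut_le (J : set nat) (g : nat -> E -> R[i]) (B : set E) (F : seq nat) w :
    (forall n, J n -> cLp mu 2%:E (g n)) -> orthonormal_on mu J g ->
    measurable B -> (mu B < +oo)%E -> uniq F -> (forall n, n \in F -> J n) ->
  \sum_(n <- F) cmodulus (fourier1 (cut B (g n)) w) ^+ 2 <= 2 * fine (mu B).
Proof.
move=> hg og mB Bfin uF FJ.
have mc : measurable_fun setT (fun x : E => cos (angle x w)).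
  exact: (measurableT_comp measurable_cosR (measurable_angle_l w)).
have ms : measurable_fun setT (fun x : E => sin (angle x w)).
  exact: (measurableT_comp measurable_sinR (measurable_angle_l w)).
(* exp (i angle) and its product with i *)
pose v1 (x : E) : R[i] := Complex (cos (angle x w)) (sin (angle x w)).
pose v2 (x : E) : R[i] := Complex (- sin (angle x w)) (cos (angle x w)).
have mv1 : cmeasurable v1 by [].
have mv2 : cmeasurable v2 by split => //; exact: measurable_funN.
have n1 x : cmodulus (v1 x) = 1 by rewrite /cmodulus /= cos2Dsin2 sqrtr1.
have n2 x : cmodulus (v2 x) = 1 by rewrite /cmodulus /= sqrrN addrC cos2Dsin2 sqrtr1.
have L2 v : cmeasurable v -> (forall x, cmodulus (v x) = 1) -> cLp mu 2%:E (cut B v).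
  move=> mv nv; apply/cLp2P; split; first exact: cmeasurable_cut.
  by rewrite energy_cut_unimodular.
have bes v : cmeasurable v -> (forall x, cmodulus (v x) = 1) ->
    \sum_(n <- F) re_inner mu (cut B v) (g n) ^+ 2 <= fine (mu B).
  move=> mv nv; have v2' := L2 v mv nv.
  have := bessel uF (fun n nF => hg n (FJ n nF))
    (fun n m nF mF => orthonormal_re_inner og (FJ n nF) (FJ m mF)) v2'.
  by move=> h; apply: le_trans h _; rewrite -(energy_cut_unimodular mB mv nv) (re_inner_energy v2').
have -> : \sum_(n <- F) cmodulus (fourier1 (cut B (g n)) w) ^+ 2 =
    \sum_(n <- F) re_inner mu (cut B v1) (g n) ^+ 2 +
    \sum_(n <- F) re_inner mu (cut B v2) (g n) ^+ 2.
  rewrite -big_split; apply: eq_bigr => n _.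
  rewrite sqr_cmodulus fourier1E /=.
  congr (_ ^+ 2 + _ ^+ 2); apply: eq_Rintegral => x _;
    by rewrite /oscillatory !(cut_ReIm _ _ _).1 !(cut_ReIm _ _ _).2 /=; ring.
by rewrite mulr_natl mulr2n lerD// bes.
Qed.

End bessel_on_cubes.
Theorem corollary3p3 (R : realType) (d : nat) (hd : (0 < d)%N)
    (phi : euclid R d * euclid R d -> R[i])
    (hphi : cLp (lebesgue_tuple R d \x lebesgue_tuple R d)%E 2%:E phi)
    (J : set nat) (g : nat -> euclid R d -> R[i])
    (hg : forall n, J n -> cLp (lebesgue_tuple R d) 2%:E (g n))
    (hortho : orthonormal_on (lebesgue_tuple R d) J g)
    (hdom : forall n, J n ->
      {ae (lebesgue_tuple R d \x lebesgue_tuple R d)%E,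
        forall z, cmodulus (rihaczek (g n) z) <= cmodulus (phi z)}) :
  finite_set J.
Proof.
pose mu := lebesgue_tuple R d.
have /cLp2P[mphi phifin] := hphi.
have gE n : J n -> energy mu (g n) = 1%E.
  move=> Jn; rewrite (re_inner_energy (hg n Jn)).
  by rewrite (orthonormal_re_inner hortho Jn Jn) eqxx.
have gh n : J n -> is_fourier2 (g n) (fourier2 (g n)).
  move=> Jn; have [h hP] := fourier2_exists (hg n Jn).
  rewrite /fourier2; case: xgetP => [y _ //|/(_ h)].
  by move=> /(_ hP).
have mS m : measurable (@square R d m) by apply: measurableX; exact: measurable_cube.
(* With a tail of at most t outside the cube, the steps below give
   1/4 <= 2 Q n + 32 t + t, so t = 1/256 leaves Q n above 1/20. *)
have [m tail_m] : exists m, (\int[(mu \x mu)%E]_(z in ~` @square R d m)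
    (cmodulus (phi z) ^+ 2)%:E <= (16^-1 ^+ 2)%:E)%E.
  have tc := @tail_cvg0 _ _ R (mu \x mu)%E (@square R d) (fun z => (cmodulus (phi z) ^+ 2)%:E) mS.
  have {tc} : (fun m => \int[(mu \x mu)%E]_(z in ~` @square R d m)
      (cmodulus (phi z) ^+ 2)%:E)%E @ \oo --> 0%E.
    apply: tc => //.
    - move=> z; have := cube_absorbs z.1; have := cube_absorbs z.2.
      by move=> h2 h1; near=> k; split; near: k.
    - exact/measurable_EFinP/measurable_funX/measurable_cmodulus.
    - by move=> z; rewrite lee_fin sqr_ge0.
  have t0 k : (0 <= \int[(mu \x mu)%E]_(z in ~` @square R d k) (cmodulus (phi z) ^+ 2)%:E)%E.
    by apply: integral_ge0 => z _; rewrite lee_fin sqr_ge0.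
  move/cvge0P => /(_ t0 (16^-1 ^+ 2)); rewrite exprn_gt0 ?invr_gt0// => /(_ isT)[N _ hN].
  by exists N; exact: (hN N (leqnn N)).
pose B : set (euclid R d) := cube m.
have mB : measurable B by exact: measurable_cube.
have Bfin : (mu B < +oo)%E by exact: cube_lty.
pose Q n := (\int[mu]_(w in B) (cmodulus (fourier1 (cut B (g n)) w) ^+ 2)%:E)%E.
have Q_ge n : J n -> ((20^-1)%:E <= Q n)%E.
  move=> Jn; have fh := gh n Jn; set h := fourier2 (g n) in fh *.
  have /cLp2P[mg _] := hg n Jn; have [_ /cLp2P[mh _] _] := fh.
  have dom : {ae (mu \x mu)%E, forall z,
      cmodulus (g n z.1) * cmodulus (h z.2) <= cmodulus (phi z)}.
    by apply: filterS (hdom n Jn) => z; rewrite cmodulus_rihaczek.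
  have h_ge : ((4^-1)%:E <= energy mu h)%E.
    have := fourier2_energy_ge fh; rewrite gE// => h1.
    by rewrite -(@lee_pmul2l _ 4%:E)// -EFinM mulfV.
  have tail_g : (\int[mu]_(x in ~` B) (cmodulus (g n x) ^+ 2)%:E <= (8^-1 ^+ 2)%:E)%E.
    have t1 := le_trans (tail_energy_le mg mh mphi dom m) tail_m.
    have t2 : (\int[mu]_(x in ~` B) (cmodulus (g n x) ^+ 2)%:E * (4^-1)%:E <= (16^-1 ^+ 2)%:E)%E.
      apply: le_trans t1; apply: lee_wpmul2l => //.
      by apply: integral_ge0 => x _; rewrite lee_fin sqr_ge0.
    rewrite -(@lee_pmul2r _ (4^-1)%:E)// ?lte_fin ?invr_gt0// (le_trans t2)//.
    by rewrite -EFinM lee_fin; lra.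
  have tail_h : (\int[mu]_(w in ~` B) (cmodulus (h w) ^+ 2)%:E <= (16^-1 ^+ 2)%:E)%E.
    have := le_trans (energy_tail_le mg mh mphi dom m) tail_m.
    by rewrite gE// mul1e.
  pose p := cut B (g n).
  have p1 : cLp mu 1 p by apply: cut_cLp1 => //; exact: hg.
  have p2 : cLp mu 2%:E p by apply: cut_cLp2 => //; exact: hg.
  have mq := fourier1_measurable p1.
  have near_h : (energy mu (fourier1 p \- h) <= (16^-1)%:E)%E.
    apply: (le_trans (fourier2_energyB_le fh p1 p2)).
    rewrite energy_cut//; apply: (@le_trans _ _ (4%:E * (8^-1 ^+ 2)%:E)%E).
      exact: lee_wpmul2l.
    by rewrite -EFinM lee_fin; lra.
  have h_split : (energy mu h = \int[mu]_(w in B) (cmodulus (h w) ^+ 2)%:E +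
      \int[mu]_(w in ~` B) (cmodulus (h w) ^+ 2)%:E)%E.
    rewrite -ge0_integral_setU ?setUv//.
    - exact: measurableC.
    - exact/measurable_EFinP/measurable_funX/measurable_cmodulus.
    - by move=> w _; rewrite lee_fin sqr_ge0.
    - exact/disj_setPCl.
  have in_B : (\int[mu]_(w in B) (cmodulus (h w) ^+ 2)%:E <= 2%:E * Q n + 2%:E * (16^-1)%:E)%E.
    apply: (@le_trans _ _ (2%:E * Q n + 2%:E * energy mu (fourier1 p \- h))%E); last first.
      by rewrite leeD2l// lee_wpmul2l.
    rewrite /Q !(integral_EFin_indic _ B); apply: ge0_integral_le_comb => //.
    - by apply: measurable_funM; [exact: measurable_indic|exact/measurable_funX/measurable_cmodulus].
    - by apply: measurable_funM; [exact: measurable_indic|exact/measurable_funX/measurable_cmodulus].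
    - by apply/measurable_funX/measurable_cmodulus; exact: cmeasurableB.
    - by move=> w; rewrite mulr_ge0 ?sqr_ge0// indicE.
    - by move=> w; rewrite mulr_ge0 ?sqr_ge0// indicE.
    - by move=> w; exact: sqr_ge0.
    - move=> w /=; have hw := sqr_cmodulusB_le (fourier1 p w) (fourier1 p w - h w).
      have e0 := sqr_ge0 (cmodulus (fourier1 p w - h w)).
      rewrite indicE; case: (w \in B); rewrite ?mulr1n ?mulr0n ?mul1r ?mul0r ?mulr0 ?add0r.
        by move: hw; rewrite opprB addrC subrK.
      by rewrite mulr_ge0.
  have : ((4^-1)%:E <= 2%:E * Q n + 2%:E * (16^-1)%:E + (16^-1 ^+ 2)%:E)%E.
    by apply: (le_trans h_ge); rewrite h_split leeD.
  case: (Q n) => [q| |].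
  - by rewrite -!EFinM -!EFinD !lee_fin => hq; lra.
  - by rewrite leey.
  - by rewrite mulrNy gtr0_sg// mul1e.
have count (F : seq nat) : uniq F -> (forall n, n \in F -> J n) ->
    (size F)%:R <= 40 * fine (mu B) ^+ 2.
  move=> uF FJ.
  have mQ n : n \in F -> measurable_fun B (fun w => (cmodulus (fourier1 (cut B (g n)) w) ^+ 2)%:E).
    move=> nF; apply: measurable_funTS; apply/measurable_EFinP/measurable_funX/measurable_cmodulus.
    by apply: fourier1_measurable; apply: cut_cLp1 => //; exact: hg (FJ n nF).
  have muBE : mu B = (fine (mu B))%:E by rewrite fineK// ge0_fin_numE.
  pose G n w : \bar R := if n \in F then (cmodulus (fourier1 (cut B (g n)) w) ^+ 2)%:E else 0%E.
  have mG n : measurable_fun B (G n).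
    by rewrite /G; case: (boolP (n \in F)) => nF; [exact: mQ|exact: measurable_cst].
  have G0 n w : (0 <= G n w)%E by rewrite /G; case: ifP => // _; rewrite lee_fin sqr_ge0.
  have sum_le : (\sum_(n <- F) Q n <= (2 * fine (mu B) * fine (mu B))%:E)%E.
    have -> : (\sum_(n <- F) Q n = \int[mu]_(w in B) \sum_(n <- F) G n w)%E.
      rewrite ge0_integral_sum//; apply: eq_big_seq => n nF.
      by apply: eq_integral => w _; rewrite /G nF.
    apply: (@le_trans _ _ (\int[mu]_(w in B) (2 * fine (mu B))%:E)%E).
      apply: ge0_le_integral => //.
      - by move=> w _; exact: sume_ge0.
      - exact: emeasurable_sum.
      - move=> w _; rewrite (eq_big_seq (fun n => (cmodulus (fourier1 (cut B (g n)) w) ^+ 2)%:E)).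
          by rewrite sumEFin lee_fin; exact: sum_fourier1_cut_le hg hortho mB Bfin uF FJ.
        by move=> n nF; rewrite /G nF.
    by rewrite integral_cst// [X in (_ * X)%E]muBE -EFinM.
  have sum_ge : (((size F)%:R * 20^-1)%:E <= \sum_(n <- F) Q n)%E.
    have : forall n, n \in F -> ((20^-1)%:E <= Q n)%E by move=> n /FJ; exact: Q_ge.
    elim: (F) => [_|n s IH QF]; first by rewrite big_nil mul0r.
    rewrite big_cons /= -add1n natrD mulrDl mul1r EFinD leeD//.
      by apply: QF; rewrite inE eqxx.
    by apply: IH => k ks; apply: QF; rewrite inE ks orbT.
  have := le_trans sum_ge sum_le; rewrite lee_fin expr2.
  by set r := fine _; set s := _%:R; lra.
apply: contrapT => Jinf.
have [K hK] : exists K : nat, 40 * fine (mu B) ^+ 2 < K%:R.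
  exists (Num.truncn (40 * fine (mu B) ^+ 2)).+1; exact: truncnS_gt.
have [F FJ KF] := infinite_set_fset K Jinf.
have := count (finmap.enum_fset F) (finmap.fset_uniq F) (fun n nF => FJ n nF).
apply/negP; rewrite -ltNge (lt_le_trans hK)// ler_nat.
exact: KF.
Unshelve. all: by end_near. Qed.
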